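(* Fix $s\ge3$ and let $\mathcal{U}$ be a monster model of $T^2_s$; let $p_E\in S_1(\mathcal{U})$ be the unique type containing $\neg E(x,b)$ for all $b\in\mathcal{U}$. Then: (a) $\mathfrak{M}^{\mathrm{fam}}_1(\mathcal{U})=\mathfrak{M}^{\mathrm{dfs}}_1(\mathcal{U})=\{rp_E+(1-r)\mu:\mu\in\mathfrak{M}^{\mathrm{tr}}_1(\mathcal{U}),\ r\in[0,1]\}$; (b) $\mathfrak{M}^{\mathrm{fim}}_1(\mathcal{U})=\mathfrak{M}^{\mathrm{tr}}_1(\mathcal{U})$.
   Context: $T^2_s$ is the theory of the Fraïssé limit of finite $K_s$-free graphs in the language $\{E\}$. $\mathfrak{M}_1(\mathcal{U})$ is the space of Keisler measures in one variable over $\mathcal{U}$ ($p_E$ is regarded as a $\{0,1\}$-valued measure). $\mathfrak{M}^{\mathrm{tr}}_1$: trivial measures, i.e. $\sum_k r_k\delta_{a_k}$ with $a_k\in\mathcal{U}$, $\sum r_k=1$, $\delta_a$ the Dirac measure. $\mathfrak{M}^{\mathrm{dfs}}_1$: measures definable over and finitely satisfiable in some small model $M$ (definable: $\{b:\mu(\phi(x;b))\in C\}$ type-definable over $M$ for each formula $\phi(x;y)$ and closed $C\subseteq[0,1]$; finitely satisfiable: every formula of positive measure realized in $M$). $\mathfrak{M}^{\mathrm{fam}}_1$: finitely approximated measures, i.e. there is a small $M$ such that for every formula $\phi(x;y)$ and $\epsilon>0$ there are $a_1,\dots,a_n\in M$ with $|\mu(\phi(x;b))-\frac1n|\{i:\models\phi(a_i;b)\}||<\epsilon$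 for all $b$. $\mathfrak{M}^{\mathrm{fim}}_1$: frequency interpretation measures, i.e. $\mu$ such that for each $\mathcal{L}$-formula $\phi(x;y)$ there are $\mathcal{L}(\mathcal{U})$-formulas $\theta_n(x_1,\dots,x_n)$ with (1) for each $\epsilon>0$ some $n_\epsilon$ such that for $n\ge n_\epsilon$, $\bar a\models\theta_n$ and all $b$, $|\mu(\phi(x;b))-\operatorname{Av}_{\bar a}(\phi(x;b))|<\epsilon$, and (2) $\mu^{(n)}(\theta_n)\to1$, where $\mu^{(n)}$ is the $n$-fold Morley product $\mu\otimes\cdots\otimes\mu$ (defined for definable $\mu$ by $(\mu\otimes\nu)(\phi(x,y))=\int F^\phi_\mu\,d\nu$, $F^\phi_\mu(\operatorname{tp}(b/N))=\mu(\phi(x;b))$). *)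

(* Defs.v *)
From HB Require Import structures.
From mathcomp Require Import all_boot all_order all_algebra.
From mathcomp Require Import all_classical all_reals all_analysis.
Set Implicit Arguments.
Unset Strict Implicit.
Unset Printing Implicit Defensive.
Import Order.TTheory GRing.Theory Num.Theory.
Import numFieldNormedType.Exports.
Local Open Scope classical_set_scope.
Local Open Scope ring_scope.

(* First-order logic with equality in the language {E}.  A term of type
   [fmla n] is a formula whose free variables are among x_0, ..., x_(n-1);
   [Fall] binds variable 0 and shifts the others by one. *)
Inductive fmla : nat -> Type :=
| Fbot n : fmla n
| Feq n (i j : 'I_n) : fmla n
| Fedge n (i j : 'I_n) : fmla n
| Fimp n (phi psi : fmla n) : fmla n
| Fall n (phi : fmla n.+1) : fmla n.

(* concatenation (x, y) of two tuples *)
Definition catf (T : Type) m n (x : 'I_m -> T) (y : 'I_n -> T) (i : 'I_(m + n)) : T :=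
  match fintype.split i with inl j => x j | inr k => y k end.

Definition pt (T : Type) (a : T) : 'I_1 -> T := fun=> a.

Fixpoint sat (T : Type) (E : T -> T -> Prop) n (phi : fmla n) : ('I_n -> T) -> Prop :=
  match phi in fmla k return ('I_k -> T) -> Prop with
  | Fbot _ => fun=> False
  | Feq _ i j => fun v => v i = v j
  | Fedge _ i j => fun v => E (v i) (v j)
  | Fimp _ phi psi => fun v => sat E phi v -> sat E psi v
  | Fall _ phi => fun v => forall a : T, sat E phi (catf (pt a) v)
  end.

Record structure := Structure {
  carrier :> Type ;
  edge : carrier -> carrier -> Prop ;
  carrier_inhabited : inhabited carrier }.

Definition models (F : structure) (phi : fmla 0) : Prop :=
  forall v : 'I_0 -> F, sat (@edge F) phi v.

(* Classes of finite {E}-structures, given on the carriers 'I_n. *)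
Definition finite_class := forall n, ('I_n -> 'I_n -> Prop) -> Prop.

Definition age (F : structure) : finite_class := fun n e =>
  exists2 f : 'I_n -> F, injective f & forall i j, edge (f i) (f j) <-> e i j.

Definition automorphism (F : structure) (sigma : F -> F) : Prop :=
  bijective sigma /\ forall x y, edge (sigma x) (sigma y) <-> edge x y.

Definition ultrahomogeneous (F : structure) : Prop :=
  forall n (a b : 'I_n -> F),
    (forall i j, a i = a j <-> b i = b j) ->
    (forall i j, edge (a i) (a j) <-> edge (b i) (b j)) ->
    exists2 sigma : F -> F, automorphism sigma & forall i, sigma (a i) = b i.

Definition fraisse_limit (K : finite_class) (F : structure) : Prop :=
  [/\ countable [set: F], ultrahomogeneous F & forall n e, age F e <-> @K n e].

Definition Ks_free_graph (s : nat) : finite_class := fun n e =>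
  [/\ forall i, ~ e i i, forall i j, e i j -> e j i &
      ~ exists f : 'I_s -> 'I_n, forall i j, i != j -> e (f i) (f j)].

(* The complete theory of the Fraisse limit of the finite K_s-free graphs,
   which is unique up to isomorphism. *)
Definition T2 (s : nat) : set (fmla 0) :=
  [set phi | forall F, fraisse_limit (Ks_free_graph s) F -> models F phi].

Section model_theory.
Variable U : structure.

(* The subset of U^n defined by phi(x; b), where phi is an L-formula. *)
Definition inst n m (phi : fmla (n + m)) (b : 'I_m -> U) : set ('I_n -> U) :=
  [set x | sat (@edge U) phi (catf x b)].

(* L(A)-formulas in n variables are identified with the subsets of U^n which
   they define; L(U)-formulas are the case A = setT. *)
Definition definable_over (A : set U) n : set (set ('I_n -> U)) :=
  [set D | exists m (phi : fmla (n + m)) (c : 'I_m -> U),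
             (forall j, A (c j)) /\ D = inst phi c].

Definition type_definable_over (A : set U) n (S : set ('I_n -> U)) : Prop :=
  exists2 G : set (set ('I_n -> U)),
    G `<=` definable_over A (n := n) & S = \bigcap_(D in G) D.

Definition is_complete_type (A : set U) n (p : set (set ('I_n -> U))) : Prop :=
  [/\ p `<=` definable_over A (n := n),
      forall k (D : 'I_k -> set ('I_n -> U)), (forall i, p (D i)) ->
        exists a, forall i, D i a &
      forall D, definable_over A D -> p D \/ p (~` D)].

(* S_n(A) *)
Record ctype (A : set U) n := CType {
  in_type : set (set ('I_n -> U)) ;
  ctypeP : is_complete_type A in_type }.

Lemma definable_overC (A : set U) n (D : set ('I_n -> U)) :
  definable_over A D -> definable_over A (~` D).
Proof.
move=> [m [phi [c [Ac ->]]]].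
by exists m, (Fimp phi (Fbot (n + m))), c.
Qed.

Lemma tp_subproof (A : set U) n (b : 'I_n -> U) :
  is_complete_type A [set D | definable_over A D /\ D b].
Proof.
split=> [D []//|k D pD|D dD].
  by exists b => i; case: (pD i).
by have [Db|nDb] := pselect (D b); [left|right; split=> //; exact: definable_overC].
Qed.

Definition tp (A : set U) n (b : 'I_n -> U) : ctype A n := CType (tp_subproof A b).

Lemma carrier_nonempty : exists a : U, True.
Proof. by have [a] := carrier_inhabited U; exists a. Qed.

HB.instance Definition _ (A : set U) n := gen_eqMixin (ctype A n).
HB.instance Definition _ (A : set U) n := gen_choiceMixin (ctype A n).
HB.instance Definition _ (A : set U) n := isPointed.Build (ctype A n)
  (tp A (fun=> sval (cid carrier_nonempty))).

(* The basic clopen sets [D] of the Stone space S_n(A). *)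
Definition clopens (A : set U) n : set (set (ctype A n)) :=
  [set [set q : ctype A n | in_type q D] | D in @definable_over A n].

(* S_n(A) with the sigma-algebra generated by its clopen sets. *)
Definition stone (A : set U) n := g_sigma_algebraType (@clopens A n).

Definition elementary_substructure (M : set U) : Prop :=
  forall n (phi : fmla n) (a : 'I_n -> {x : U | M x}),
    sat (fun x y : {x : U | M x} => edge (sval x) (sval y)) phi a <->
    sat (@edge U) phi (fun i => sval (a i)).

Definition elementary_on (A : set U) (f : U -> U) : Prop :=
  forall n (phi : fmla n) (a : 'I_n -> U), (forall i, A (a i)) ->
    sat (@edge U) phi a <-> sat (@edge U) phi (fun i => f (a i)).

(* In what follows the cardinal kappa is the cardinality of the type K. *)
Variable K : Type.

Definition small (A : set U) : Prop :=
  (A #<= [set: K])%card /\ ~ ([set: K] #<= A)%card.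

Definition small_model (M : set U) : Prop :=
  small M /\ elementary_substructure M.

Definition saturated : Prop :=
  forall (A : set U) n (p : ctype A n), small A -> exists b, p = tp A b.

Definition strongly_homogeneous : Prop :=
  forall (A : set U) (f : U -> U), small A -> elementary_on A f ->
    exists2 sigma : U -> U, automorphism sigma & forall a, A a -> sigma a = f a.

Definition monster (T : set (fmla 0)) : Prop :=
  [/\ forall phi, T phi -> models U phi, ~ countable [set: K],
      saturated & strongly_homogeneous].

End model_theory.

Section keisler_measures.
Variables (R : realType) (U : structure).

(* Finitely additive probability measures on the definable subsets of U^n; the
   value 0 outside the definable sets makes equality of measures mean
   agreement on the definable sets. *)
Record keisler n := Keisler {
  kmeas :> set ('I_n -> U) -> R ;
  kmeas_junk : forall D, ~ definable_over setT D -> kmeas D = 0 ;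
  kmeas_ge0 : forall D, definable_over setT D -> 0 <= kmeas D ;
  kmeas_setT : kmeas setT = 1 ;
  kmeasU : forall D1 D2, definable_over setT D1 -> definable_over setT D2 ->
    D1 `&` D2 = set0 -> kmeas (D1 `|` D2) = kmeas D1 + kmeas D2 }.

Definition is_trivial (mu : keisler 1) : Prop :=
  exists (r : nat -> R) (a : nat -> U),
    [/\ forall k, 0 <= r k, series r @ \oo --> (1 : R) &
        forall D, definable_over setT D ->
          series (fun k => r k * \1_D (pt (a k))) @ \oo --> mu D].

Definition definable_measure_over (M : set U) n (mu : keisler n) : Prop :=
  forall m (phi : fmla (n + m)) (C : set R), closed C -> C `<=` `[0, 1] ->
    type_definable_over M [set b : 'I_m -> U | C (mu (inst phi b))].

Definition finitely_satisfiable_in (M : set U) n (mu : keisler n) : Prop :=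
  forall D, definable_over setT D -> 0 < mu D ->
    exists2 a, D a & forall i, M (a i).

Definition Av n (a : 'I_n -> U) (D : set ('I_1 -> U)) : R :=
  #|[pred i | `[< D (pt (a i)) >]]|%:R / n%:R.

Variable K : Type.

Definition is_dfs (mu : keisler 1) : Prop :=
  exists M : set U, [/\ small_model K M, definable_measure_over M mu &
                        finitely_satisfiable_in M mu].

Definition is_fam (mu : keisler 1) : Prop :=
  exists2 M : set U, small_model K M &
    forall m (phi : fmla (1 + m)) (eps : R), 0 < eps ->
      exists n (a : 'I_n.+1 -> U), (forall i, M (a i)) /\
        forall b : 'I_m -> U, `|mu (inst phi b) - Av a (inst phi b)| < eps.

(* [lam] is the Morley product mu (x) nu, for mu definable over a small model:
   lam(D) is the integral of F over S_n(N) with respect to the measure P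
   induced by nu, where F(tp(b/N)) = mu({x : (x, b) in D}).  By saturation F is
   determined by this equation; it is continuous, so integrating it needs P
   only on the sigma-algebra generated by the clopen sets, where P is
   determined by nu. *)
Definition is_morley_product m n (mu : keisler m) (nu : keisler n)
    (lam : keisler (m + n)) : Prop :=
  forall (D : set ('I_(m + n) -> U)) (M N : set U),
    small_model K M -> definable_measure_over M mu ->
    small_model K N -> M `<=` N -> definable_over N D ->
    exists (P : probability (stone N n) R) (F : stone N n -> R),
      [/\ forall D', definable_over N D' ->
            P [set q : stone N n | in_type q D'] = (nu D')%:E,
          forall b : 'I_n -> U, F (tp N b) = mu [set x | D (catf x b)] &
          (lam D)%:E = (\int[P]_q (F q)%:E)%E].

(* [lam n] is the (n+1)-fold Morley power mu (x) ... (x) mu. *)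
Definition are_morley_powers (mu : keisler 1) (lam : forall n, keisler n.+1) : Prop :=
  lam 0%N = mu /\ forall n, is_morley_product mu (lam n) (lam n.+1).

(* [theta n] is the formula theta_(n+1)(x_1, ..., x_(n+1)). *)
Definition is_fim (mu : keisler 1) : Prop :=
  (exists2 M : set U, small_model K M & definable_measure_over M mu) /\
  exists2 lam : forall n, keisler n.+1, are_morley_powers mu lam &
    forall m (phi : fmla (1 + m)),
    exists theta : forall n, set ('I_n.+1 -> U),
      [/\ forall n, definable_over setT (theta n),
          forall eps : R, 0 < eps -> exists n0, forall n, (n0 <= n)%N ->
            forall a, theta n a -> forall b : 'I_m -> U,
              `|mu (inst phi b) - Av a (inst phi b)| < eps &
          (fun n => lam n (theta n)) @ \oo --> (1 : R)].

End keisler_measures.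

(* Main.v *)
(* Everything reduces to quantifier elimination: modulo a small set of
   parameters a tuple is determined by its equalities and edges, so a
   finitely additive measure on definable subsets of U is determined by its
   values on points and on neighbourhoods N(b).

   Suppose that mu is definable over and finitely satisfiable in M.  Squeeze
   a formula over a finite C in M around { b : mu(N(b)) >= c }; for b outside
   M it also contains some b' outside M whose only neighbours in M are those
   of b in C.  By finite satisfiability N(b') lives on these finitely many
   points, so mu(N(b)) is at most the mass of the atoms in N(b).  A point b of
   M is replaced by a twin outside M with the same neighbours in M.  Hence mu
   minus its atoms gives mass 0 to all points and neighbourhoods, and is a
   multiple of p_E.

   Conversely p_E is finitely approximated because (Erdos and Rogers) there
   are finite K_s-free graphs in which every K_(s-1)-free set has small
   proportion: embed one in a countable model; each trace N(b) on it is
   K_(s-1)-free.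

   A mixture with a p_E-part of weight t > 0 is not fim: for large n, with
   probability bounded below, a sample contains at least tn/2 points off a
   large finite set of atoms, pairwise non-adjacent, and some b is joined to
   all of them but to none of these atoms, so the sample badly misjudges
   N(b).  For a trivial measure the weak law of large numbers for the finitely
   many subsets of a large finite set of atoms provides the formulas
   theta_n. *)
Require Import Defs.
From HB Require Import structures.
From mathcomp Require Import all_boot all_order all_algebra.
From mathcomp Require Import all_classical all_reals all_analysis.
From mathcomp Require Import measurable_realfun lra ring.
Set Implicit Arguments.
Unset Strict Implicit.
Unset Printing Implicit Defensive.
Import Order.TTheory GRing.Theory Num.Theory.
Import numFieldNormedType.Exports.
Local Open Scope classical_set_scope.
Local Open Scope ring_scope.

(** The models constructed here are countable: K is uncountable, so countable sets are small, and
    every countable set lies in a countable elementary substructure. A fim measure is finitely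
    approximated in such a model, one tuple satisfying some theta_n being picked for each formula
    and precision. Hence the decomposition of dfs measures applies to it, and only a p_E-part
    remains to be excluded.

    The obstacle in (b) is that Morley powers are given abstractly. Starting from fim, only lower
    bounds of lam(D) through its fibres are derived; upper bounds come from complements. For trivial
    measures the powers must be exhibited and checked against every small model M over which mu is
    definable; this succeeds because such an M contains all atoms. Their tuples are coded by natural
    numbers, where every set is measurable.

    The sparse graphs carry weights and arise by iterating rho -> rho - rho^2/8 inside an induction
    on the clique size. *)

Definition clique (V : Type) (e : V -> V -> Prop) r (f : 'I_r -> V) :=
  forall i j, i != j -> e (f i) (f j).

(** * K_(r+1)-free graphs all of whose K_r-free sets are light *)

Section clique_sparse.
Variable R : realType.

(** Weights instead of counting let the amalgam below give its two kinds of vertices any proportion;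
    [weighted_average] later turns weights into repetitions in a sample. *)
Definition clique_sparse r (rho : R) := exists (V : finType) (e : rel V) (w : V -> R),
  [/\ irreflexive e /\ symmetric e,
      forall f : 'I_r.+1 -> V, ~ clique e f,
      (forall v, 0 <= w v) /\ \sum_v w v = 1 &
      forall I : pred V, (forall f : 'I_r -> V, clique e f -> ~ forall i, I (f i)) ->
        \sum_(v | I v) w v <= rho].

Lemma clique_sparse_le r (rho rho' : R) :
  rho <= rho' -> clique_sparse r rho -> clique_sparse r rho'.
Proof.
move=> le_rho [V [e [w [Ve Vr Vw VI]]]]; exists V, e, w; split=> // I HI.
exact: le_trans (VI I HI) le_rho.
Qed.

Lemma clique_sparse_point (I : pred unit) :
  \sum_(v | I v) (1 : R) = (I tt)%:R.
Proof. by rewrite big_mkcond /= (bigD1 tt)//= big1 ?addr0; [case: (I tt)|case]. Qed.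

Lemma unit_clique r (f : 'I_r.+2 -> unit) : ~ clique (fun _ _ => false) f.
Proof. by move=> /(_ ord0 ord_max isT). Qed.

Lemma clique_sparse_1 : clique_sparse 1 0.
Proof.
exists unit, (fun _ _ => false), (fun=> 1); split=> //.
- exact: unit_clique.
- by split=> //; rewrite (clique_sparse_point predT).
- move=> I HI; rewrite (clique_sparse_point I) lern0; apply/eqP.
  case E : (I tt) => //; exfalso; apply: (HI (fun=> tt)) => // i j.
  by rewrite !ord1 eqxx.
Qed.

Lemma clique_sparse_trivial r : (0 < r)%N -> clique_sparse r 1.
Proof.
case: r => // r _.
exists unit, (fun _ _ => false), (fun=> 1); split=> //.
- exact: unit_clique.
- by split=> //; rewrite (clique_sparse_point predT).
- by move=> I _; rewrite (clique_sparse_point I); case: (I tt); rewrite ?ler01.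
Qed.

(** A division-free substitute for the exponential bound: 1 - x is at most 1/(1 + x), and the
    product of the 1 + x_i is at least 1 + sum x_i. *)
Lemma prod1B_sum_le1 t (al : 'I_t -> R) : (forall i, 0 <= al i <= 1) ->
  (\prod_i (1 - al i)) * (1 + \sum_i al i) <= 1.
Proof.
elim: t al => [|t IH] al Hal; first by rewrite !big_ord0 addr0 mulr1.
rewrite !big_ord_recl.
have := IH (fun i => al (lift ord0 i)) (fun i => Hal _).
have p0 : 0 <= \prod_(i < t) (1 - al (lift ord0 i)).
  by apply: prodr_ge0 => i _; have := Hal (lift ord0 i); lra.
have s0 : 0 <= \sum_(i < t) al (lift ord0 i).
  by apply: sumr_ge0 => i _; have /andP[] := Hal (lift ord0 i).
set p := \prod_(_ < _) _ in p0 *; set q := \sum_(_ < _) _ in s0 *.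
have := Hal ord0; set a := al ord0 => /andP[a0 a1] le1.
apply: le_trans le1.
suff : (1 - a) * (1 + (a + q)) <= 1 + q by move=> h; have := ler_wpM2l p0 h; lra.
by have := mulr_ge0 a0 s0; nra.
Qed.

Section step.
Variables (r : nat) (V H : finType) (e : rel V) (eH : rel H) (t : nat).
Variables (w : V -> R) (u : H -> R) (la : R).

Definition amalg : finType := ((V * 'I_t) + ({ffun 'I_t -> V} * H))%type.

Definition amalg_rel : rel amalg := fun x y =>
  match x, y with
  | inl (v, i), inl (v', i') => (i == i') && e v v'
  | inl (v, i), inr (f, h) => f i == v
  | inr (f, h), inl (v, i) => f i == v
  | inr (f, h), inr (f', h') => (f == f') && eH h h'
  end.

Definition amalg_weight (x : amalg) : R :=
  match x with
  | inl (v, i) => la * (w v / t%:R)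
  | inr (f, h) => (1 - la) * ((\prod_i w (f i)) * u h)
  end.

Hypotheses (eV_irr : irreflexive e) (eV_sym : symmetric e).
Hypotheses (eH_irr : irreflexive eH) (eH_sym : symmetric eH).
Hypothesis V_free : forall f : 'I_r.+2 -> V, ~ clique e f.
Hypothesis H_free : forall f : 'I_r.+1 -> H, ~ clique eH f.

Lemma amalg_irr : irreflexive amalg_rel.
Proof. by case=> [[v i]|[f h]] /=; rewrite eqxx ?eV_irr ?eH_irr. Qed.

Lemma amalg_sym : symmetric amalg_rel.
Proof.
by case=> [[v i]|[f h]] [[v' i']|[f' h']] //=; rewrite 1?eq_sym 1?eV_sym 1?eH_sym.
Qed.

(** A clique made of old vertices stays in one copy and projects to V. Once there is a new vertex,
    all new vertices belong to one choice g, and there is at most one old vertex: two of them would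
    lie in the same copy and both be the vertex that g chooses there. Deleting one vertex leaves a
    clique of size r + 1 in H. *)
Lemma amalg_free (f : 'I_r.+2 -> amalg) : ~ clique amalg_rel f.
Proof.
move=> Cf.
have [[i0 [[g h] fi0]]|noR] := pselect (exists i0 z, f i0 = inr z); last first.
  have fL i : exists z, f i = inl z.
    by case E : (f i) => [z|z]; [exists z|case: noR; exists i, z].
  pose g i := (sval (cid (fL i))).1.
  apply: (V_free (f := g)) => i j ij; have := Cf i j ij.
  rewrite /g; case: cid => -[v k] /= ->; case: cid => -[v' k'] /= ->.
  by case/andP.
have [j Hj] : exists j, forall i, i != j -> exists h', f i = inr (g, h').
  have [[j [[v k] fj]]|noL] := pselect (exists j z, f j = inl z); last first.
    exists i0 => i ii0; case E : (f i) => [z|[g' h']].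
      by case: noL; exists i, z.
    by have := Cf i i0 ii0; rewrite E fi0 /= => /andP[/eqP -> _]; exists h'.
  exists j => i ij.
  case E : (f i) => [[v' k']|[g' h']].
    have ni0 : i != i0 by apply/eqP => ii; move: E; rewrite ii fi0.
    have nj0 : j != i0 by apply/eqP => ii; move: fj; rewrite ii fi0.
    have := Cf i j ij; rewrite E fj /= => /andP[/eqP kk evv].
    have := Cf i i0 ni0; rewrite E fi0 /= => /eqP gk.
    have := Cf j i0 nj0; rewrite fj fi0 /= => /eqP gk'.
    by move: evv; rewrite -gk -gk' kk eV_irr.
  have [ii0|ii0] := eqVneq i i0; first by exists h; rewrite -E ii0.
  by have := Cf i i0 ii0; rewrite E fi0 /= => /andP[/eqP -> _]; exists h'.
have Hl i : exists h', f (lift j i) = inr (g, h') by apply: Hj; rewrite eq_sym neq_lift.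
apply: (H_free (f := fun i => sval (cid (Hl i)))) => i k ik.
have := Cf (lift j i) (lift j k); rewrite (inj_eq lift_inj) => /(_ ik).
by case: cid => h1 /= ->; case: cid => h2 /= -> /andP[].
Qed.

Lemma sum_amalg (I : pred amalg) :
  \sum_(x | I x) amalg_weight x =
  la * ((\sum_i \sum_(v | I (inl (v, i))) w v) / t%:R) +
  (1 - la) * \sum_(f : {ffun 'I_t -> V})
     ((\prod_i w (f i)) * \sum_(h | I (inr (f, h))) u h).
Proof.
rewrite big_mkcond big_sumType /=; congr +%R.
  rewrite mulr_suml mulr_sumr.
  under [RHS]eq_bigr do rewrite mulr_suml mulr_sumr big_mkcond/=.
  rewrite exchange_big pair_bigA /=; apply: eq_bigr => -[v i] _ /=.
  by case: ifP; rewrite ?mul0r ?mulr0.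
under [X in _ * X]eq_bigr do rewrite mulr_sumr big_mkcond.
rewrite pair_bigA /= mulr_sumr; apply: eq_bigr => -[f h] _ /=.
by case: ifP; rewrite ?mulr0.
Qed.

End step.

Lemma sum_ffun_prod t (V : finType) (w : 'I_t -> V -> R) :
  \sum_(f : {ffun 'I_t -> V}) \prod_i w i (f i) = \prod_i \sum_v w i v.
Proof. by rewrite bigA_distr_bigA. Qed.

(* A K_(r+2)-free graph is built from [t] disjoint copies of an old one by
   adding, for every choice of one vertex in each copy, a copy of a
   K_(r+1)-free graph joined to the chosen vertices.  A K_(r+1)-free set which
   is heavy on the copies meets most choices, and is K_r-free, hence light, on
   the corresponding new graphs. *)
Lemma clique_sparse_step r (rho : R) : 0 < rho <= 1 ->
  (forall eps, 0 < eps -> clique_sparse r eps) ->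
  clique_sparse r.+1 rho -> clique_sparse r.+1 (rho - rho ^+ 2 / 8).
Proof.
move=> /andP[rho0 rho1] Hr [V [e [w [[eirr esym] Vfree [w0 w1] VI]]]].
have d0 : 0 < rho / 8 by lra.
have [H [eH [u [[eHirr eHsym] Hfree [u0 u1] HI]]]] := Hr _ d0.
(* This many copies give S >= 8 / rho, hence P <= rho / 8, as soon as the mean of the [al i] is at
   least rho / 2. *)
have [t Ht] : exists t, 16 / rho ^+ 2 <= t.+1%:R.
  exists (Num.truncn (16 / rho ^+ 2)); apply: ltW; exact: truncnS_gt.
set T := t.+1 in Ht.
have T0 : 0 < T%:R :> R by rewrite ltr0n.
(* The new vertices get total weight rho/2. The two final cases yield (1 - rho/2) rho/2 + (rho/2)(1
   + rho/8) and (1 - rho/2) rho + (rho/2)(rho/4), both at most rho - rho^2/8. *)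
pose la : R := 1 - rho / 2.
exists (amalg V H T), (@amalg_rel V H e eH T), (@amalg_weight V H T w u la).
have la01 : 0 <= la <= 1 by rewrite /la; lra.
have [la0 la1] := andP la01.
split.
- by split; [exact: amalg_irr|exact: amalg_sym].
- exact: amalg_free.
- split.
    case=> [[v i]|[f h]] /=.
      by rewrite !mulr_ge0 ?invr_ge0 ?ler0n.
    by rewrite !mulr_ge0 ?subr_ge0 ?prodr_ge0.
  rewrite (sum_amalg _ _ _ predT) /=.
  under eq_bigr do rewrite w1.
  under [X in _ + _ * X]eq_bigr do rewrite u1 mulr1.
  rewrite sumr_const card_ord divff ?gt_eqF// (sum_ffun_prod (fun=> w)).
  by rewrite big1 ?mulr1; [ring|move=> i _].
move=> I IP; rewrite sum_amalg.
pose al i := \sum_(v | I (inl (v, i))) w v.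
have al0 i : 0 <= al i by apply: sumr_ge0.
have alrho i : al i <= rho.
  apply: VI => f Cf fI; apply: (IP (fun j => inl (f j, i))) => // j k jk /=.
  by rewrite eqxx /=; exact: Cf.
have al1 i : al i <= 1 by apply: le_trans (alrho i) _.
have nal i : \sum_(v | ~~ I (inl (v, i))) w v = 1 - al i.
  have : \sum_v w v = al i + \sum_(v | ~~ I (inl (v, i))) w v.
    by rewrite (bigID (fun v => I (inl (v, i)))).
  by rewrite w1; lra.
set S := \sum_i al i.
have S0 : 0 <= S by apply: sumr_ge0.
have STrho : S / T%:R <= rho.
  rewrite ler_pdivrMr// (le_trans (ler_sum _ (fun i _ => alrho i)))//.
  by rewrite sumr_const card_ord mulr_natr.
(* The total weight of the choices that avoid I in every copy. *)
pose P := \prod_i (1 - al i).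
have P01 : 0 <= P by apply: prodr_ge0 => i _; rewrite subr_ge0.
have PS : P * (1 + S) <= 1 by apply: prod1B_sum_le1 => i; rewrite al0 al1.
have B : \sum_(f : {ffun 'I_T -> V})
     ((\prod_i w (f i)) * \sum_(h | I (inr (f, h))) u h) <= P + rho / 8.
  have -> : P + rho / 8 = \sum_(f : {ffun 'I_T -> V}) (\prod_i (w (f i) *
      (~~ I (inl (f i, i)))%:R) + (\prod_i w (f i)) * (rho / 8)).
    rewrite big_split/= -mulr_suml (sum_ffun_prod (fun=> w)).
    rewrite (sum_ffun_prod (fun i v => w v * (~~ I (inl (v, i)))%:R)); congr +%R; last first.
      by rewrite big1 ?mul1r.
    apply: eq_bigr => i _; rewrite -nal big_mkcond; apply: eq_bigr => v _.
    by case: ifP; rewrite ?mulr1 ?mulr0.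
  apply: ler_sum => f _; rewrite big_split /= -mulrDr.
  apply: ler_wpM2l; first exact: prodr_ge0.
  have [/existsP[i If]|] := boolP [exists i, I (inl (f i, i))].
    apply: le_trans (_ : rho / 8 <= _); last first.
      by rewrite lerDr; apply: prodr_ge0.
    apply: HI => g Cg gI.
    pose g' (j : 'I_r.+1) : amalg V H T :=
      if unlift ord0 j is Some k then inr (f, g k) else inl (f i, i).
    apply: (IP g').
      move=> j k; rewrite /g'.
      case: (unliftP ord0 j) => [j'|] ->; case: (unliftP ord0 k) => [k'|] -> //=.
      by rewrite (inj_eq lift_inj) eqxx /=; exact: Cg.
    by move=> j; rewrite /g'; case: unlift.
  rewrite negb_exists => /forallP nI.
  have -> : \prod_i (~~ I (inl (f i, i)))%:R = 1 :> R by apply: big1 => i _; rewrite nI.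
  apply: le_trans (_ : 1 <= _); last by lra.
  by rewrite -u1 big_mkcond /=; apply: ler_sum => h _; case: ifP.
rewrite -/al -/S.
have [Sl|Sg] := ltP (S / T%:R) (rho / 2).
  have P1 : P <= 1 by have := mulr_ge0 P01 S0; lra.
  rewrite /la expr2.
  have := ler_wpM2l la0 (ltW Sl).
  have := ler_wpM2l (_ : 0 <= 1 - la) (le_trans B (lerD P1 (lexx _))).
  rewrite /la; nra.
have P8 : P <= rho / 8.
  have h1 : rho / 2 * T%:R <= S by rewrite -ler_pdivlMr.
  have h2 : 8 / rho <= S.
    apply: le_trans h1; rewrite -(@ler_pM2l _ (2 / rho)) ?divr_gt0//.
    apply: le_trans (_ : 16 / rho ^+ 2 <= _); first by rewrite le_eqVlt; apply/orP; left; apply/eqP; field; lra.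
    apply: (le_trans Ht); rewrite le_eqVlt; apply/orP; left; apply/eqP; field; lra.
  have h3 : P * (8 / rho) <= 1.
    by apply: le_trans (ler_wpM2l P01 (_ : _ <= 1 + S)) PS; lra.
  by rewrite -ler_pdivlMr ?divr_gt0// in h3; move: h3; rewrite invf_div mul1r.
have := ler_wpM2l la0 STrho.
have := ler_wpM2l (_ : 0 <= 1 - la) (le_trans B (lerD P8 (lexx _))).
by rewrite /la expr2; nra.
Qed.

Lemma clique_sparse_exists r (eps : R) : (0 < r)%N -> 0 < eps -> clique_sparse r eps.
Proof.
case: r => // r _; elim: r eps => [|r IH] eps eps0.
  exact: clique_sparse_le (ltW eps0) clique_sparse_1.
(* The sequence 8/(n + 8) starts at 1, where a single vertex suffices, and dominates the iterates of
   rho -> rho - rho^2/8. *)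
have P n : clique_sparse r.+2 (8 / (n + 8)%:R).
  elim: n => [|n IHn].
    by rewrite divff// ?pnatr_eq0//; exact: clique_sparse_trivial.
  have n0 : 0 < (n + 8)%:R :> R by rewrite ltr0n addnS.
  have : 0 < (8 / (n + 8)%:R : R) <= 1.
    by rewrite divr_gt0//= ler_pdivrMr// mul1r ler_nat leq_addl.
  move=> /clique_sparse_step /(_ IH IHn).
  apply: clique_sparse_le.
  rewrite addSn -[(n + 8).+1%:R]natr1; set x := (n + 8)%:R in n0 *.
  rewrite -subr_ge0.
  have -> : 8 / (x + 1) - (8 / x - (8 / x) ^+ 2 / 8) = 8 / (x ^+ 2 * (x + 1)).
    by field; rewrite !lt0r_neq0//; lra.
  by rewrite divr_ge0// mulr_ge0 ?sqr_ge0//; lra.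
apply: clique_sparse_le (P (Num.truncn (8 / eps))).
rewrite ler_pdivrMr ?ltr0n ?addnS//.
rewrite mulrC -ler_pdivrMr//.
apply/ltW/(lt_le_trans (truncnS_gt _)).
rewrite ler_nat; set t := Num.truncn _.
by rewrite addn0 ltnS; do 7! apply: leqW.
Qed.

End clique_sparse.

(** * Facts about the Fraisse limit transferred to the monster model *)

Section tuples.
Variable T : Type.

Lemma catf_lshift m n (x : 'I_m -> T) (y : 'I_n -> T) i : catf x y (lshift n i) = x i.
Proof. by rewrite /catf (unsplitK (inl i)). Qed.

Lemma catf_rshift m n (x : 'I_m -> T) (y : 'I_n -> T) i : catf x y (rshift m i) = y i.
Proof. by rewrite /catf (unsplitK (inr i)). Qed.

Lemma catf_pt0 n (a : T) (y : 'I_n -> T) : catf (pt a) y ord0 = a.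
Proof. by rewrite -[RHS](catf_lshift (pt a) y ord0); congr catf; exact: val_inj. Qed.

Lemma catf_ptS n (a : T) (y : 'I_n -> T) i : catf (pt a) y (lift ord0 i) = y i.
Proof. by rewrite -[RHS](catf_rshift (pt a) y); congr catf; exact: val_inj. Qed.

Lemma catf_pt_eta n (v : 'I_n.+1 -> T) : catf (pt (v ord0)) (fun i => v (lift ord0 i)) = v.
Proof.
apply/funext => i; have [j ->|->] := unliftP ord0 i; last by rewrite catf_pt0.
by rewrite (catf_ptS (v ord0)).
Qed.

Lemma pt_ord0 (x : 'I_1 -> T) : pt (x ord0) = x.
Proof. by apply/funext => i; rewrite /pt [i]ord1. Qed.

End tuples.

Lemma finite_enum_eqType (T : eqType) (C : set T) : finite_set C ->
  exists n (v : 'I_n -> T), injective v /\ range v = C.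
Proof.
move=> /finite_seqP[s ->].
exists (size (undup s)), (tnth (in_tuple (undup s))); split.
  by apply/tuple_uniqP; exact: undup_uniq.
apply/seteqP; split => [x [i _ <-]|x /= xs].
  by rewrite /= -mem_undup; exact: mem_tnth.
have : x \in in_tuple (undup s) by rewrite /= mem_undup.
by move=> /tnthP[i ->]; exists i.
Qed.

Lemma finite_enum (T : Type) (C : set T) : finite_set C ->
  exists n (v : 'I_n -> T), injective v /\ range v = C.
Proof. exact: (@finite_enum_eqType {classic T}). Qed.


Lemma fun_ord0 (T : Type) : 'I_0 -> T.
Proof. by case. Qed.

Section formulas.
Implicit Types n : nat.

Definition Fnot n (phi : fmla n) := Fimp phi (Fbot n).
Definition Fand n (phi psi : fmla n) := Fnot (Fimp phi (Fnot psi)).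
Definition Fbigand n (I : finType) (phi : I -> fmla n) :=
  foldr (fun i => Fand (phi i)) (Fnot (Fbot n)) (enum I).
Definition Flit n (b : bool) (phi : fmla n) := if b then phi else Fnot phi.

Fixpoint Fclose n : fmla n -> fmla 0 :=
  match n with 0%N => id | k.+1 => fun phi => Fclose (Fall phi) end.

(** A pattern is a quantifier-free type in n variables. There are finitely many, so any property of
    tuples that depends only on the pattern is a formula, [Fpatterns]. *)
Definition pattern_type n := {ffun 'I_n * 'I_n -> bool * bool}.

Definition Fpattern n (p : pattern_type n) := Fbigand (fun ij : 'I_n * 'I_n =>
  Fand (Flit (p ij).1 (Feq ij.1 ij.2)) (Flit (p ij).2 (Fedge ij.1 ij.2))).

Definition Fpatterns n (Q : {set pattern_type n}) :=
  Fbigand (fun p : pattern_type n => if p \in Q then Fnot (Fbot n) else Fnot (Fpattern p)).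

Variables (T : Type) (E : T -> T -> Prop).

Definition pattern n (v : 'I_n -> T) : pattern_type n :=
  [ffun ij => (`[< v ij.1 = v ij.2 >], `[< E (v ij.1) (v ij.2) >])].

Lemma sat_and n (phi psi : fmla n) v : sat E (Fand phi psi) v <-> sat E phi v /\ sat E psi v.
Proof.
rewrite /=; split=> [|[] //]; last by auto.
by move=> h; split; apply: contrapT => h'; apply: h.
Qed.

Lemma sat_bigand n (I : finType) (phi : I -> fmla n) v :
  sat E (Fbigand phi) v <-> forall i, sat E (phi i) v.
Proof.
rewrite /Fbigand; have -> : (forall i, sat E (phi i) v) <->
  (forall i, i \in enum I -> sat E (phi i) v).
  by split=> h i; [|apply: h; rewrite mem_enum].
elim: (enum I) => [|i s IH]; first by split=> //=; auto.
rewrite [foldr _ _ _]/= sat_and IH; split=> [[hi hs] j|h].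
  by rewrite inE => /orP[/eqP->|/hs].
by split=> [|j js]; apply: h; rewrite inE ?eqxx ?js ?orbT.
Qed.

Lemma sat_lit n b (phi : fmla n) v : sat E (Flit b phi) v <-> b = `[< sat E phi v >].
Proof.
case: b => /=; split=> h.
- by apply/esym/asboolP.
- by apply/asboolP; rewrite -h.
- by apply/esym/asboolPn.
- by apply/asboolPn; rewrite -h.
Qed.

Lemma sat_pattern n (p : pattern_type n) v : sat E (Fpattern p) v <-> pattern v = p.
Proof.
rewrite sat_bigand; split=> [h|<- ij].
  apply/ffunP => ij; rewrite ffunE; move: (h ij).
  by rewrite sat_and !sat_lit => -[/= <- <-]; case: (p ij).
by rewrite sat_and !sat_lit ffunE.
Qed.

Lemma sat_patterns n (Q : {set pattern_type n}) v : sat E (Fpatterns Q) v <-> pattern v \in Q.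
Proof.
rewrite sat_bigand; split=> [h|vQ p].
  apply: contrapT => /negP nQ; have := h (pattern v); rewrite (negbTE nQ).
  by apply; apply/sat_pattern.
case: ifP => pQ /=; first by auto.
by move=> /sat_pattern vp; rewrite -vp vQ in pQ.
Qed.

Lemma sat_close n (phi : fmla n) v0 : sat E (Fclose phi) v0 <-> forall v, sat E phi v.
Proof.
elim: n phi => [|n IH] phi /=.
  split=> [h v|]; last exact.
  by rewrite (_ : v = v0)//; apply/funext => -[].
rewrite IH /=; split=> h v; last by move=> a; exact: h.
by rewrite -(catf_pt_eta v); exact: h.
Qed.

End formulas.

Lemma pattern_eqP (T T' : Type) (E : T -> T -> Prop) (E' : T' -> T' -> Prop) n
    (v : 'I_n -> T) (w : 'I_n -> T') : pattern E v = pattern E' w <->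
  forall i j, (v i = v j <-> w i = w j) /\ (E (v i) (v j) <-> E' (w i) (w j)).
Proof.
split=> [/ffunP h i j|h].
  have := h (i, j); rewrite !ffunE /= => -[h1 h2].
  by split; [exact: asbool_eq_equiv h1|exact: asbool_eq_equiv h2].
by apply/ffunP => -[i j]; rewrite !ffunE /=; congr pair; apply/asbool_equiv_eq; have [] := h i j.
Qed.


(** The theory enters all later arguments only through these consequences, with r = s - 1. *)
Record henson r (U : structure) : Prop := Henson {
  henson_irr : forall x : U, ~ edge x x ;
  henson_sym : forall x y : U, edge x y -> edge y x ;
  henson_free : forall f : 'I_r.+1 -> U, ~ clique (@edge U) f ;
  henson_ext : forall C X : set U, finite_set C ->
    (forall f : 'I_r -> U, clique (@edge U) f -> ~ forall i, C (f i) /\ X (f i)) ->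
    exists y, forall c, C c -> y <> c /\ (edge y c <-> X c) ;
  henson_embed : forall n (e : rel 'I_n), Ks_free_graph r.+1 e ->
    exists2 f : 'I_n -> U, injective f & forall i j, edge (f i) (f j) <-> e i j }.

Section henson_of_T2.
Variables (r : nat) (U : structure).
Hypothesis UT : forall phi, T2 r.+1 phi -> models U phi.

Lemma T2_transfer n (phi : fmla n) :
  (forall F, fraisse_limit (Ks_free_graph r.+1) F -> forall v, sat (@edge F) phi v) ->
  forall v, sat (@edge U) phi v.
Proof.
move=> h; have /UT Uphi : T2 r.+1 (Fclose phi).
  by move=> F FK v0; apply/sat_close; exact: h.
exact: (sat_close _ _ (@fun_ord0 U)).1 (Uphi _).
Qed.

Lemma limit_free (F : structure) n (v : 'I_n -> F) : fraisse_limit (Ks_free_graph r.+1) F ->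
  injective v -> Ks_free_graph r.+1 (fun i j => edge (v i) (v j)).
Proof. by move=> [_ _ FK] vi; apply/FK; exists v. Qed.

(** The tuple with a new vertex joined to X is still K_(r+1)-free, since a clique through the new
    vertex leaves an r-clique in X. It therefore embeds in F, and ultrahomogeneity moves the copy of
    the old tuple back onto v. *)
Lemma limit_ext (F : structure) n (v : 'I_n -> F) (X : set 'I_n) :
  fraisse_limit (Ks_free_graph r.+1) F -> injective v ->
  (forall f : 'I_r -> 'I_n, clique (fun i j => edge (v i) (v j)) f -> ~ forall i, X (f i)) ->
  exists y, forall i, y <> v i /\ (edge y (v i) <-> X i).
Proof.
move=> FK vi HX; have [e_irr e_sym e_free] := limit_free FK vi.
pose e' (i j : 'I_n.+1) := match unlift ord0 i, unlift ord0 j with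
  | Some i', Some j' => edge (v i') (v j')
  | None, Some j' => X j' | Some i', None => X i' | None, None => False end.
have e'_irr i : ~ e' i i.
  by rewrite /e'; case: unlift => // i'; exact: e_irr.
have : Ks_free_graph r.+1 e'.
  split=> //.
    by move=> i j; rewrite /e'; case: unlift => [i'|]; case: unlift => [j'|]//; exact: e_sym.
  move=> [g Cg].
  have [[i0 gi0]|n0] := pselect (exists i0, g i0 = ord0).
    have gl i : exists k, g (lift i0 i) = lift ord0 k.
      have [k ->|g0] := unliftP ord0 (g (lift i0 i)); first by exists k.
      exfalso; have := Cg i0 (lift i0 i); rewrite neq_lift => /(_ isT).
      by rewrite gi0 g0; exact: e'_irr.
    apply: (HX (fun i => sval (cid (gl i)))) => [i j ij|i].
      case: cid => k /= Hk; case: cid => l /= Hl.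
      have := Cg (lift i0 i) (lift i0 j); rewrite (inj_eq lift_inj) => /(_ ij).
      by rewrite Hk Hl /e' !liftK.
    case: cid => k /= Hk; have := Cg i0 (lift i0 i); rewrite neq_lift => /(_ isT).
    by rewrite gi0 Hk /e' liftK unlift_none.
  have gl i : exists k, g i = lift ord0 k.
    have [k ->|g0] := unliftP ord0 (g i); first by exists k.
    by case: n0; exists i.
  apply: e_free; exists (fun i => sval (cid (gl i))) => i j ij.
  case: cid => k /= Hk; case: cid => l /= Hl.
  by have := Cg i j ij; rewrite Hk Hl /e' !liftK.
have [_ hom FKe] := FK.
move=> /FKe[f fi fe].
have [||sig [sbij sedge] Hsig] := hom n (fun i => f (lift ord0 i)) v.
- by move=> i j; split=> [/fi/lift_inj ->|/vi ->].
- by move=> i j; rewrite fe /e' !liftK.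
exists (sig (f ord0)) => i; rewrite -Hsig; split.
  by move=> /(bij_inj sbij)/fi/eqP; rewrite (negbTE (neq_lift _ _)).
by rewrite sedge fe /e' liftK unlift_none.
Qed.

(** Freeness depends only on the pattern of v, so it transfers from the limit as membership in the
    set of good patterns. *)
Lemma T2_free n (v : 'I_n -> U) : injective v ->
  Ks_free_graph r.+1 (fun i j => edge (v i) (v j)).
Proof.
pose good (p : pattern_type n) := (forall i j, (p (i, j)).1 -> i = j) ->
  Ks_free_graph r.+1 (fun i j => (p (i, j)).2).
have Hgood (F : structure) (w : 'I_n -> F) : good (pattern (@edge F) w) <->
    (injective w -> Ks_free_graph r.+1 (fun i j => edge (w i) (w j))).
  rewrite /good (_ : (fun i j => _) = (fun i j => edge (w i) (w j)) :> ('I_n -> 'I_n -> Prop)); last first.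
    by apply/funext => i; apply/funext => j; rewrite ffunE /= asboolE.
  split=> h hi; apply: h => i j; first by rewrite ffunE /= => /asboolP/hi.
  by move=> wij; apply: hi; rewrite ffunE; apply/asboolP.
apply/Hgood; have := @T2_transfer n (Fpatterns (finset (fun p => `[< good p >]))) _ v.
move=> /(_ _)/sat_patterns; rewrite inE => /(_ _)/asboolP; apply.
move=> F FK w; apply/sat_patterns; rewrite inE; apply/asboolP/Hgood.
exact: limit_free.
Qed.

Lemma T2_ext n (v : 'I_n -> U) (X : set 'I_n) : injective v ->
  (forall f : 'I_r -> 'I_n, clique (fun i j => edge (v i) (v j)) f -> ~ forall i, X (f i)) ->
  exists y, forall i, y <> v i /\ (edge y (v i) <-> X i).
Proof.
move=> vi HX.
pose Q := finset (fun p : pattern_type n.+1 =>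
  [forall i, p (ord0, lift ord0 i) == (false, `[< X i >])]).
have HQ (F : structure) (w : 'I_n -> F) (y : F) : pattern (@edge F) (catf (pt y) w) \in Q <->
    forall i, y <> w i /\ (edge y (w i) <-> X i).
  rewrite inE; split=> [/forallP h i|h].
    have /eqP := h i; rewrite ffunE /= catf_pt0 (catf_ptS y) => -[h1 h2].
    by split; [exact/asboolPn/negbT|exact: asbool_eq_equiv h2].
  apply/forallP => i; rewrite ffunE /= catf_pt0 (catf_ptS y).
  by have [h1 h2] := h i; apply/eqP; congr pair; [exact/asboolPn|exact/asbool_equiv_eq].
(* The implication says that any tuple with the pattern of v has a point with the required trace;
   the negated [Fall] is the existential quantifier. *)
pose phi := Fimp (Fpatterns [set pattern (@edge U) v]%SET)
              (Fnot (Fall (Fnot (Fpatterns Q)))).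
have := @T2_transfer n phi _ v.
rewrite /phi [sat _ _]/= => /(_ _ _).
case: (pselect (exists y, forall i, y <> v i /\ (edge y (v i) <-> X i))) => // nex.
case.
- move=> F FK w /sat_patterns; rewrite inE => /eqP/pattern_eqP wv.
  have wi : injective w by move=> i j; have [-> _] := wv i j; exact: vi.
  have [f Cf|y Hy] := limit_ext (X := X) FK wi _.
    by apply: HX => i j /Cf; have [_ ->] := wv (f i) (f j).
  by move=> /(_ y); apply; apply/(sat_patterns (@edge F))/HQ.
- by apply/(sat_patterns (@edge U)); rewrite inE.
- by move=> y /(sat_patterns (@edge U))/HQ Hy; apply: nex; exists y.
Qed.

Lemma T2_embed n (e : rel 'I_n) : Ks_free_graph r.+1 e ->
  exists2 f : 'I_n -> U, injective f & forall i j, edge (f i) (f j) <-> e i j.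
Proof.
move=> He; pose p : pattern_type n := [ffun ij => (ij.1 == ij.2, e ij.1 ij.2)].
have Hp (F : structure) (w : 'I_n -> F) : pattern (@edge F) w = p <->
    injective w /\ forall i j, edge (w i) (w j) <-> e i j.
  split=> [/ffunP h|[wi we]].
    split=> i j; have := h (i, j); rewrite !ffunE /= => -[h1 h2].
      by move=> wij; apply/eqP; rewrite -h1; apply/asboolP.
    by rewrite -h2; split=> /asboolP.
  apply/ffunP => -[i j]; rewrite !ffunE /=; congr pair.
    by apply/asboolP/eqP => [/wi|->].
  by apply/asboolP/idP => /we.
pose phi := Fnot (Fclose (Fnot (Fpattern p))).
have [v0] : exists v0 : 'I_0 -> U, True.
  by exists (@fun_ord0 U).
have := @T2_transfer 0 phi _ v0; rewrite /phi [sat _ _]/= => h _.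
apply: contrapT => nex; apply: h.
  move=> F [_ _ FK] w /= /sat_close h.
  have [f fi fe] := (FK n e).2 He.
  by apply: (h f); apply/sat_pattern/Hp.
by apply/sat_close => w /= /sat_pattern/Hp[wi we]; apply: nex; exists w.
Qed.

Lemma henson_of_T2 : henson r U.
Proof.
have irr (x : U) : ~ edge x x.
  have [|h _ _] := @T2_free 1 (fun=> x); first by move=> i j; rewrite !ord1.
  exact: h ord0.
split=> //.
- move=> x y exy; have xy : x <> y by move=> xy; apply: (irr x); rewrite {2}xy.
  pose v (i : 'I_2) := if i == ord0 then x else y.
  have [|_ h _] := @T2_free 2 v; last by have := h ord0 ord_max; exact.
  move=> i j; rewrite /v; case: eqP => [->|/eqP i0]; case: eqP => [->|/eqP j0] //; first by move=> /esym.
  by move=> _; move: i j i0 j0 => [[|[|i]] hi] [[|[|j]] hj]// _ _; exact: val_inj.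
- move=> f Cf; have fi : injective f.
    move=> i j fij; apply: contrapT => /eqP/Cf; rewrite fij; exact: irr.
  by have [_ _] := T2_free fi; apply; exists id => i j; exact: Cf.
- move=> C X /finite_enum[n [v [vi <-]]] HX.
  have [f Cf|y Hy] := T2_ext (X := fun i => X (v i)) vi _.
    by move=> h; apply: (HX (v \o f)) => [|i]; [exact: Cf|split; [exists (f i)|exact: h]].
  by exists y => _ [i _ <-]; exact: Hy.
- exact: T2_embed.
Qed.

End henson_of_T2.

(** * Quantifier elimination, definable sets, small models *)

Section sim.
Variable U : structure.

(** Equality of quantifier-free types over C, which quantifier elimination ([sat_sim]) turns into
    equality of types over C. *)
Definition sim (C : set U) n (x x' : 'I_n -> U) : Prop :=
  (forall i j, (x i = x j <-> x' i = x' j) /\ (edge (x i) (x j) <-> edge (x' i) (x' j))) /\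
  (forall i c, C c -> (x i = c <-> x' i = c) /\ (edge (x i) c <-> edge (x' i) c)).

Lemma sim_sub (C C' : set U) n (x x' : 'I_n -> U) : C `<=` C' -> sim C' x x' -> sim C x x'.
Proof. by move=> CC' [h1 h2]; split=> // i c /CC'; exact: h2. Qed.

Lemma sim_sym (C : set U) n (x x' : 'I_n -> U) : sim C x x' -> sim C x' x.
Proof.
move=> [h1 h2]; split=> [i j|i c Cc]; first by have [-> ->] := h1 i j.
by have [-> ->] := h2 i c Cc.
Qed.

Lemma sim_pt (C : set U) (x x' : U) : ~ edge x x -> ~ edge x' x' ->
  (forall c, C c -> (x = c <-> x' = c) /\ (edge x c <-> edge x' c)) ->
  sim C (pt x) (pt x').
Proof. by move=> nx nx' h; split=> [i j|i c]; [split; split|exact: h]. Qed.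

Definition sim_invariant (C : set U) n (D : set ('I_n -> U)) :=
  forall x x', sim C x x' -> D x -> D x'.

Lemma definable_overS (A B : set U) n (D : set ('I_n -> U)) :
  A `<=` B -> definable_over A D -> definable_over B D.
Proof. by move=> AB [m [phi [c [Ac ->]]]]; exists m, phi, c; split=> // j; exact: AB. Qed.

(** An invariant set is determined by the patterns of [catf x c] for an enumeration c of C, and
    these are finite in number. With the converse [definable_invariant], definability proofs reduce
    to checking invariance, without writing formulas. *)
Lemma invariant_definable (A C : set U) n (D : set ('I_n -> U)) :
  finite_set C -> C `<=` A -> sim_invariant C D -> definable_over A D.
Proof.
move=> /finite_enum[m [c [_ rc]]] CA DC.
have Cc j : C (c j) by rewrite -rc; exists j.
pose Q : {set pattern_type (n + m)} :=
  finset (fun p => `[< exists2 x, D x & pattern (@edge U) (catf x c) = p >]).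
exists m, (Fpatterns Q), c; split.
  by move=> j; exact: CA.
apply/seteqP; split=> [x Dx|x].
  by apply/sat_patterns; rewrite inE; apply/asboolP; exists x.
move=> /sat_patterns; rewrite inE => /asboolP[x' Dx' /pattern_eqP h].
apply: (DC x' x _ Dx'); split=> [i j|i d Cd].
  by have := h (lshift m i) (lshift m j); rewrite !catf_lshift.
have [j _ <-] : range c d by rewrite rc.
by have := h (lshift m i) (rshift n j); rewrite !catf_lshift !catf_rshift.
Qed.

End sim.

Section henson_theory.
Variables (r : nat) (U : structure).
Hypothesis hU : henson r U.

Let irr : forall x : U, ~ edge x x := henson_irr hU.

Lemma henson_symE (x y : U) : edge x y <-> edge y x.
Proof. by split; exact: henson_sym hU _ _. Qed.

Lemma clique_edges_free (f : 'I_r -> U) (a : U) : clique (@edge U) f ->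
  ~ forall i, edge a (f i).
Proof.
move=> Cf af.
pose g (j : 'I_r.+1) := if unlift ord0 j is Some k then f k else a.
apply: (henson_free hU (f := g)) => j k; rewrite /g.
case: (unliftP ord0 j) => [j'|] ->; case: (unliftP ord0 k) => [k'|] -> //=.
- by rewrite (inj_eq lift_inj); exact: Cf.
by move=> _; apply/henson_symE.
Qed.

Lemma sim_cons n (x x' : 'I_n -> U) a a' : sim set0 x x' ->
  (forall i, (a = x i <-> a' = x' i) /\ (edge a (x i) <-> edge a' (x' i))) ->
  sim set0 (catf (pt a) x) (catf (pt a') x').
Proof.
move=> [h _] ha; split=> // i j.
have [i' ->|->] := unliftP (ord0 : 'I_n.+1) i; have [j' ->|->] := unliftP (ord0 : 'I_n.+1) j;
  rewrite ?(catf_ptS a) ?(catf_ptS a') ?catf_pt0.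
- exact: h.
- by rewrite (henson_symE _ a) (henson_symE _ a'); have [h1 h2] := ha i'; split=> //; split=> /esym/h1/esym.
- exact: ha.
- by split; split=> // /irr.
Qed.

(** The back-and-forth step. The neighbours prescribed for a' contain no K_r, because the
    corresponding points of x together with a would form a K_(r+1). *)
Lemma sim_extend n (x x' : 'I_n -> U) a : sim set0 x x' ->
  exists a', sim set0 (catf (pt a) x) (catf (pt a') x').
Proof.
move=> xx'; have [h _] := xx'.
have [[k ->]|nx] := pselect (exists k, a = x k).
  by exists (x' k); apply: sim_cons => // i; have [-> ->] := h k i.
pose X u := exists2 k, u = x' k & edge a (x k).
have [f Cf|a' Ha'] := henson_ext hU (C := range x') (X := X) (finite_image _ (@finite_finset _ _)) _.
  move=> /(_ _) fX; have fk i : exists k, f i = x' k /\ edge a (x k).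
    by have [_ [k -> ?]] := fX i; exists k.
  apply: (@clique_edges_free (fun i => x (sval (cid (fk i)))) a).
    move=> i j ij; case: cid => k /= [fi _]; case: cid => l /= [fj _].
    by have [_ ->] := h k l; rewrite -fi -fj; exact: Cf.
  by move=> i; case: cid => k /= [].
exists a'; apply: sim_cons => // i.
have [h1 h2] := Ha' (x' i) (ex_intro2 _ _ i I erefl).
split; first by split=> [ai|//]; case: nx; exists i.
rewrite h2; split=> [ai|[k xk ak]]; first by exists i.
by rewrite ((h i k).1.2 xk).
Qed.

Lemma sat_sim n (phi : fmla n) x x' : sim set0 x x' ->
  sat (@edge U) phi x <-> sat (@edge U) phi x'.
Proof.
elim: phi x x' => {n} [n|n i j|n i j|n phi IH psi IH'|n phi IH] x x' xx' //=.
- by have [/(_ i j)[]] := xx'.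
- by have [/(_ i j)[]] := xx'.
- by have := IH x x' xx'; have := IH' x x' xx'; tauto.
- split=> h a.
    have [a' ha] := sim_extend a (sim_sym xx').
    by apply/(IH _ _ ha).
  have [a' ha] := sim_extend a xx'.
  by apply/(IH _ _ ha).
Qed.

Lemma sim_catf n m (C : set U) (x x' : 'I_n -> U) (c : 'I_m -> U) :
  (forall i, C (c i)) -> sim C x x' -> sim set0 (catf x c) (catf x' c).
Proof.
move=> Cc [h1 h2]; split=> // i j.
case: (split_ordP i) => i' ->; case: (split_ordP j) => j' ->;
  rewrite ?catf_lshift ?catf_rshift //; first exact: h2.
rewrite henson_symE [X in _ /\ (_ <-> X)]henson_symE.
by have [h3 h4] := h2 j' (c i') (Cc i'); split=> //; split=> /esym/h3/esym.
Qed.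

Lemma inst_invariant n m (phi : fmla (n + m)) (c : 'I_m -> U) :
  sim_invariant (range c) (inst phi c).
Proof.
move=> x x' xx'; rewrite /inst /=.
by move/(sim_catf (c := c)) : xx' => /(_ (fun i => ex_intro2 _ _ i I erefl))/(sat_sim phi)[].
Qed.

Lemma definable_invariant (A : set U) n (D : set ('I_n -> U)) : definable_over A D ->
  exists C, [/\ finite_set C, C `<=` A & sim_invariant C D].
Proof.
move=> [m [phi [c [Ac ->]]]]; exists (range c); split.
- exact: finite_image.
- by move=> _ [i _ <-].
- exact: inst_invariant.
Qed.

Lemma invariantS (C C' : set U) n (D : set ('I_n -> U)) : C `<=` C' ->
  sim_invariant C D -> sim_invariant C' D.
Proof. by move=> CC' h x x' /(sim_sub CC'); exact: h. Qed.

Lemma invariantI (C : set U) n (D D' : set ('I_n -> U)) :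
  sim_invariant C D -> sim_invariant C D' -> sim_invariant C (D `&` D').
Proof. by move=> h h' x x' xx' [/(h _ _ xx') ? /(h' _ _ xx')]. Qed.

Lemma definableI (A : set U) n (D D' : set ('I_n -> U)) :
  definable_over A D -> definable_over A D' -> definable_over A (D `&` D').
Proof.
move=> /definable_invariant[C [fC CA hC]] /definable_invariant[C' [fC' CA' hC']].
apply: (@invariant_definable _ _ (C `|` C')).
- by rewrite finite_setU.
- by rewrite subUset.
- by apply: invariantI; [exact: invariantS hC|exact: invariantS hC'].
Qed.

Lemma definableT (A : set U) n : definable_over A [set: 'I_n -> U].
Proof. exact: (@invariant_definable _ _ set0). Qed.

Lemma definable0 (A : set U) n : definable_over A (set0 : set ('I_n -> U)).
Proof. exact: (@invariant_definable _ _ set0). Qed.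

Lemma definableU (A : set U) n (D D' : set ('I_n -> U)) :
  definable_over A D -> definable_over A D' -> definable_over A (D `|` D').
Proof.
move=> h h'; rewrite -[_ `|` _]setCK setCU.
by apply/definable_overC/definableI; exact: definable_overC.
Qed.

Lemma definableD (A : set U) n (D D' : set ('I_n -> U)) :
  definable_over A D -> definable_over A D' -> definable_over A (D `\` D').
Proof. by move=> h h'; rewrite setDE; apply/definableI/definable_overC. Qed.

Lemma definable_bigI (A : set U) n k (D : 'I_k -> set ('I_n -> U)) :
  (forall i, definable_over A (D i)) -> definable_over A [set x | forall i, D i x].
Proof.
elim: k D => [|k IH] D h.
  by rewrite (_ : mkset _ = setT); [exact: definableT|apply/seteqP; split=> // x _ []].
rewrite (_ : mkset _ = D ord0 `&` [set x | forall i, D (lift ord0 i) x]).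
  by apply: definableI => //; exact: IH.
apply/seteqP; split=> [x h'|x [h0 h'] i]; first by split=> // i.
by have [j ->|->] := unliftP ord0 i.
Qed.

Lemma definable_bigU (A : set U) n k (D : 'I_k -> set ('I_n -> U)) :
  (forall i, definable_over A (D i)) -> definable_over A [set x | exists i, D i x].
Proof.
move=> h; rewrite (_ : mkset _ = ~` [set x | forall i, (~` D i) x]).
  by apply/definable_overC/definable_bigI => i; exact: definable_overC.
apply/seteqP; split=> [x [i Di] /(_ i)//|x nh].
by apply: contrapT => ne; apply: nh => i Di; apply: ne; exists i.
Qed.

Definition nbr (b : U) : set ('I_1 -> U) := [set x | edge (x ord0) b].

Lemma definable_nbr (A : set U) b : A b -> definable_over A (nbr b).
Proof.
move=> Ab; apply: (@invariant_definable _ _ [set b]) => //; first by move=> _ ->.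
by move=> x x' [_ /(_ ord0 b erefl)[_ h]]; rewrite /nbr /= h.
Qed.

Lemma definable_point (A : set U) a : A a -> definable_over A [set pt a].
Proof.
move=> Aa; apply: (@invariant_definable _ _ [set a]) => //; first by move=> _ ->.
move=> x x' [_ /(_ ord0 a erefl)[h _]] /= xa.
by rewrite -(pt_ord0 x') h.1// xa.
Qed.

Lemma definable_finite (A : set U) (F : set ('I_1 -> U)) : finite_set F ->
  (forall x, F x -> A (x ord0)) -> definable_over A F.
Proof.
move=> fF FA; apply: (@invariant_definable _ _ ((fun x => x ord0) @` F)).
- exact: finite_image.
- by move=> _ [x Fx <-]; exact: FA.
move=> x x' [_ h'] Fx; have [|h _] := h' ord0 (x ord0); first by exists x.
by rewrite -(pt_ord0 x') h.1// pt_ord0.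
Qed.

(** * The Tarski-Vaught test and countable elementary substructures *)

Definition rich (M : set U) := forall C a, finite_set C -> C `<=` M -> ~ C a ->
  exists2 a', M a' & forall c, C c -> a' <> c /\ (edge a' c <-> edge a c).

(** By quantifier elimination the Tarski-Vaught test only concerns the trace of one new point on a
    finite subset of M. *)
Lemma rich_elementary (M : set U) : rich M -> elementary_substructure M.
Proof.
move=> rM n; elim=> {n} [n|n i j|n i j|n phi IH psi IH'|n phi IH] v //=.
- split=> [->//|]; case: (v i) (v j) => [x Mx] [y My] /= xy.
  by move: Mx; rewrite xy => Mx; congr exist; exact: Prop_irrelevance.
- by have := IH v; have := IH' v; tauto.
have catfE a : (fun i => sval (catf (pt a) v i)) = catf (pt (sval a)) (fun i => sval (v i)).
  by apply/funext => i; rewrite /catf; case: fintype.split.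
split=> h a; last by apply/IH; rewrite catfE.
have [[k ->]|nv] := pselect (exists k, a = sval (v k)).
  by rewrite -catfE; apply/IH.
have [||| a' Ma' ha'] := rM (range (fun i => sval (v i))) a.
- exact: finite_image.
- by move=> _ [i _ <-]; case: (v i).
- by move=> [i _ vi]; apply: nv; exists i.
have /IH := h (exist _ a' Ma'); rewrite catfE /= => ha; apply: (sat_sim phi _).1 ha.
apply: sim_cons => // i; have [h1 h2] := ha' (sval (v i)) (ex_intro2 _ _ i I erefl).
by rewrite h2; split=> //; split=> [/h1//|ai]; case: nv; exists i.
Qed.

Section hull.
Variable a : nat -> U.

(* [n] codes the trace on [l] prescribed for the point to be chosen. *)
Let witness (n : nat) (l : seq U) : U :=
  let mask := odflt [::] (@unpickle (seq bool) n) in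
  let P y := forall i, (i < size l)%N ->
     y <> nth (a 0%N) l i /\ (edge y (nth (a 0%N) l i) <-> nth false mask i) in
  if pselect (exists y, P y) is left e then sval (cid e) else a 0%N.

(** Trees serve as Skolem terms: leaves name the generators and nodes apply witness functions, so
    the hull is countable because trees are. *)
Fixpoint hull_eval (t : GenTree.tree nat) : U :=
  match t with
  | GenTree.Leaf k => a k
  | GenTree.Node n l => witness n (map hull_eval l)
  end.

Lemma countable_hull :
  exists M, [/\ countable M, elementary_substructure M & range a `<=` M].
Proof.
exists (range hull_eval); split.
- exact: card_le_trans (card_image_le _ _) (countableP _).
- apply: rich_elementary => C b /finite_enum[n [v [vi <-]]] Cs nCb.
  have vt i : exists t, hull_eval t = v i by have [t _ <-] := Cs (v i) (ex_intro2 _ _ i I erefl); exists t.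
  pose t i := sval (cid (vt i)).
  have tv i : hull_eval (t i) = v i by rewrite /t; case: cid.
  pose l := [seq t i | i <- enum 'I_n].
  pose mask := [seq `[< edge b (v i) >] | i <- enum 'I_n].
  exists (hull_eval (GenTree.Node (pickle mask) l)); first by exists (GenTree.Node (pickle mask) l).
  move=> _ [i _ <-] /=; rewrite /witness pickleK /=.
  have nthv (j : 'I_n) : nth (a 0%N) (map hull_eval l) j = v j.
    by rewrite /l -map_comp (nth_map j) ?size_enum_ord// nth_ord_enum /= tv.
  have nthm (j : 'I_n) : nth false mask j = `[< edge b (v j) >].
    by rewrite (nth_map j) ?size_enum_ord// nth_ord_enum.
  have sz : size (map hull_eval l) = n by rewrite size_map /l size_map size_enum_ord.
  case: pselect => [e|[]].
    case: cid => y /= /(_ i); rewrite sz => /(_ (ltn_ord i)).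
    by rewrite nthv nthm => -[? ->]; split=> //; split=> /asboolP.
  exists b => j; rewrite sz => jn; rewrite (nthv (Ordinal jn)) (nthm (Ordinal jn)).
  split; first by move=> bv; apply: nCb; exists (Ordinal jn).
  by split=> /asboolP.
- by move=> _ [k _ <-]; exists (GenTree.Leaf k).
Qed.

End hull.

(** * Compactness and extension over small sets *)

Section monster.
Variable K : Type.
Hypothesis K_uncountable : ~ countable [set: K].
Hypothesis U_saturated : saturated U K.

Lemma small_countable (M : set U) : countable M -> small K M.
Proof.
move=> cM; split.
  apply: card_le_trans cM _; apply/infiniteP => /finite_set_countable.
  exact: K_uncountable.
by move=> /card_le_trans /(_ cM); exact: K_uncountable.
Qed.

(** An ultrafilter on tuples that contains G yields a complete type over A, and saturation realises
    it. *)
Lemma compactness (A : set U) n (G : set (set ('I_n -> U))) : small K A ->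
  G `<=` definable_over A (n := n) ->
  (forall k (D : 'I_k -> set ('I_n -> U)), (forall i, G (D i)) -> exists a, forall i, D i a) ->
  exists b, forall D, G D -> D b.
Proof.
move=> sA GA fip.
pose F : set_system ('I_n -> U) := [set S | exists k (D : 'I_k -> set ('I_n -> U)),
  (forall i, G (D i)) /\ [set x | forall i, D i x] `<=` S].
have FF : ProperFilter F.
  split.
    move=> [k [D [GD]]]; have [a Da] := fip k D GD.
    by move=> /(_ a); exact.
  split.
  - by exists 0%N, (fun=> setT); split=> // -[].
  - move=> S S' [k [D [GD DS]]] [k' [D' [GD' DS']]].
    exists (k + k')%N, (catf D D'); split=> [i|x Dx].
      by case: (split_ordP i) => j ->; rewrite ?catf_lshift ?catf_rshift.
    split; [apply: DS => i|apply: DS' => i].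
      by have := Dx (lshift k' i); rewrite catf_lshift.
    by have := Dx (rshift k i); rewrite catf_rshift.
  - by move=> S S' SS' [k [D [GD DS]]]; exists k, D; split=> //; exact: subset_trans SS'.
have [V [VU FV]] := ultraFilterLemma FF.
have pP : is_complete_type A [set D | definable_over A D /\ V D].
  split=> [D []//|k D pD|D dD].
    have : V [set x | forall i, D i x].
      elim: k D pD => [|k IH] D pD.
        rewrite (_ : mkset _ = setT); first exact: filterT.
        by apply/seteqP; split=> // x _ [].
      rewrite (_ : mkset _ = D ord0 `&` [set x | forall i, D (lift ord0 i) x]).
        by apply: filterI; [have [] := pD ord0|exact: IH].
      apply/seteqP; split=> [x h'|x [h0 h'] i]; first by split=> // i.
      by have [j ->|->] := unliftP ord0 i.
    by move=> /filter_ex[a ha]; exists a.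
  have [VD|VD] := in_ultra_setVsetC D VU; [by left|right; split=> //].
  exact: definable_overC.
have [b /(congr1 (@in_type _ _ _))/= pb] := U_saturated (CType pP) sA.
exists b => D GD.
have : [set D | definable_over A D /\ V D] D.
  split; first exact: GA.
  by apply: FV; exists 1%N, (fun=> D); split=> // x /(_ ord0).
by rewrite pb => -[].
Qed.

Lemma ext_small (M X : set U) : small K M ->
  (forall f : 'I_r -> U, clique (@edge U) f -> ~ forall i, M (f i) /\ X (f i)) ->
  exists b, forall c, M c -> b <> c /\ (edge b c <-> X c).
Proof.
move=> sM HX.
pose Dc c : set ('I_1 -> U) := [set y | y ord0 <> c /\ (edge (y ord0) c <-> X c)].
have [|k D GD|b Hb] := @compactness M 1 [set Dc c | c in M] sM.
- move=> _ [c Mc <-]; apply: (@invariant_definable _ _ [set c]) => //; first by move=> _ ->.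
  by move=> x x' [_ /(_ ord0 c erefl)[h h']]; rewrite /Dc /= h h'.
- pose c i := sval (cid2 (GD i)).
  have cM i : M (c i) by rewrite /c; case: cid2.
  have [f Cf h|y Hy] := henson_ext hU (C := range c) (X := X) (finite_image _ (@finite_finset _ _)) _.
    by apply: (HX f Cf) => i; have [[j _ <-] ?] := h i.
  exists (pt y) => i; have := Hy (c i) (ex_intro2 _ _ i I erefl).
  by rewrite /c; case: cid2 => ? /= _ <-.
- by exists (b ord0) => c Mc; apply: (Hb (Dc c)); exists c.
Qed.

End monster.
End henson_theory.

(** * Finitely additive measures and their atoms *)

Section contents.
Variables (R : realType) (r : nat) (U : structure).
Hypothesis hU : henson r U.

(** The total mass is left free so that a Keisler measure minus its atomic part is covered too. *)
Definition is_content n (nu : set ('I_n -> U) -> R) :=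
  (forall D, definable_over setT D -> 0 <= nu D) /\
  (forall D1 D2, definable_over setT D1 -> definable_over setT D2 ->
     D1 `&` D2 = set0 -> nu (D1 `|` D2) = nu D1 + nu D2).

Lemma keisler_content n (mu : keisler R U n) : is_content mu.
Proof. by split; [exact: kmeas_ge0|exact: kmeasU]. Qed.

Section content_theory.
Variables (n : nat) (nu : set ('I_n -> U) -> R).
Hypothesis nuP : is_content nu.
Implicit Types D E : set ('I_n -> U).
Notation def := (definable_over (setT : set U)).

Lemma content0 : nu set0 = 0.
Proof.
have /(_ (setI0 _)) := nuP.2 set0 set0 (definable0 _ _) (definable0 _ _).
by rewrite setU0; lra.
Qed.

Lemma content_split D E : def D -> def E -> nu D = nu (D `&` E) + nu (D `\` E).
Proof.
move=> dD dE.
have disj : (D `&` E) `&` (D `\` E) = set0.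
  by apply/seteqP; split=> // x [[_ ?] [_]].
have := nuP.2 _ _ (definableI hU dD dE) (definableD hU dD dE) disj.
by rewrite setUIDK.
Qed.

Lemma content_le D E : def D -> def E -> D `<=` E -> nu D <= nu E.
Proof.
move=> dD dE DE; rewrite (content_split dE dD) (_ : E `&` D = D).
  by rewrite lerDl; apply: nuP.1; exact: (definableD hU).
by apply/seteqP; split=> [x []//|x Dx]; split=> //; exact: DE.
Qed.

Lemma contentU_le D E : def D -> def E -> nu (D `|` E) <= nu D + nu E.
Proof.
move=> dD dE; have dU := definableU hU dD dE.
rewrite (content_split dU dD) (_ : _ `&` D = D); last first.
  by apply/seteqP; split=> [x []//|x Dx]; split=> //; left.
rewrite lerD2l; apply: content_le => //; first exact: (definableD hU).
by move=> x [[]].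
Qed.

Lemma content_bigU_le k (D : 'I_k -> set ('I_n -> U)) : (forall i, def (D i)) ->
  nu [set x | exists i, D i x] <= \sum_i nu (D i).
Proof.
elim: k D => [|k IH] D dD.
  rewrite big_ord0 (_ : mkset _ = set0) ?content0//.
  by apply/seteqP; split=> // x [[]].
rewrite big_ord_recl (_ : mkset _ = D ord0 `|` [set x | exists i, D (lift ord0 i) x]).
  apply: le_trans (contentU_le _ _) _ => //; first exact: (definable_bigU hU).
  by rewrite lerD2l; exact: IH.
apply/seteqP; split=> [x [i]|x [h|[i h]]].
- by have [j ->|->] := unliftP ord0 i; [right; exists j|left].
- by exists ord0.
- by exists (lift ord0 i).
Qed.

End content_theory.

Lemma kmeas_le1 n (mu : keisler R U n) D : definable_over setT D -> mu D <= 1.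
Proof.
by move=> dD; rewrite -(kmeas_setT mu); apply: (content_le (keisler_content mu)) => //; exact: definableT.
Qed.

Lemma kmeasC n (mu : keisler R U n) D : definable_over setT D -> mu (~` D) = 1 - mu D.
Proof.
move=> dD; have := content_split (keisler_content mu) (definableT _ _) dD.
by rewrite kmeas_setT setTI setTD; lra.
Qed.

Lemma definable_pt (a : U) : definable_over setT [set pt a].
Proof. exact: definable_point. Qed.

Lemma pt_inj : injective (@pt U).
Proof. by move=> a b /(congr1 (fun f => f ord0)). Qed.

Lemma infinite_points_unbounded (mu : keisler R U 1) (A : set U) w n :
  infinite_set A -> (forall a, A a -> w <= mu [set pt a]) ->
  exists2 F : set U, finite_set F & w * n%:R <= mu (@pt U @` F).
Proof.
move=> infA Aw; suff [F [fF FA wF]] : exists F : set U,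
    [/\ finite_set F, F `<=` A & w * n%:R <= mu (@pt U @` F)] by exists F.
elim: n => [|n [F [fF FA wF]]].
  exists set0; split=> //; rewrite mulr0 kmeas_ge0// image_set0; exact: definable0.
have [a [Aa nFa]] : exists a, A a /\ ~ F a.
  apply: contrapT => ne; apply: infA; apply: sub_finite_set fF => a Aa.
  by apply: contrapT => nFa; apply: ne; exists a.
exists (a |` F); split.
- by rewrite finite_setU; split.
- by move=> x [->|/FA].
rewrite image_setU image_set1 kmeasU.
- by rewrite -natr1 mulrDr mulr1 addrC lerD// Aw.
- exact: definable_pt.
- by apply: definable_finite => //; exact: finite_image.
- by apply/seteqP; split=> // x [-> [b Fb /pt_inj ba]]; apply: nFa; rewrite -ba.
Qed.

Lemma finite_heavy_points (mu : keisler R U 1) w : 0 < w ->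
  finite_set [set a : U | w <= mu [set pt a]].
Proof.
move=> w0; apply: contrapT => infA.
have [F fF] := infinite_points_unbounded (Num.truncn w^-1).+1 infA (fun a h => h).
apply/negP; rewrite -ltNge; apply: (@le_lt_trans _ _ 1).
  apply: kmeas_le1; apply: definable_finite => //; exact: finite_image.
by rewrite -ltr_pdivrMl// mulr1 truncnS_gt.
Qed.

Lemma countable_atoms (mu : keisler R U 1) : countable [set a : U | 0 < mu [set pt a]].
Proof.
rewrite (_ : mkset _ = \bigcup_(k in [set: nat]) [set a : U | k.+1%:R^-1 <= mu [set pt a]]).
  apply: bigcup_countable => // k _; apply: finite_set_countable.
  by apply: finite_heavy_points; rewrite invr_gt0.
apply/seteqP; split=> [a /= a0|a [k _ /=]]; last by apply: lt_le_trans; rewrite invr_gt0.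
exists (Num.truncn (mu [set pt a])^-1) => //=.
by rewrite invf_ple ?posrE// ltW// truncnS_gt.
Qed.

(** The enumeration may have gaps, for instance when the atoms are finite in number. Indices with
    [w k = 0] are padding with a default point, so injectivity is claimed only at positive
    weights. *)
Lemma atoms_seq (mu : keisler R U 1) : exists (w : nat -> R) (a : nat -> U),
  [/\ forall k, 0 <= w k, forall k, 0 < w k -> w k = mu [set pt (a k)],
      forall k l, 0 < w k -> 0 < w l -> a k = a l -> k = l &
      forall x, 0 < mu [set pt x] -> exists k, a k = x /\ w k = mu [set pt x]].
Proof.
have /countable_injP[g gi] := countable_atoms mu.
pose P k x := 0 < mu [set pt x] /\ g x = k.
have [u0 _] := carrier_nonempty U.
pose a k := if pselect (exists x, P k x) is left e then sval (cid e) else u0.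
pose w k := if `[< exists x, P k x >] then mu [set pt (a k)] else 0.
have aP k : (exists x, P k x) -> P k (a k).
  by rewrite /a; case: pselect => // e _; case: cid.
have w0 k : 0 < w k -> P k (a k) /\ w k = mu [set pt (a k)].
  by rewrite /w; case: asboolP => [/aP//|]; rewrite ltxx.
exists w, a; split.
- move=> k; rewrite /w; case: asboolP => // _.
  by apply: kmeas_ge0; exact: definable_pt.
- by move=> k /w0[].
- by move=> k l /w0[[_ gk] _] /w0[[_ gl] _] akl; rewrite -gk -gl akl.
- move=> x x0; exists (g x); have Px : exists y, P (g x) y by exists x.
  have [h1 h2] := aP _ Px.
  have ax : a (g x) = x by apply: gi => //; rewrite inE.
  by split=> //; rewrite /w ax; case: asboolP.
Qed.

Lemma indicU_disj (T : Type) (A B : set T) (x : T) : A `&` B = set0 ->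
  \1_(A `|` B) x = \1_A x + \1_B x :> R.
Proof.
move=> AB; rewrite !indicE in_setU.
have [xA|] := boolP (x \in A); have [xB|] := boolP (x \in B); rewrite ?addr0 ?add0r//.
by have : (A `&` B) x; [split; exact: set_mem|rewrite AB].
Qed.

Definition disc (w : nat -> R) (a : nat -> U) (D : set ('I_1 -> U)) : R :=
  limn (series (fun k => w k * \1_D (pt (a k)))).

Section discrete.
Variables (w : nat -> R) (a : nat -> U).
Hypothesis w0 : forall k, 0 <= w k.

Hypothesis w_cvg : cvgn (series w).

Let term0 (D : set ('I_1 -> U)) k : 0 <= w k * \1_D (pt (a k)) :> R.
Proof. by rewrite mulr_ge0. Qed.

Let term_le (D : set ('I_1 -> U)) k : w k * \1_D (pt (a k)) <= w k.
Proof. by rewrite ler_piMr// indicE; case: (_ \in _). Qed.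

Lemma disc_cvg D : cvgn (series (fun k => w k * \1_D (pt (a k)))).
Proof. exact: (series_le_cvg (term0 D) w0 (term_le D)). Qed.

Let series_nd (u : nat -> R) : (forall k, 0 <= u k) -> {homo series u : m n / (m <= n)%N >-> m <= n}.
Proof. by move=> u0 m n mn; apply: nondecreasing_series. Qed.

Lemma disc_partial D n : \sum_(k < n) w k * \1_D (pt (a k)) <= disc w a D.
Proof.
rewrite -(big_mkord predT (fun k => w k * \1_D (pt (a k)))).
exact: (nondecreasing_cvgn_le (series_nd (term0 D)) (disc_cvg (D := D))).
Qed.

Lemma disc_ge0 D : 0 <= disc w a D.
Proof. by have := disc_partial D 0; rewrite big_ord0. Qed.

Lemma disc_ge D k : D (pt (a k)) -> w k <= disc w a D.
Proof.
move=> Dk; apply: le_trans (disc_partial D k.+1).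
rewrite big_ord_recr /= indicE mem_set// mulr1 lerDr.
exact: sumr_ge0.
Qed.

Lemma disc_le D c : (forall n, \sum_(k < n) w k * \1_D (pt (a k)) <= c) -> disc w a D <= c.
Proof.
move=> h; apply: limr_le; first exact: disc_cvg.
by apply: nearW => n; rewrite /series /= big_mkord.
Qed.

Lemma discU D1 D2 : D1 `&` D2 = set0 -> disc w a (D1 `|` D2) = disc w a D1 + disc w a D2.
Proof.
move=> D12; rewrite /disc -lim_seriesD; try exact: disc_cvg.
congr (limn (series _)); apply/funext => k; rewrite /= -mulrDr; congr (_ * _).
by rewrite /= indicU_disj.
Qed.

Lemma disc_content : is_content (disc w a).
Proof. by split=> [D _|D1 D2 _ _]; [exact: disc_ge0|exact: discU]. Qed.

Lemma discT : disc w a setT = limn (series w).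
Proof. by rewrite /disc; congr (limn (series _)); apply/funext => k; rewrite indicT mulr1. Qed.

(** The bound from below by partial sums, applied to the complement of D. *)
Lemma disc_le_partial D n :
  disc w a D <= \sum_(k < n) w k * \1_D (pt (a k)) + (limn (series w) - \sum_(k < n) w k).
Proof.
have h := disc_partial (~` D) n.
have e : disc w a D + disc w a (~` D) = limn (series w) by rewrite -discU ?setICr// setUCr discT.
have {1}-> : disc w a D = limn (series w) - disc w a (~` D) by lra.
rewrite addrCA lerD2l -opprB lerN2 -sumrB; apply: le_trans h.
by apply: ler_sum => k _; rewrite !indicE in_setC; case: (_ \in D); rewrite /=; lra.
Qed.

Lemma disc_tail D n : (forall k, (k < n)%N -> ~ D (pt (a k))) ->
  disc w a D <= limn (series w) - \sum_(k < n) w k.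
Proof.
move=> nD; apply: le_trans (disc_le_partial D n) _; rewrite big1 ?add0r// => i _.
by rewrite indicE memNset ?mulr0//; exact: nD.
Qed.

Lemma disc_scale D (x : R) : disc (fun k => w k * x) a D = disc w a D * x.
Proof.
have E : series (fun k => w k * x * \1_D (pt (a k))) =
    (fun n => series (fun k => w k * \1_D (pt (a k))) n * x).
  by apply/funext => n; rewrite /series /= mulr_suml; apply: eq_bigr => k _; ring.
by rewrite /disc E; apply/cvg_lim => //; apply: cvgMl; exact: disc_cvg.
Qed.

End discrete.

Section discrete_keisler.
Variables (w : nat -> R) (a : nat -> U).
Hypothesis w0 : forall k, 0 <= w k.
Hypothesis w1 : series w @ \oo --> (1 : R).

Let w_cvg : cvgn (series w).
Proof. by apply/cvg_ex; exists 1. Qed.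

Definition kdisc_fun (D : set ('I_1 -> U)) : R :=
  if `[< definable_over setT D >] then disc w a D else 0.

Let kdiscE D : definable_over setT D -> kdisc_fun D = disc w a D.
Proof. by move=> dD; rewrite /kdisc_fun; case: asboolP. Qed.

Lemma kdisc_junk D : ~ definable_over setT D -> kdisc_fun D = 0.
Proof. by rewrite /kdisc_fun; case: asboolP. Qed.

Lemma kdisc_ge0 D : definable_over setT D -> 0 <= kdisc_fun D.
Proof. by move=> dD; rewrite kdiscE// disc_ge0. Qed.

Lemma kdisc_setT : kdisc_fun setT = 1.
Proof. by rewrite kdiscE ?discT//; [exact/cvg_lim|exact: definableT]. Qed.

Lemma kdiscU D1 D2 : definable_over setT D1 -> definable_over setT D2 ->
  D1 `&` D2 = set0 -> kdisc_fun (D1 `|` D2) = kdisc_fun D1 + kdisc_fun D2.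
Proof. by move=> d1 d2 d12; rewrite !kdiscE ?discU//; exact: (definableU hU). Qed.

Definition kdisc : keisler R U 1 := Keisler kdisc_junk kdisc_ge0 kdisc_setT kdiscU.

Lemma kdisc_trivial : is_trivial kdisc.
Proof.
by exists w, a; split=> // D dD; rewrite /= kdiscE//; exact: disc_cvg.
Qed.

End discrete_keisler.

Lemma trivial_disc (mu : keisler R U 1) w a :
  (forall D, definable_over setT D -> series (fun k => w k * \1_D (pt (a k))) @ \oo --> mu D) ->
  forall D, definable_over setT D -> mu D = disc w a D.
Proof. by move=> h D /h /cvg_lim <-. Qed.

Lemma atoms_disc_le (mu : keisler R U 1) w a :
  (forall k, 0 <= w k) -> (forall k, 0 < w k -> w k = mu [set pt (a k)]) ->
  (forall k l, 0 < w k -> 0 < w l -> a k = a l -> k = l) ->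
  cvgn (series w) /\ forall D, definable_over setT D -> disc w a D <= mu D.
Proof.
move=> w0 wE wi.
pose E n := [set x | exists i : 'I_n, 0 < w i /\ x = pt (a i)].
have fE n : finite_set (E n).
  apply: (@sub_finite_set _ _ (range (fun i : 'I_n => pt (a i)))).
    by move=> x [i [_ ->]]; exists i.
  exact: finite_image.
have dE n : definable_over setT (E n) by exact: definable_finite.
(* Removing the atoms one at a time is exact, because positive indices enumerate distinct atoms with
   their full mass and [E n] omits the padding. *)
have part D n : definable_over setT D ->
    mu D = \sum_(k < n) w k * \1_D (pt (a k)) + mu (D `\` E n).
  move=> dD; elim: n => [|n IH].
    by rewrite big_ord0 add0r (_ : E 0%N = set0) ?setD0//; apply/seteqP; split=> // x [[]].
  rewrite IH big_ord_recr /= -addrA; congr +%R.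
  have [wn0|wn0] := eqVneq (w n) 0.
    rewrite wn0 mul0r add0r; congr (mu (_ `\` _)).
    apply/seteqP; split=> x [i [wi0 ->]]; first by exists (widen_ord (leqnSn n) i).
    have [j ij|ij] := unliftP ord_max i; last by move: wi0; rewrite ij /= wn0 ltxx.
    have e : (i : nat) = j by rewrite ij lift_max.
    by exists j; rewrite -e.
  have {}wn0 : 0 < w n by rewrite lt_neqAle eq_sym wn0 w0.
  have dDE : definable_over setT (D `\` E n) by exact: (definableD hU).
  rewrite (content_split (keisler_content mu) dDE (definable_pt (a n))); congr (_ + mu _).
    rewrite indicE; have [/set_mem Dn|nDn] := boolP (_ \in D).
      rewrite mulr1 wE//; congr (mu _); apply/seteqP; split=> [x []//|x ->].
      split=> //; split=> // -[i [wi0 /pt_inj ani]].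
      by have /eqP := wi _ _ wn0 wi0 ani; rewrite gtn_eqF.
    rewrite mulr0 (_ : _ `&` _ = set0) ?(content0 (keisler_content mu))//.
    by apply/seteqP; split=> // x [[Dx _] xn]; move: nDn; rewrite -xn mem_set.
  apply/seteqP; split=> x.
    move=> [[Dx nE] xn]; split=> // -[i [wi0 xi]].
    have [j ij|ij] := unliftP ord_max i; last by move: xi; rewrite ij.
    by apply: nE; exists j; move: wi0 xi; rewrite ij lift_max.
  move=> [Dx nE]; split; last by move=> xn; apply: nE; exists ord_max.
  by split=> // -[i [wi0 xi]]; apply: nE; exists (widen_ord (leqnSn n) i).
have part_le D n : definable_over setT D -> \sum_(k < n) w k * \1_D (pt (a k)) <= mu D.
  by move=> dD; rewrite (part D n dD) lerDl kmeas_ge0//; exact: (definableD hU).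
have wc : cvgn (series w).
  apply: nondecreasing_is_cvgn.
    by move=> m n mn; apply: nondecreasing_series.
  exists 1 => _ [n _ <-]; rewrite /series /= big_mkord.
  have := part_le setT n (definableT _ _); rewrite kmeas_setT.
  by under eq_bigr do rewrite indicT mulr1.
by split=> // D dD; apply: disc_le => // n; exact: part_le.
Qed.

End contents.

(** * The type p_E and dfs measures *)

Section generic_type.
Variables (r : nat) (U : structure).
Hypothesis hU : henson r U.
Hypothesis r_gt1 : (1 < r)%N.
Notation def := (definable_over (setT : set U)).

Definition generic_over (C : set U) : set ('I_1 -> U) :=
  [set x | forall c, C c -> x ord0 <> c /\ ~ edge (x ord0) c].

Lemma generic_nonempty C : finite_set C -> exists x, generic_over C x.
Proof.
move=> fC; have [f Cf h|y Hy] := henson_ext hU (X := set0) fC _.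
  by have [] := h (Ordinal (ltnW r_gt1)).
by exists (pt y) => c /Hy[? [h _]]; split=> // /h.
Qed.

Lemma generic_sim C x x' : generic_over C x -> generic_over C x' -> sim C x x'.
Proof.
move=> gx gx'; rewrite -(pt_ord0 x) -(pt_ord0 x').
apply: sim_pt; [exact: henson_irr hU _|exact: henson_irr hU _|move=> c Cc].
by have [? ?] := gx c Cc; have [? ?] := gx' c Cc.
Qed.

Lemma generic_overS C C' : C `<=` C' -> generic_over C' `<=` generic_over C.
Proof. by move=> CC' x h c /CC'; exact: h. Qed.

Lemma definable_generic C : finite_set C -> def (generic_over C).
Proof.
move=> fC; apply: (@invariant_definable _ _ C) => // x x' [_ h] gx c Cc.
by have [<- <-] := h ord0 c Cc; exact: gx.
Qed.

Definition pE_set : set (set ('I_1 -> U)) :=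
  [set D | def D /\ exists2 C, finite_set C & generic_over C `<=` D].

Lemma generic_dichotomy (C : set U) (D : set ('I_1 -> U)) : sim_invariant C D ->
  generic_over C `<=` D \/ generic_over C `<=` ~` D.
Proof.
move=> iD; have [[x [gx Dx]]|n] := pselect (exists x, generic_over C x /\ D x).
  by left=> x' gx'; apply: iD Dx; exact: generic_sim.
by right=> x gx Dx; apply: n; exists x.
Qed.

Lemma pE_complete : is_complete_type setT pE_set.
Proof.
split=> [D []//|k D pD|D dD].
  have [C fC CD] : exists2 C, finite_set C & forall x, generic_over C x -> forall i, D i x.
    elim: k D pD => [|k IH] D pD; first by exists set0 => // x _ [].
    have [C fC CD] := IH _ (fun i => pD (lift ord0 i)).
    have [_ [C' fC' C'D]] := pD ord0.
    exists (C `|` C'); first by rewrite finite_setU.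
    move=> x gx i; have [j ->|->] := unliftP ord0 i.
      by apply: CD; apply: generic_overS gx => c; left.
    by apply: C'D; apply: generic_overS gx => c; right.
  by have [x gx] := generic_nonempty fC; exists x => i; exact: CD.
have [C [fC _ iD]] := definable_invariant hU dD.
have [CD|CD] := generic_dichotomy iD; [left|right]; split=> //.
- by exists C.
- exact: definable_overC.
- by exists C.
Qed.

Definition pE : ctype setT 1 := CType pE_complete.

Lemma pE_avoids b : in_type pE [set x | ~ edge (x ord0) b].
Proof.
split; first by apply/definable_overC/(@definable_nbr _ setT).
by exists [set b] => // x /(_ b erefl)[].
Qed.

Section complete_type.
Variable p : ctype (U := U) setT 1.

Lemma ctype_up D E : in_type p D -> def E -> D `<=` E -> in_type p E.
Proof.
have [_ fip comp] := ctypeP p; move=> pD dE DE.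
have [//|pE'] := comp E dE.
have [|a ha] := fip 2 (fun i => if i == ord0 then D else ~` E).
  by move=> i; case: ifP.
by have := ha ord_max; case; apply: DE; exact: ha ord0.
Qed.

Lemma ctypeI D E : in_type p D -> in_type p E -> in_type p (D `&` E).
Proof.
have [pdef fip comp] := ctypeP p; move=> pD pE'.
have [//|pC] := comp (D `&` E) (definableI hU (pdef _ pD) (pdef _ pE')).
have [|a ha] := fip 3 (fun i => if i == ord0 then D else if i == ord_max then ~` (D `&` E) else E).
  by move=> i; case: ifP => // _; case: ifP.
have := ha ord_max; case; split; first exact: ha ord0.
exact: ha (@Ordinal 3 1 isT).
Qed.

Hypothesis p_avoids : forall b : U, in_type p [set x | ~ edge (x ord0) b].

(** The hypothesis on p only speaks of edges. A type containing x = c would contain E(x, b) for a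
    neighbour b of c, and such a b exists because one point contains no K_r when r > 1. *)
Lemma avoids_generic C : finite_set C -> in_type p (generic_over C).
Proof.
have [pdef fip comp] := ctypeP p.
have p_point c : in_type p (~` [set pt c]).
  have [pc|//] := comp _ (definable_point (I : setT c)).
  have [f Cf h|b Hb] := henson_ext hU (C := [set c]) (X := setT) (finite_set1 c) _.
    pose i0 : 'I_r := Ordinal (ltnW r_gt1); pose i1 : 'I_r := Ordinal r_gt1.
    have := Cf i0 i1 isT; have [-> _] := h i0; have [-> _] := h i1.
    exact: henson_irr hU c.
  have [|a ha] := fip 2 (fun i => if i == ord0 then [set pt c] else [set x | ~ edge (x ord0) b]).
    by move=> i; case: ifP.
  have := ha ord_max; have /= -> := ha ord0; case; rewrite /pt.
  by apply/(henson_symE hU); have [_ ->] := Hb c erefl.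
move=> /finite_enum[n [c [_ <-]]].
suff : in_type p [set x | forall i, x ord0 <> c i /\ ~ edge (x ord0) (c i)].
  move=> h; apply: ctype_up h _ _.
    by apply: definable_generic; exact: finite_image.
  by move=> x hx _ [i _ <-].
elim: n c => [|n IH] c.
  rewrite (_ : mkset _ = setT); last by apply/seteqP; split=> // x _ [].
  have [//|p0] := comp setT (definableT _ _).
  by have [//|a] := fip 1%N (fun=> ~` setT); move=> /(_ ord0); case.
rewrite (_ : mkset _ = ((~` [set pt (c ord0)]) `&` [set x | ~ edge (x ord0) (c ord0)]) `&`
   [set x | forall i, x ord0 <> c (lift ord0 i) /\ ~ edge (x ord0) (c (lift ord0 i))]).
  by apply: ctypeI; [exact: ctypeI|exact: IH].
apply/seteqP; split=> [x h|x [[h1 h2] h] i].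
  split=> [|i]; last exact: h.
  by split; [move=> xc; have [+ _] := h ord0; apply; rewrite xc|have [] := h ord0].
have [j ->|->] := unliftP ord0 i; first exact: h.
by split=> // xc; apply: h1; rewrite -xc pt_ord0.
Qed.

Lemma avoids_pE D : in_type p D <-> pE_set D.
Proof.
have [pdef fip comp] := ctypeP p; split=> [pD|[dD [C fC CD]]].
  have dD := pdef _ pD; split=> //.
  have [C [fC _ iD]] := definable_invariant hU dD; exists C => //.
  have [//|CD] := generic_dichotomy iD.
  have := ctypeI pD (avoids_generic fC) => pI.
  by have [//|a] := fip 1%N (fun=> D `&` generic_over C); move=> /(_ ord0)[Da /CD].
by apply: ctype_up CD => //; exact: avoids_generic.
Qed.

End complete_type.

Lemma pE_unique (p : ctype (U := U) setT 1) :
  (forall b : U, in_type p [set x | ~ edge (x ord0) b]) -> pE = p.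
Proof.
move=> /avoids_pE h; case: p h => q qP /= h.
have pq : pE_set = q by apply/seteqP; split=> D; rewrite (h D).
rewrite /pE; move: pE_complete; rewrite pq => qP'.
by congr CType; exact: Prop_irrelevance.
Qed.

(** D is decided by the generic points over a finite C, and the non-generic points are covered by
    finitely many points and neighbourhoods, all of mass 0. *)
Lemma content_generic (R : realType) (nu : set ('I_1 -> U) -> R) : is_content nu ->
  (forall b, nu (nbr b) = 0) -> (forall c, nu [set pt c] = 0) ->
  forall D, def D -> nu D = nu setT * \1_pE_set D.
Proof.
move=> nuP nu_nbr nu_pt D dD.
have [C [fC _ iD]] := definable_invariant hU dD.
have nuG : nu (~` generic_over C) = 0.
  have dG := definable_overC (definable_generic fC).
  apply/eqP; rewrite eq_le nuP.1// andbT.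
  have [n [c [_ Cc]]] := finite_enum fC.
  have dE i : def ([set pt (c i)] `|` nbr (c i)).
    by apply: (definableU hU); [exact: definable_point|exact: (@definable_nbr _ setT)].
  apply: (@le_trans _ _ (nu [set x | exists i, ([set pt (c i)] `|` nbr (c i)) x])).
    apply: (content_le hU nuP) => //; first exact: (definable_bigU hU).
    move=> x nx; apply: contrapT => ne; apply: nx; rewrite -Cc => _ [i _ <-].
    split=> [xc|xc]; apply: ne; exists i; [left|by right].
    by rewrite -xc pt_ord0.
  apply: le_trans (content_bigU_le hU nuP dE) _.
  apply: sumr_le0 => i _.
  apply: le_trans (contentU_le hU nuP _ _) _; first exact: definable_point.
    exact: (@definable_nbr _ setT).
  by rewrite nu_pt nu_nbr addr0.
have nuGle E : def E -> E `<=` ~` generic_over C -> nu E = 0.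
  move=> dE EG; apply/eqP; rewrite eq_le nuP.1// andbT -nuG.
  by apply: (content_le hU nuP) => //; exact/definable_overC/definable_generic.
have [CD|CD] := generic_dichotomy iD.
  rewrite indicE mem_set ?mulr1; last by split=> //; exists C.
  rewrite (content_split hU nuP (definableT _ _) dD) setTI setTD.
  by rewrite (nuGle (~` D)) ?addr0//; [exact: definable_overC|exact: subsetC].
rewrite indicE memNset ?mulr0; last first.
  move=> [_ [C' fC' C'D]].
  have [|x gx] := @generic_nonempty (C `|` C'); first by rewrite finite_setU.
  apply: (CD x); first by apply: generic_overS gx => c; left.
  by apply: C'D; apply: generic_overS gx => c; right.
by apply: nuGle => // x Dx /CD.
Qed.

End generic_type.

(** * Finitely approximated measures are dfs; decomposition of dfs measures *)

Section dfs.
Variables (R : realType) (r : nat) (U : structure) (K : Type).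
Hypothesis hU : henson r U.
Hypothesis r_gt1 : (1 < r)%N.
Hypothesis K_uncountable : ~ countable [set: K].
Hypothesis U_saturated : saturated U K.

Lemma Av_inst_sim n m (a : 'I_n -> U) (phi : fmla (1 + m)) (b b' : 'I_m -> U) :
  sim (range a) b b' -> Av R a (inst phi b) = Av R a (inst phi b').
Proof.
move=> [h1 h2]; rewrite /Av; congr (_%:R / _); apply: eq_card => i.
rewrite !inE; apply: asbool_equiv_eq; rewrite /inst /=.
apply: (sat_sim hU phi); apply: (sim_cons hU) => // j.
have [h3 h4] := h2 j (a i) (ex_intro2 _ _ i I erefl).
rewrite (henson_symE hU _ (b j)) (henson_symE hU _ (b' j)).
by split=> //; split=> /esym/h3/esym.
Qed.

Definition approximated_in (M : set U) (mu : keisler R U 1) : Prop :=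
  forall m (phi : fmla (1 + m)) (eps : R), 0 < eps ->
    exists n (a : 'I_n.+1 -> U), (forall i, M (a i)) /\
      forall b : 'I_m -> U, `|mu (inst phi b) - Av R a (inst phi b)| < eps.

Lemma approximated_dfs (M : set U) (mu : keisler R U 1) : approximated_in M mu ->
  definable_measure_over M mu /\ finitely_satisfiable_in M mu.
Proof.
move=> fam; split.
  move=> m phi C cC _.
  pose good k n (a : 'I_n.+1 -> U) := (forall i, M (a i)) /\
     forall b : 'I_m -> U, `|mu (inst phi b) - Av R a (inst phi b)| < k.+1%:R^-1.
  (* The condition that the average lies within 1/(k + 1) of C. It depends only on the type of b
     over the finite set of sample points, hence is definable over M. *)
  pose Dk k n (a : 'I_n.+1 -> U) : set ('I_m -> U) :=
    [set b | exists2 y, C y & `|y - Av R a (inst phi b)| < k.+1%:R^-1].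
  exists [set D | exists k n (a : 'I_n.+1 -> U), good k n a /\ D = Dk k n a].
    move=> _ [k [n [a [[Ma _] ->]]]].
    apply: (@invariant_definable _ _ (range a)); first exact: finite_image.
      by move=> _ [i _ <-].
    by move=> b b' /Av_inst_sim bb' [y Cy]; rewrite bb'; exists y.
  apply/seteqP; split=> b /=.
    by move=> Cb _ [k [n [a [[_ ga] ->]]]]; exists (mu (inst phi b)).
  (* A point b satisfying all these conditions has measure within 2/(k + 1) of C for every k, and C
     is closed. *)
  move=> h; rewrite closure_id in cC; rewrite cC => B /nbhs_ballP[e /= e0 eB].
  pose k := Num.truncn (2 / e).
  have k0 : 0 < k.+1%:R^-1 :> R by rewrite invr_gt0.
  have ke : k.+1%:R^-1 + k.+1%:R^-1 < e.
    rewrite -mulr2n -[_ *+ 2]mulr_natl ltr_pdivrMr// -ltr_pdivrMl// mulrC.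
    exact: truncnS_gt.
  have [n [a [Ma ga]]] := fam m phi _ k0.
  have [y Cy hy] : Dk k n a b by apply: h; exists k, n, a.
  exists y; split=> //; apply: eB; rewrite /ball /=.
  rewrite (_ : _ - y = (mu (inst phi b) - Av R a (inst phi b)) - (y - Av R a (inst phi b))); last by ring.
  by apply: le_lt_trans (ler_normB _ _) _; apply: lt_trans ke; apply: ltrD.
move=> D [m [phi [b [_ ->]]]] D0.
(* With the mass of D itself as tolerance, the average cannot vanish. *)
have [n [a [Ma ga]]] := fam m phi _ D0.
have [[i Di]|nD] := pselect (exists i, inst phi b (pt (a i))).
  by exists (pt (a i)) => // j; exact: Ma.
have := ga b; rewrite (_ : Av _ _ _ = 0).
  by rewrite subr0 gtr0_norm// ltxx.
rewrite /Av (_ : #|_| = 0%N) ?mul0r//.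
by apply: eq_card0 => i; rewrite !inE; apply/asboolPn => Di; apply: nD; exists i.
Qed.

Lemma fam_dfs (mu : keisler R U 1) : is_fam K mu -> is_dfs K mu.
Proof. by move=> [M sM /approximated_dfs[]]; exists M. Qed.

Section sandwich.
Variables (n : nat) (mu : keisler R U n) (M : set U).
Hypothesis sM : small K M.
Hypothesis muM : definable_measure_over M mu.

(** The conditions mu >= e and mu <= d are type-definable over M and jointly inconsistent, so by
    compactness a finite part is inconsistent, and its conditions from the first family form D. *)
Lemma sandwich m (phi : fmla (n + m)) (d e : R) : d < e ->
  exists D, [/\ definable_over M D, forall b, e <= mu (inst phi b) -> D b &
                forall b, D b -> d < mu (inst phi b)].
Proof.
move=> de.
(* Intersecting with [0, 1] allows for d or e outside [0, 1]. *)
have clI (x y : R) : closed (`[x, y] `&` `[0, 1] : set R) /\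
    (`[x, y] `&` `[0, 1] : set R) `<=` `[0, 1].
  by split; [apply: closedI; exact: interval_closed|move=> z []].
have mu01 b : 0 <= mu (inst phi b) /\ mu (inst phi b) <= 1.
  have db : definable_over setT (inst phi b) by exists m, phi, b.
  by split; [exact: kmeas_ge0|exact: (kmeas_le1 hU)].
have [G1 dG1 E1] := muM phi (clI e 1).1 (clI e 1).2.
have [G2 dG2 E2] := muM phi (clI 0 d).1 (clI 0 d).2.
have in1 b : e <= mu (inst phi b) -> forall D, G1 D -> D b.
  move=> h; have : (\bigcap_(D in G1) D) b; last by [].
  rewrite -E1; have [h0 h1] := mu01 b.
  by split; rewrite /= in_itv /=; apply/andP; split.
have in2 b : mu (inst phi b) <= d -> forall D, G2 D -> D b.
  move=> h; have : (\bigcap_(D in G2) D) b; last by [].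
  rewrite -E2; have [h0 h1] := mu01 b.
  by split; rewrite /= in_itv /=; apply/andP; split.
have [k [D [GD nD]]] : exists k (D : 'I_k -> set ('I_m -> U)),
    (forall i, (G1 `|` G2) (D i)) /\ ~ exists a, forall i, D i a.
  apply: contrapT => fip.
  have [|k D GD|b Hb] := @compactness U K U_saturated M m (G1 `|` G2) sM.
  - by rewrite subUset.
  - by apply: contrapT => nD; apply: fip; exists k, D.
  have : [set b | (`[e, 1] `&` `[0, 1]) (mu (inst phi b))] b.
    by rewrite E1 => D GD; apply: Hb; left.
  have : [set b | (`[0, d] `&` `[0, 1]) (mu (inst phi b))] b.
    by rewrite E2 => D GD; apply: Hb; right.
  by move=> [/= + _] [/= + _]; rewrite !in_itv /= => /andP[_ h1] /andP[h2 _]; lra.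
exists [set b | forall i, (if `[< G1 (D i) >] then D i else setT) b]; split.
- apply: (definable_bigI hU) => i; case: asboolP => [/dG1//|_]; exact: definableT.
- by move=> b /in1 h i; case: asboolP => // /h.
- move=> b h; rewrite ltNge; apply/negP => /in2 h2; apply: nD; exists b => i.
  have := h i; case: asboolP => // nG1 _; apply: h2.
  by case: (GD i).
Qed.

End sandwich.

Section dfs_representation.
Variables (mu : keisler R U 1) (M : set U).
Hypothesis sM : small K M.
Hypothesis muM : definable_measure_over M mu.
Hypothesis fsM : finitely_satisfiable_in M mu.
Variables (w : nat -> R) (a : nat -> U).
Hypothesis w0 : forall k, 0 <= w k.
Hypothesis w_cvg : cvgn (series w).
Hypothesis w_le : forall D, definable_over setT D -> disc w a D <= mu D.
Hypothesis w_atoms : forall x, 0 < mu [set pt x] -> exists k, a k = x /\ w k = mu [set pt x].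

Let nu (D : set ('I_1 -> U)) := mu D - disc w a D.

Lemma diff_content : is_content nu.
Proof.
split=> [D dD|D1 D2 d1 d2 d12]; first by rewrite subr_ge0 w_le.
by rewrite /nu kmeasU// discU//; ring.
Qed.

Lemma diff_pt c : nu [set pt c] = 0.
Proof.
have dc := @definable_pt U c.
apply/eqP; rewrite eq_le diff_content.1// andbT subr_le0.
have [/w_atoms[k [<- <-]]|h] := ltP 0 (mu [set pt c]); first exact: disc_ge.
by apply: le_trans h _; exact: disc_ge0.
Qed.

Lemma diff_finite F : finite_set F -> nu F = 0.
Proof.
move=> fF; have dF : definable_over setT F by exact: definable_finite.
apply/eqP; rewrite eq_le diff_content.1// andbT.
have [n [v [_ Fv]]] := finite_enum fF.
rewrite (_ : F = [set x | exists i, [set pt (v i ord0)] x]); last first.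
  rewrite -Fv; apply/seteqP; split=> x; first by move=> [i _ <-]; exists i; rewrite /= pt_ord0.
  by move=> [i ->]; exists i; rewrite // pt_ord0.
apply: le_trans (content_bigU_le hU diff_content _) _.
  by move=> i; exact: definable_point.
by rewrite big1// => i _; exact: diff_pt.
Qed.

Lemma null_off_model D : definable_over setT D -> (forall x, M x -> ~ D (pt x)) -> mu D = 0.
Proof.
move=> dD nD; apply/eqP; rewrite eq_le kmeas_ge0// andbT leNgt; apply/negP.
by move=> /(fsM dD)[x Dx Mx]; apply: (nD (x ord0)); rewrite ?pt_ord0.
Qed.

Lemma dnbr b : definable_over setT (nbr b : set ('I_1 -> U)).
Proof. exact: (@definable_nbr _ setT). Qed.

(* A point b' outside M with the same trace on the finite support of the
   formula squeezed around mu(E(x,b)) and no other neighbour in M has almost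
   as heavy a neighbourhood, but by finite satisfiability only the finite
   trace contributes. *)
Lemma diff_nbr_out b : ~ M b -> nu (nbr b) = 0.
Proof.
move=> nMb; apply/eqP; rewrite eq_le diff_content.1 ?andbT; last exact: dnbr.
rewrite subr_le0; apply/ler_addgt0Pr => eta eta0.
pose phi : fmla (1 + 1) := Fedge (lshift 1 ord0) (rshift 1 ord0).
have phiE c : inst phi (pt c) = nbr c :> set ('I_1 -> U).
  by apply/seteqP; split=> x; rewrite /inst /nbr /= catf_lshift catf_rshift.
have : mu (nbr b) - eta < mu (nbr b) by lra.
move=> /(sandwich sM muM phi)[D [dD hD1 hD2]].
have Db : D (pt b) by apply: hD1; rewrite phiE.
have [C [fC CM iD]] := definable_invariant hU dD.
have [f Cf h|b' Hb'] := ext_small hU U_saturated (X := [set c | C c /\ edge c b]) sM _.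
  by apply: (clique_edges_free hU Cf (a := b)) => i; apply/(henson_symE hU); case: (h i) => _ [].
have nMb' : ~ M b' by move=> /Hb'[].
(* Equalities with points of C agree because C lies in M while both b and b' lie outside it. *)
have : D (pt b').
  apply: iD Db; apply: sim_pt; [exact: henson_irr hU _|exact: henson_irr hU _|].
  move=> c Cc; have [h1 h2] := Hb' c (CM c Cc); rewrite h2; split.
    by split=> // bc; case: nMb; rewrite bc; exact: CM.
  by rewrite (henson_symE hU b c); split=> [|[]].
move=> /hD2; rewrite phiE.
pose F : set ('I_1 -> U) := @pt U @` [set c | C c /\ edge c b].
have fF : finite_set F by apply/finite_image/(sub_finite_set _ fC) => c [].
have dF : definable_over setT F by exact: definable_finite.
have F0 : mu (nbr b' `\` F) = 0.
  apply: null_off_model => [|x Mx [/(henson_symE hU) exb nF]].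
    by apply: (definableD hU) => //; exact: dnbr.
  by apply: nF; exists x => //; have [_ <-] := Hb' x Mx.
have h1 : mu (nbr b') <= mu F.
  rewrite (content_split hU (keisler_content mu) (dnbr b') dF) F0 addr0.
  apply: (content_le hU (keisler_content mu)) => //.
  by apply: (definableI hU) => //; exact: dnbr.
have h2 : mu F = disc w a F by apply/eqP; rewrite -subr_eq0; apply/eqP/diff_finite.
have h3 : disc w a F <= disc w a (nbr b).
  apply: (content_le hU (disc_content a w0 w_cvg)) => //; first exact: dnbr.
  by move=> _ [c [_ ?] <-].
lra.
Qed.

Lemma diff_nbr b : nu (nbr b) = 0.
Proof.
have [Mb|] := pselect (M b); last exact: diff_nbr_out.
have [f Cf h|b1 Hb1] := ext_small hU U_saturated (X := [set c | edge c b]) sM _.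
  by apply: (clique_edges_free hU Cf (a := b)) => i; apply/(henson_symE hU); case: (h i).
have nMb1 : ~ M b1 by move=> /Hb1[].
have dI : definable_over setT (nbr b `\` nbr b1 : set ('I_1 -> U)).
  by apply: (definableD hU); exact: dnbr.
apply/eqP; rewrite eq_le diff_content.1 ?andbT; last exact: dnbr.
rewrite (content_split hU diff_content (dnbr b) (dnbr b1)).
rewrite -[leRHS]addr0; apply: lerD.
  rewrite -(diff_nbr_out nMb1); apply: (content_le hU diff_content); last by move=> x [].
    by apply: (definableI hU); exact: dnbr.
  exact: dnbr.
rewrite /nu null_off_model// ?sub0r ?oppr_le0 ?disc_ge0//.
move=> x Mx [/= xb]; apply; apply/(henson_symE hU).
by have [_ ->] := Hb1 x Mx.
Qed.

Lemma diff_generic D : definable_over setT D ->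
  mu D = nu setT * \1_(@pE_set U) D + disc w a D.
Proof.
move=> dD; rewrite -(content_generic hU r_gt1 diff_content diff_nbr diff_pt dD) /nu.
by rewrite subrK.
Qed.

End dfs_representation.

Lemma dfs_representation (mu : keisler R U 1) : is_dfs K mu ->
  exists (t : R) (nu : keisler R U 1), [/\ 0 <= t <= 1, is_trivial nu &
    forall D, definable_over setT D -> mu D = t * \1_(@pE_set U) D + (1 - t) * nu D].
Proof.
move=> [M [[sM _] muM fsM]].
have [w [a [w0 wE wi wat]]] := atoms_seq hU mu.
have [wc wle] := atoms_disc_le hU w0 wE wi.
have dT := definableT (U := U) setT 1.
have main := diff_generic sM muM fsM w0 wc wle wat.
have := wle _ dT; have := disc_ge0 a w0 wc setT.
move: main; rewrite discT kmeas_setT; set c := limn _ => main c0 c1.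
have sc (x : R) : series (fun k => w k / x) = (fun n => series w n * x^-1).
  by apply/funext => n; rewrite /series /= mulr_suml.
have [cE|cN] := eqVneq c 0.
  (* The trivial part has coefficient 0 here, so any trivial measure will do; this one is the Dirac
     measure at [a 0]. *)
  have d0 : forall k, 0 <= (k == 0%N)%:R :> R by move=> k; rewrite ler0n.
  have d1 : series (fun k => (k == 0%N)%:R) @ \oo --> (1 : R).
    apply/cvgrPdist_lt => e e0; exists 1%N => //= n /= n1.
    rewrite /series /= (big_ltn n1) eqxx big_nat big1 ?addr0 ?subrr ?normr0//.
    by case.
  exists 1, (kdisc hU a d0 d1); split; rewrite ?lexx ?ler01//; first exact: kdisc_trivial.
  move=> D dD; rewrite main// cE subr0 subrr mul0r; congr +%R.
  apply/eqP; rewrite eq_le disc_ge0// andbT.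
  by rewrite -cE /c -(discT w a); apply: (content_le hU (disc_content a w0 wc)).
have cp : 0 < c by rewrite lt_neqAle eq_sym cN.
have d0 k : 0 <= w k / c by rewrite divr_ge0.
have d1 : series (fun k => w k / c) @ \oo --> (1 : R).
  by rewrite sc -(divff cN); apply: cvgMl.
exists (1 - c), (kdisc hU a d0 d1); split; [by apply/andP; split; lra|exact: kdisc_trivial|].
move=> D dD; rewrite main//; congr +%R; rewrite /= /kdisc_fun; case: asboolP => // _.
by rewrite disc_scale// opprB addrC subrK mulrCA divff// mulr1.
Qed.

End dfs.

(** * Finite approximations *)

Section weighted_average.
Variables (R : realType) (U : structure).

Lemma card_nth_count (T : Type) (P : pred T) x0 (s : seq T) n : size s = n ->
  #|[pred i : 'I_n | P (nth x0 s i)]| = count P s.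
Proof.
by move=> <-; rewrite -sum1_card -sum1_count (big_nth x0) big_mkord; apply: eq_bigl.
Qed.

(** Real weights are replaced by integer multiplicities; the error bound is uniform over all sets
    D. *)
Lemma weighted_average (I : finType) (w : I -> R) (a : I -> U) (eps : R) :
  (forall i, 0 <= w i) -> \sum_i w i = 1 -> 0 < eps ->
  exists n (b : 'I_n.+1 -> U), (forall j, exists i, b j = a i) /\
    forall D, `|\sum_i w i * \1_D (pt (a i)) - Av R b D| <= eps.
Proof.
move=> w0 w1 eps0.
pose N := (Num.truncn (#|I|%:R / eps)).+1.
have N0 : 0 < N%:R :> R by rewrite ltr0n.
have NI : #|I|%:R <= eps * N%:R.
  by rewrite mulrC -ler_pdivrMr// ltW// truncnS_gt.
(* Rounding up errs in one direction and by at most 1 per index, so the sample size lies between N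
   and N + #|I|, where N was chosen with #|I| <= eps N. *)
pose m i := (Num.truncn (N%:R * w i)).+1.
have mN i : N%:R * w i <= (m i)%:R <= N%:R * w i + 1.
  have /truncn_itv/andP[h1 h2] : 0 <= N%:R * w i by rewrite mulr_ge0.
  by rewrite ltW//= -natr1 lerD2r.
pose s := flatten [seq nseq (m i) i | i <- index_enum I].
have cs (P : pred I) : (count P s)%:R = \sum_i (m i)%:R * (P i)%:R :> R.
  rewrite /s count_flatten sumnE !big_map natr_sum.
  by apply: eq_bigr => i _; rewrite count_nseq natrM mulrC.
have ss : (size s)%:R = \sum_i (m i)%:R :> R.
  by rewrite -count_predT cs; apply: eq_bigr => i _; rewrite mulr1.
have sI (x : I -> R) : (forall i, 0 <= x i <= 1) ->
  N%:R * \sum_i w i * x i <= \sum_i (m i)%:R * x i <= N%:R * (\sum_i w i * x i) + #|I|%:R.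
  move=> x01; apply/andP; split.
    rewrite mulr_sumr; apply: ler_sum => i _; rewrite mulrA ler_wpM2r//.
      by have /andP[] := x01 i.
    by have /andP[] := mN i.
  rewrite mulr_sumr -sum1_card natr_sum -big_split /=; apply: ler_sum => i _.
  rewrite mulrA; have /andP[x0 x1] := x01 i; have /andP[_ h] := mN i.
  by have := ler_wpM2r x0 h; lra.
have [sN1 sN2] : N%:R <= (size s)%:R :> R /\ (size s)%:R <= N%:R + #|I|%:R :> R.
  have /andP[] : N%:R * (\sum_i w i * 1) <= \sum_i (m i)%:R * 1 <= N%:R * (\sum_i w i * 1) + #|I|%:R.
    by apply: sI => i; rewrite ler01 lexx.
  rewrite ss; under eq_bigr do rewrite mulr1.
  by under [\sum_i (m i)%:R * 1]eq_bigr do rewrite mulr1; rewrite w1 mulr1.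
have s0 : (0 < size s)%N by rewrite -(ltr_nat R); apply: lt_le_trans sN1.
have [n sn] : exists n, size s = n.+1 by exists (size s).-1; rewrite prednK.
have i0 : I by move: s0; rewrite /s; case: (flatten _) => // i.
exists n, (fun j => a (nth i0 s j)); split=> [j|D]; first by exists (nth i0 s j).
pose P i := `[< D (pt (a i)) >].
have -> : Av R (fun j : 'I_n.+1 => a (nth i0 s j)) D = (count P s)%:R / (size s)%:R.
  by rewrite /Av sn -(card_nth_count P i0 sn).
have S0 : 0 < (size s)%:R :> R by rewrite ltr0n.
rewrite cs; set x := \sum_i w i * _; set y := \sum_i (m i)%:R * _.
have xE : x = \sum_i w i * (P i)%:R.
  by apply: eq_bigr => i _; rewrite indicE.
have /andP[h1 h2] : N%:R * x <= y <= N%:R * x + #|I|%:R.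
  by rewrite xE; apply: sI => i; case: (P i) => /=; lra.
have x0 : 0 <= x by rewrite xE; apply: sumr_ge0 => i _; rewrite mulr_ge0.
have x1 : x <= 1.
  by rewrite xE -w1; apply: ler_sum => i _; rewrite ler_piMr//; case: (P i) => /=; lra.
rewrite -(ler_pM2r S0) -[X in _ * X <= _]gtr0_norm// -normrM mulrBl divfK ?gt_eqF//.
apply: (@le_trans _ _ #|I|%:R); last by apply: le_trans NI _; rewrite ler_pM2l.
have I0 : 0 <= #|I|%:R :> R by rewrite ler0n.
move: sN1 sN2 h1 h2 x0 x1 I0; set S := (size s)%:R; set NN := N%:R; set II := #|I|%:R.
by move=> *; rewrite ler_norml; apply/andP; split; nra.
Qed.

Lemma countable_enum (B : set U) : countable B -> exists s : nat -> U, B `<=` range s.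
Proof.
move=> /countable_injP[g gi]; have [u0 _] := carrier_nonempty U.
pose s k := if pselect (exists x, B x /\ g x = k) is left e then sval (cid e) else u0.
exists s => x Bx; exists (g x) => //; rewrite /s; case: pselect => [e|[]]; last by exists x.
by case: cid => y /= [By /gi]; apply; rewrite inE.
Qed.

End weighted_average.

Section representation_fam.
Variables (R : realType) (r : nat) (U : structure) (K : Type).
Hypothesis hU : henson r U.
Hypothesis r_gt1 : (1 < r)%N.
Hypothesis K_uncountable : ~ countable [set: K].

Definition scattered (A : set U) (eps : R) := exists (V : finType) (w : V -> R) (f : V -> U),
  [/\ forall v, A (f v), forall v, 0 <= w v, \sum_v w v = 1 &
      forall b, \sum_(v | `[< edge (f v) b >]) w v <= eps /\ \sum_(v | `[< f v = b >]) w v <= eps].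

Lemma scattered_exists eps : 0 < eps -> exists2 A, finite_set A & scattered A eps.
Proof.
move=> eps0.
have [V [e [w [[eirr esym] Vfree [w0 w1] VI]]]] := clique_sparse_exists (ltnW r_gt1) eps0.
pose e' (i j : 'I_#|V|) := e (enum_val i) (enum_val j).
have [|g gi ge] := henson_embed hU (e := e').
  split=> [i|i j|[f Cf]]; rewrite /e' ?eirr//; first by rewrite esym.
  by apply: (Vfree (fun i => enum_val (f i))) => i j; exact: Cf.
pose f v := g (enum_rank v).
have fe v v' : edge (f v) (f v') <-> e v v' by rewrite ge /e' !enum_rankK.
exists (range f); first exact: finite_image.
exists V, w, f; split=> // b.
split; apply: VI => h Ch hI.
  have Cfh : clique (@edge U) (f \o h) by move=> i j ij; apply/fe; exact: Ch.
  apply: (clique_edges_free hU Cfh (a := b)) => i.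
  by apply/(henson_symE hU); have /asboolP := hI i.
(* A single point is also light: since r > 1, a K_r has two distinct vertices. *)
pose i0 : 'I_r := Ordinal (ltnW r_gt1); pose i1 : 'I_r := Ordinal r_gt1.
have /fe := Ch i0 i1 isT; have /asboolP -> := hI i0; have /asboolP -> := hI i1.
exact: henson_irr hU b.
Qed.

Lemma representation_fam (mu nu : keisler R U 1) t : 0 <= t <= 1 -> is_trivial nu ->
  (forall D, definable_over setT D -> mu D = t * \1_(@pE_set U) D + (1 - t) * nu D) ->
  is_fam K mu.
Proof.
move=> /andP[t0 t1] [w [a [w0 w1 wnu]]] muE.
have nuE := trivial_disc wnu.
have wc : cvgn (series w) by apply/cvg_ex; exists 1.
have wlim : limn (series w) = 1 by exact/cvg_lim.
(* The model must be fixed before the formula and eps are known, so it receives scattered sets of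
   every precision 1/(k + 1) and all points of the trivial part. *)
have /choice[A HA] : forall k : nat, exists A, finite_set A /\ scattered A k.+1%:R^-1.
  move=> k; have [|A fA sA] := @scattered_exists k.+1%:R^-1; first by rewrite invr_gt0.
  by exists A.
have [s sP] : exists s : nat -> U, \bigcup_(k in [set: nat]) (a k |` A k) `<=` range s.
  apply/countable_enum/bigcup_countable => // k _; apply: finite_set_countable.
  by rewrite finite_setU; split; [exact: finite_set1|case: (HA k)].
have [M [cM eM sM]] := countable_hull hU s.
have aM k : M (a k) by apply/sM/sP; exists k => //; left.
have AM k : A k `<=` M by move=> x Akx; apply/sM/sP; exists k => //; right.
exists M; first by split=> //; exact: small_countable.
move=> m phi eps eps0.
(* There are 2m + 1 errors of size d: a neighbourhood and a point for each of the m parameters, and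
   the tail of w. *)
pose d : R := eps / (4 * (m%:R + m%:R + 1)).
have mm0 : 0 <= m%:R :> R by rewrite ler0n.
have d0 : 0 < d by rewrite divr_gt0//; lra.
have [k kd] : exists k : nat, k.+1%:R^-1 <= d.
  exists (Num.truncn d^-1); rewrite invf_ple ?posrE//.
  by rewrite ltW// truncnS_gt.
have [_ [V [v [f [fA v0 v1 vb]]]]] := HA k.
have [L tailL] : exists L, 1 - \sum_(l < L) w l <= d.
  move/cvgrPdist_le : w1 => /(_ d d0)[L _ /(_ L (leqnn L))] /=.
  rewrite /series /= big_mkord => h; exists L; exact: le_trans (ler_norm _) h.
have tail0 : 0 <= 1 - \sum_(l < L) w l.
  rewrite subr_ge0 -wlim; have := disc_partial a w0 wc setT L.
  by rewrite discT; under eq_bigr do rewrite indicT mulr1.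
(* The discarded tail mass is put on [a L], so that the weights still sum to 1. *)
pose rest := 1 - \sum_(l < L) w l.
pose u (l : nat) := if (l < L)%N then w l else rest.
pose W (i : V + 'I_L.+1) : R := match i with inl x => t * v x | inr l => (1 - t) * u l end.
pose F (i : V + 'I_L.+1) : U := match i with inl x => f x | inr l => a l end.
have sumW (x : V -> R) (y : nat -> R) :
    \sum_i W i * (match i with inl z => x z | inr l => y l end) =
    t * (\sum_z v z * x z) + (1 - t) * (\sum_(l < L) w l * y l + rest * y L).
  rewrite big_sumType big_ord_recr /=; congr +%R.
    by rewrite mulr_sumr; apply: eq_bigr => i _; rewrite mulrA.
  rewrite mulrDr mulr_sumr; congr +%R; last by rewrite /u ltnn mulrA.
  by apply: eq_bigr => i _; rewrite /u ltn_ord mulrA.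
have [|||n [b [bF bav]]] := @weighted_average R U _ W F (eps / 4).
- by case=> [x|l] /=; rewrite mulr_ge0 ?subr_ge0// /u; case: ifP.
- have := sumW (fun=> 1) (fun=> 1); rewrite (eq_bigr (fun i => W i)); last by case=> i _; rewrite mulr1.
  move=> ->; under eq_bigr do rewrite mulr1.
  by under [\sum_(l < L) _]eq_bigr do rewrite mulr1; rewrite v1 /rest; ring.
- by lra.
exists n, b; split=> [j|c].
  by have [[x|l] ->] := bF j => //=; apply: AM.
set D := inst phi c.
have dD : definable_over setT D by exists m, phi, c.
have := bav D.
have -> : \sum_i W i * \1_D (pt (F i)) = t * (\sum_z v z * \1_D (pt (f z))) +
    (1 - t) * (\sum_(l < L) w l * \1_D (pt (a l)) + rest * \1_D (pt (a L))).
  by rewrite -(sumW _ (fun l => \1_D (pt (a l)))); apply: eq_bigr => -[].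
set S1 := \sum_z _; set S2 := \sum_(l < L) _ => h.
have nu1 : S2 <= nu D by rewrite nuE//; exact: disc_partial.
have nu2 : nu D <= S2 + rest.
  by rewrite nuE// /rest -wlim; exact: disc_le_partial.
(* A point [f y] generic over the parameters satisfies D exactly when p_E contains D; any other
   [f y] equals or is adjacent to some [c j], and these have small total weight. *)
have pE1 : `|\1_(@pE_set U) D - S1| <= (m%:R + m%:R) * d.
  have -> : \1_(@pE_set U) D - S1 = \sum_y v y * (\1_(@pE_set U) D - \1_D (pt (f y))).
    by under eq_bigr do rewrite mulrBr; rewrite sumrB -mulr_suml v1 mul1r.
  apply: le_trans (ler_norm_sum _ _ _) _.
  apply: (@le_trans _ _ (\sum_y v y * \sum_(j < m) ((`[< edge (f y) (c j) >])%:R + (`[< f y = c j >])%:R))).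
    apply: ler_sum => y _; rewrite normrM ger0_norm//; apply: ler_wpM2l => //.
    have [gy|ngy] := pselect (generic_over (range c) (pt (f y))).
      rewrite (_ : \1_(@pE_set U) D = \1_D (pt (f y))) ?subrr ?normr0.
        by apply: sumr_ge0 => j _; rewrite addr_ge0.
      have iD : sim_invariant (range c) D by exact: (inst_invariant hU).
      rewrite !indicE; congr (_%:R); congr nat_of_bool; apply/idP/idP => /set_mem Dy; apply: mem_set.
        have [_ [C fC CD]] := Dy.
        have [|z gz] := generic_nonempty hU r_gt1 (C := C `|` range c).
          by rewrite finite_setU; split=> //; exact: finite_image.
        apply: iD (CD z _); last by apply: generic_overS gz => x; left.
        by apply: (generic_sim hU) => //; apply: generic_overS gz => x; right.
      split=> //; exists (range c); first exact: finite_image.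
      by move=> z gz; apply: iD Dy; exact: (generic_sim hU).
    apply: (@le_trans _ _ 1).
      by rewrite !indicE; do 2! case: (_ \in _); rewrite ?subrr ?subr0 ?sub0r ?normrN ?normr1 ?normr0.
    have [j Hj] : exists j, f y = c j \/ edge (f y) (c j).
      apply: contrapT => ne; apply: ngy => _ [j _ <-].
      by split=> h'; apply: ne; exists j; [left|right].
    rewrite (bigD1 j)//= -[leLHS]addr0; apply: lerD; last by apply: sumr_ge0 => i _; rewrite addr_ge0.
    by case: Hj => /asboolP ->; rewrite ?lerDl ?lerDr.
  under eq_bigr do rewrite mulr_sumr.
  rewrite exchange_big /=.
  apply: (@le_trans _ _ (\sum_(j < m) (d + d))); last first.
    by rewrite sumr_const card_ord -[leLHS]mulr_natl; lra.
  apply: ler_sum => j _; under eq_bigr do rewrite mulrDr.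
  have [h1 h2] := vb (c j).
  rewrite big_split /=; apply: lerD; apply: le_trans kd.
    apply: le_trans h1; rewrite [leRHS]big_mkcond; apply: ler_sum => y _.
    by case: ifP; rewrite ?mulr1 ?mulr0.
  apply: le_trans h2; rewrite [leRHS]big_mkcond; apply: ler_sum => y _.
  by case: ifP; rewrite ?mulr1 ?mulr0.
rewrite muE//.
set x0 := \1_D (pt (a L)) in h.
have x01 : 0 <= x0 <= 1 by rewrite /x0 indicE; case: (_ \in _); rewrite ?lexx ?ler01.
have dm : (m%:R + m%:R + 1) * d = eps / 4.
  by rewrite /d; field; lra.
have rd : rest <= d by [].
have r0 : 0 <= rest by [].
move: h pE1; rewrite !ler_norml => /andP[h1 h2] /andP[p1 p2].
have /andP[x00 x1] := x01.
have rx0 : 0 <= rest * x0 by rewrite mulr_ge0.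
have rx1 : rest * x0 <= rest by rewrite ler_piMr.
have md0 : 0 <= (m%:R + m%:R) * d by rewrite mulr_ge0//; lra.
have e1 : t * `|\1_(@pE_set U) D - S1| <= (m%:R + m%:R) * d.
  rewrite -[leRHS]mul1r; apply: ler_pM => //.
  by rewrite ler_norml p1.
have e2 : (1 - t) * `|nu D - (S2 + rest * x0)| <= d.
  rewrite -[leRHS]mul1r; apply: ler_pM => //; [lra|lra|].
  by rewrite ler_norml; apply/andP; split; lra.
set Y := t * S1 + _ in h1 h2.
have e3 : `|t * \1_(@pE_set U) D + (1 - t) * nu D - Y| <= eps / 4.
  rewrite -dm.
  rewrite (_ : _ - Y = t * (\1_(@pE_set U) D - S1) + (1 - t) * (nu D - (S2 + rest * x0))); last first.
    by rewrite /Y; ring.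
  apply: le_trans (ler_normD _ _) _; rewrite !normrM !(ger0_norm t0) (@ger0_norm _ (1 - t)); last lra.
  by lra.
move: e3; rewrite ler_norml => /andP[e31 e32].
by rewrite ltr_norml; apply/andP; split; lra.
Qed.

End representation_fam.

(** * fim measures have no p_E-part *)

Section countable_formulas.

Fixpoint fmla_code n (phi : fmla n) : GenTree.tree nat :=
  match phi with
  | Fbot _ => GenTree.Leaf 0
  | Feq _ i j => GenTree.Node 0 [:: GenTree.Leaf (i : nat); GenTree.Leaf (j : nat)]
  | Fedge _ i j => GenTree.Node 1 [:: GenTree.Leaf (i : nat); GenTree.Leaf (j : nat)]
  | Fimp _ p q => GenTree.Node 2 [:: fmla_code p; fmla_code q]
  | Fall _ p => GenTree.Node 3 [:: fmla_code p]
  end.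

Lemma fmla_code_inj n : injective (@fmla_code n).
Proof.
move=> phi; elim: phi => {n} [n|n i j|n i j|n p IHp q IHq|n p IHp] psi.
- by case: n / psi.
- by case: n / psi i j => // n k l i j /= [/val_inj-> /val_inj->].
- by case: n / psi i j => // n k l i j /= [/val_inj-> /val_inj->].
- by case: n / psi p IHp q IHq => // n p' q' p IHp q IHq /= [/IHp-> /IHq->].
- by case: n / psi p IHp => // n p' p IHp /= [/IHp->].
Qed.

Lemma countable_fmla m : countable [set: {k & fmla (m + k)} * nat].
Proof.
apply/countable_injP.
exists (fun x : {k & fmla (m + k)} * nat => pickle (projT1 x.1, fmla_code (projT2 x.1), x.2)).
move=> [[k p] n] [[l q] n'] _ _ /= /(pcan_inj pickleK)[kl]; subst l.
by move=> /fmla_code_inj -> ->.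
Qed.

End countable_formulas.

Section fim_trivial.
Variables (R : realType) (r : nat) (U : structure) (K : Type).
Hypothesis hU : henson r U.
Hypothesis r_gt1 : (1 < r)%N.
Hypothesis K_uncountable : ~ countable [set: K].
Hypothesis U_saturated : saturated U K.

(** Since the mass of theta_n tends to 1, theta_n is eventually nonempty, and any tuple in it is an
    approximating sample. There are countably many formulas and precisions, so one sample for each
    spans a countable model. *)
Lemma fim_approximated (mu : keisler R U 1) : is_fim K mu ->
  exists M, [/\ countable M, elementary_substructure M & approximated_in M mu].
Proof.
move=> [_ [lam _ fim]].
have /choice[f Hf] : forall x : {m & fmla (1 + m)} * nat,
    exists y : {n & 'I_n.+1 -> U}, forall b : 'I_(tag x.1) -> U,
     `|mu (inst (tagged x.1) b) - Av R (tagged y) (inst (tagged x.1) b)| < x.2.+1%:R^-1.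
  move=> [[m phi] k]; have [theta [_ th1 th2]] := fim m phi.
  have [|n0 Hn0] := th1 k.+1%:R^-1; first by rewrite invr_gt0.
  move/cvgrPdist_lt : th2 => /(_ 1 ltr01)[n1 _ Hn1].
  pose n := maxn n0 n1.
  have [a Ha] : exists a, theta n a.
    apply: contrapT => ne; have := Hn1 n (leq_maxr _ _).
    rewrite (_ : theta n = set0); last first.
      by apply/seteqP; split=> // a Ha; apply: ne; exists a.
    by rewrite (content0 (keisler_content (lam n))) subr0 normr1 ltxx.
  by exists (existT _ n a); apply: Hn0 Ha; exact: leq_maxl.
pose pts (x : {m & fmla (1 + m)} * nat) : set U := range (tagged (f x)).
have [s sP] : exists s : nat -> U, \bigcup_(x in [set: {m & fmla (1 + m)} * nat]) pts x `<=` range s.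
  apply/countable_enum/bigcup_countable => [|x _]; last exact/finite_set_countable/finite_image.
  exact: countable_fmla.
have [M [cM eM sM]] := countable_hull hU s.
exists M; split=> // m phi eps eps0.
pose k := Num.truncn eps^-1.
have ke : k.+1%:R^-1 < eps by rewrite invf_plt ?posrE// truncnS_gt.
have := Hf (existT _ m phi, k); set y := f _ => Hy.
exists (tag y), (tagged y); split=> [i|b].
  by apply/sM/sP; exists (existT _ m phi, k) => //; exists i.
exact: lt_trans (Hy b) ke.
Qed.

(* No measurability is assumed: the integrand of [is_morley_product] is only
   known pointwise. *)
Lemma ge0_le_integralT d (T : measurableType d) (P : {measure set T -> \bar R})
    (f g : T -> \bar R) :
  (forall x, 0 <= f x)%E -> (forall x, f x <= g x)%E ->
  (\int[P]_x f x <= \int[P]_x g x)%E.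
Proof.
move=> f0 fg; have g0 x : (0 <= g x)%E by exact: le_trans (fg x).
rewrite !ge0_integralTE//; apply: le_ereal_sup => _ [h hf <-]; exists h => // x.
exact: le_trans (hf x) (fg x).
Qed.

Lemma kmeas_nonneg n (mu : keisler R U n) D : 0 <= mu D.
Proof. by have [/kmeas_ge0//|/kmeas_junk->] := pselect (definable_over setT D). Qed.

Lemma catf1_0 n (x : 'I_1 -> U) (b : 'I_n -> U) : catf x b ord0 = x ord0.
Proof. by rewrite -(pt_ord0 x) catf_pt0. Qed.

Lemma catf1_S n (x : 'I_1 -> U) (b : 'I_n -> U) i : catf x b (lift ord0 i) = b i.
Proof. by rewrite -(pt_ord0 x) (catf_ptS (x ord0)). Qed.

(** The model N is enlarged to contain the parameters of D and D1. Every type over N is realised, so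
    the integrand is bounded below pointwise by c on the clopen set of D1 and by 0 elsewhere. *)
Lemma morley_ge n (mu : keisler R U 1) (nu : keisler R U n)
    (lam : keisler R U (1 + n)) (M : set U) :
  countable M -> elementary_substructure M -> definable_measure_over M mu ->
  is_morley_product K mu nu lam ->
  forall D D1 (c : R), definable_over setT D -> definable_over setT D1 -> 0 <= c ->
    (forall b, D1 b -> c <= mu [set x | D (catf x b)]) -> c * nu D1 <= lam D.
Proof.
move=> cM eM dM mor D D1 c dD dD1 c0 H.
have [C [fC _ iD]] := definable_invariant hU dD.
have [C1 [fC1 _ iD1]] := definable_invariant hU dD1.
have [s sP] : exists s : nat -> U,
    \bigcup_(i in [set: bool]) (if i then M else C `|` C1) `<=` range s.
  apply/countable_enum/bigcup_countable => // -[] _ //.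
  by apply: finite_set_countable; rewrite finite_setU.
have [N [cN eN sN]] := countable_hull hU s.
have smM : small_model K M by split=> //; exact: small_countable.
have smN : small_model K N by split=> //; exact: small_countable.
have MN : M `<=` N by move=> x Mx; apply/sN/sP; exists true.
have CN : C `<=` N by move=> x Mx; apply/sN/sP; exists false => //; left.
have C1N : C1 `<=` N by move=> x Mx; apply/sN/sP; exists false => //; right.
have dND : definable_over N D by exact: invariant_definable iD.
have dND1 : definable_over N D1 by exact: invariant_definable iD1.
have [P [F [HP HF HI]]] := mor D M N smM dM smN MN dND.
pose S : set (stone N n) := [set q | in_type q D1].
have mS : measurable S by apply: sub_sigma_algebra; exists D1.
have Fge q : ((c * \1_S q)%:E <= (F q)%:E)%E.
  have [b ->] := U_saturated q smN.1.
  rewrite lee_fin HF indicE; case: (boolP (_ \in S)) => [/set_mem[_ D1b]|_].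
    by rewrite mulr1; exact: H.
  by rewrite mulr0 kmeas_nonneg.
rewrite -lee_fin HI.
apply: le_trans (ge0_le_integralT P _ Fge); last first.
  by move=> q; rewrite lee_fin mulr_ge0.
under eq_integral do rewrite EFinM.
rewrite ge0_integralZl_EFin//.
- by rewrite integral_indic// setIT EFinM -(HP D1 dND1).
- by apply/measurable_EFinP; exact: measurable_indic.
Qed.

(** The finitely additive form of integrating the number of events X_i over G. Splitting G by the
    first event lowers the bound to c - 1 on the part where it holds. *)
Lemma count_le n (nu : set ('I_n -> U) -> R) : is_content nu ->
  forall k (X : 'I_k -> set ('I_n -> U)) G (c : R),
  (forall i, definable_over setT (X i)) -> definable_over setT G ->
  (forall x, G x -> \sum_i (`[< X i x >])%:R <= c) ->
  \sum_i nu (X i `&` G) <= c * nu G.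
Proof.
move=> nuP; elim=> [|k IH] X G c dX dG H.
  rewrite big_ord0; have [[x Gx]|nG] := pselect (exists x, G x).
    by apply: mulr_ge0; [have := H x Gx; rewrite big_ord0|exact: nuP.1].
  rewrite (_ : G = set0) ?(content0 nuP) ?mulr0//.
  by apply/seteqP; split=> // x Gx; apply: nG; exists x.
rewrite big_ord_recl (content_split hU nuP dG (dX ord0)).
set G0 := G `&` X ord0; set G1 := G `\` X ord0.
have dG0 : definable_over setT G0 by exact: (definableI hU).
have dG1 : definable_over setT G1 by exact: (definableD hU).
have h0 := IH (fun i => X (lift ord0 i)) G0 (c - 1) (fun i => dX _) dG0.
have h1 := IH (fun i => X (lift ord0 i)) G1 c (fun i => dX _) dG1.
have split1 i : nu (X (lift ord0 i) `&` G) =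
    nu (X (lift ord0 i) `&` G0) + nu (X (lift ord0 i) `&` G1).
  have dXG : definable_over setT (X (lift ord0 i) `&` G) by exact: (definableI hU).
  by rewrite (content_split hU nuP dXG (dX ord0)) setIA setIDA.
under eq_bigr do rewrite split1.
rewrite big_split /= [X ord0 `&` G]setIC -/G0.
have {}h0 : \sum_(i < k) nu (X (lift ord0 i) `&` G0) <= (c - 1) * nu G0.
  apply: h0 => x [Gx X0]; have := H x Gx; rewrite big_ord_recl /=.
  by move/asboolP : X0 => ->; rewrite mulr1n; lra.
have {}h1 : \sum_(i < k) nu (X (lift ord0 i) `&` G1) <= c * nu G1.
  apply: h1 => x [Gx X0]; have := H x Gx; rewrite big_ord_recl /=.
  by move/asboolPn/negbTE : X0 => ->; rewrite mulr0n; lra.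
rewrite mulrDr; lra.
Qed.

Section sample.
Variables (mu : keisler R U 1) (lam : forall n, keisler R U n.+1) (M A0 : set U) (t d : R).
Hypotheses (cM : countable M) (eM : elementary_substructure M) (dM : definable_measure_over M mu).
Hypothesis lamP : are_morley_powers K mu lam.
Hypothesis fA0 : finite_set A0.
Hypotheses (t0 : 0 <= t) (d0 : 0 <= d <= 1).
Hypothesis mu_out : t <= mu [set x | ~ A0 (x ord0)].
Hypothesis mu_nbr : forall b, mu [set x | edge (x ord0) b /\ ~ A0 (x ord0)] <= d.

Definition out n (i : 'I_n) : set ('I_n -> U) := [set x | ~ A0 (x i)].
(** Both ends are kept off A0, so that [mu_nbr] applies whichever of the two coordinates is the
    newer one. *)
Definition joined n (i j : 'I_n) : set ('I_n -> U) :=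
  [set x | edge (x i) (x j) /\ (~ A0 (x i) /\ ~ A0 (x j))].

Lemma sim_A0 n (x x' : 'I_n -> U) i : sim A0 x x' -> A0 (x i) <-> A0 (x' i).
Proof.
move=> [_ h]; split=> Ax; first by rewrite ((h i _ Ax).1.1 erefl).
by rewrite ((h i _ Ax).1.2 erefl).
Qed.

Lemma definable_out n i : definable_over setT (@out n i).
Proof.
apply: (@invariant_definable _ _ A0) => // x x' /sim_A0 h.
by rewrite /out /= h.
Qed.

Lemma definable_joined n i j : definable_over setT (@joined n i j).
Proof.
apply: (@invariant_definable _ _ A0) => // x x' xx'.
have h := sim_A0 _ xx'; have [h' _] := xx'; have [_ e] := h' i j.
by rewrite /joined /= !h e.
Qed.

Lemma lam_step_ge n : forall D D1 (c : R), definable_over setT D ->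
  definable_over setT D1 -> 0 <= c ->
  (forall b, D1 b -> c <= mu [set x | D (catf x b)]) -> c * lam n D1 <= lam n.+1 D.
Proof. exact: morley_ge cM eM dM (lamP.2 n). Qed.

Lemma out_ge n i : t <= lam n (@out n.+1 i).
Proof.
elim: n i => [|n IH] i; first by rewrite lamP.1 /out [i]ord1.
have [j ->|->] := unliftP ord0 i.
  rewrite -[t]mul1r; apply: le_trans (ler_wpM2l ler01 (IH j)) _.
  apply: lam_step_ge => //; [exact: definable_out|exact: definable_out|].
  move=> b bj; rewrite (_ : [set x | _] = setT) ?kmeas_setT//.
  by apply/seteqP; split=> // x _; rewrite /out /= catf1_S.
rewrite -[t]mulr1 -(kmeas_setT (lam n)).
apply: lam_step_ge => //; [exact: definable_out|exact: definableT|].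
move=> b _; apply: le_trans mu_out _; rewrite le_eqVlt; apply/orP; left; apply/eqP; congr (mu _).
by apply/seteqP; split=> x; rewrite /out /= catf1_0.
Qed.

Lemma joined_le n i j : i != j -> lam n (@joined n.+1 i j) <= d.
Proof.
have /andP[d00 d1] := d0.
(* Coordinate 0 is the one added by the last product. If it is an end of the edge, every fibre lies
   in a neighbourhood off A0; the lower bound 1 - d for the complement gives the upper bound. *)
have first m (k : 'I_m.+1) D : definable_over setT D ->
    (forall (x : 'I_1 -> U) b, D (catf x b) -> edge (x ord0) (b k) /\ ~ A0 (x ord0)) ->
    lam m.+1 D <= d.
  move=> dD H; have := @lam_step_ge m (~` D) setT (1 - d) (definable_overC dD) (definableT _ _).
  rewrite kmeas_setT mulr1 subr_ge0 (kmeasC hU)// => /(_ d1) h.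
  suff : 1 - d <= 1 - lam m.+1 D by lra.
  apply: h => b _.
  have dE : definable_over setT [set x : 'I_1 -> U | edge (x ord0) (b k) /\ ~ A0 (x ord0)].
    by apply: (definableI hU); [exact: (@definable_nbr _ setT)|exact: (@definable_out 1 ord0)].
  apply: (@le_trans _ _ (mu (~` [set x | edge (x ord0) (b k) /\ ~ A0 (x ord0)]))).
    by rewrite (kmeasC hU)// lerD2l lerN2.
  apply: (content_le hU (keisler_content mu)); first exact: definable_overC.
    have [C [fC _ iD]] := definable_invariant hU dD.
    apply: (@invariant_definable _ _ (C `|` range b)) => //.
      by rewrite finite_setU; split=> //; exact: finite_image.
    move=> x x' [h1 h2] nD Dx'; apply: nD; apply: iD Dx'; apply: sim_sym.
    split=> [p q|p c Cc].
      case: (split_ordP p) => p' ->; case: (split_ordP q) => q' ->;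
        rewrite ?catf_lshift ?catf_rshift //; first by apply: h2; right; exists q'.
      rewrite (henson_symE hU (b _)) (henson_symE hU (b _)).
      have [|e1 e2] := h2 q' (b p'); first by right; exists p'.
      by split=> //; split=> /esym/e1/esym.
    by case: (split_ordP p) => p' ->; rewrite ?catf_lshift ?catf_rshift//; apply: h2; left.
  by move=> x nx Dx; apply: nx; exact: H Dx.
elim: n i j => [|n IH] i j; first by rewrite !ord1.
have [i' ->|->] := unliftP ord0 i; have [j' ->|->] := unliftP ord0 j.
- rewrite (inj_eq lift_inj) => /IH h; apply: le_trans h.
  have := @lam_step_ge n (~` joined (lift ord0 i') (lift ord0 j')) (~` joined i' j') 1.
  rewrite !(kmeasC hU); try exact: definable_joined.
  move=> /(_ (definable_overC (definable_joined _ _)) (definable_overC (definable_joined _ _)) ler01).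
  rewrite mul1r => h; suff : 1 - lam n (joined i' j') <= 1 - lam n.+1 (joined (lift ord0 i') (lift ord0 j')) by lra.
  apply: h => b nb; rewrite (_ : [set x | _] = setT) ?kmeas_setT//.
  by apply/seteqP; split=> // x _; rewrite /joined /= !catf1_S.
- move=> _; apply: (first _ i'); first exact: definable_joined.
  by move=> x b; rewrite /joined /= catf1_S catf1_0 => -[/(henson_symE hU) ? [_ ?]].
- move=> _; apply: (first _ j'); first exact: definable_joined.
  by move=> x b; rewrite /joined /= catf1_S catf1_0 => -[? [? _]].
- by rewrite eqxx.
Qed.

End sample.

Lemma trivial_tail (w : nat -> R) (d : R) : series w @ \oo --> (1 : R) -> 0 < d ->
  exists L, 1 - \sum_(l < L) w l <= d.
Proof.
move=> /cvgrPdist_le/[apply] -[L _ /(_ L (leqnn L))] /=.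
by rewrite /series /= big_mkord => h; exists L; exact: le_trans (ler_norm _) h.
Qed.

(* A sample avoiding a large finite set of atoms is spread over the generic
   part of mu, hence independent with high probability; a vertex joined to all
   of its generic points but to no large atom refutes the frequency
   estimate. *)
Lemma fim_no_generic_part (mu nu : keisler R U 1) (t : R) (M : set U) :
  is_fim K mu -> countable M -> elementary_substructure M -> definable_measure_over M mu ->
  0 <= t <= 1 -> is_trivial nu ->
  (forall D, definable_over setT D -> mu D = t * \1_(@pE_set U) D + (1 - t) * nu D) ->
  t <= 0.
Proof.
move=> [_ [lam lamP fim]] cM eM dM /andP[_ t1] [w [a [w0 w1 wnu]]] muE.
rewrite leNgt; apply/negP => t0.
have nuE := trivial_disc wnu.
have wc : cvgn (series w) by apply/cvg_ex; exists 1.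
have wlim : limn (series w) = 1 by exact/cvg_lim.
pose phi : fmla (1 + 1) := Fedge (lshift 1 ord0) (rshift 1 ord0).
have phiE c : inst phi (pt c) = nbr c :> set ('I_1 -> U).
  by apply/seteqP; split=> x; rewrite /inst /nbr /= catf_lshift catf_rshift.
have [theta [dth th1 th2]] := fim 1%N phi.
have t4 : 0 < t / 4 by lra.
have [n0 Hn0] := th1 _ t4.
move/cvgrPdist_lt : th2 => /(_ _ t4)[n1 _ Hn1].
pose n := maxn n0 n1.
have thn : 1 - t / 4 < lam n (theta n).
  by have /= := Hn1 n (leq_maxr _ _); rewrite ltr_norml => /andP[]; lra.
have nn0 : 0 < n.+1%:R :> R by rewrite ltr0n.
(* The sample size is fixed before d and A0, so d may depend on n: the union bound over all (n +
   1)^2 pairs costs t/8 in total. *)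
pose d : R := t / (8 * (n.+1%:R * n.+1%:R)).
have d0 : 0 < d by rewrite divr_gt0// mulr_gt0// mulr_gt0.
have nn1 : 1 <= n.+1%:R :> R by rewrite ler1n.
have dE : n.+1%:R * (n.+1%:R * d) = t / 8 by rewrite /d; field; lra.
have dt : d <= t / 8.
  rewrite -dE mulrA -[leLHS]mul1r ler_pM2r//; nra.
have [L tailL] := trivial_tail w1 d0.
pose A0 : set U := range (fun l : 'I_L => a l).
have fA0 : finite_set A0 by exact: finite_image.
have nu_nonneg D : 0 <= nu D by exact: kmeas_nonneg.
have mu_out : t <= mu [set x | ~ A0 (x ord0)].
  have dD := definable_out fA0 (ord0 : 'I_1).
  rewrite (muE _ dD) indicE mem_set ?mulr1.
    by rewrite lerDl mulr_ge0// subr_ge0.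
  split=> //; exists A0 => // x gx Ax.
  by have [] := gx _ Ax.
have mu_nbr b : mu [set x | edge (x ord0) b /\ ~ A0 (x ord0)] <= d.
  set D := [set x | _ ].
  have dD : definable_over setT D.
    by apply: (definableI hU); [exact: (@definable_nbr _ setT)|exact: (definable_out fA0 (ord0 : 'I_1))].
  rewrite (muE _ dD) indicE memNset ?mulr0 ?add0r; last first.
    move=> [_ [C fC CD]].
    have [|x gx] := generic_nonempty hU r_gt1 (C := C `|` [set b]).
      by rewrite finite_setU.
    have [] : D x by apply: CD; apply: generic_overS gx => y; left.
    by have [|] := gx b; [right|].
  apply: (@le_trans _ _ (nu D)).
    by rewrite ler_piMl//; lra.
  apply: le_trans tailL; rewrite (nuE _ dD) -wlim; apply: disc_tail => // l lL [_].
  by apply; exists (Ordinal lL).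
have d1 : 0 <= d <= 1 by apply/andP; split; lra.
pose X (i : 'I_n.+1) := out A0 i.
pose B (i j : 'I_n.+1) := if i == j then set0 else joined A0 i j.
have dB i j : definable_over setT (B i j).
  by rewrite /B; case: eqP => _; [exact: definable0|exact: definable_joined].
pose BB := [set x | exists i, [set x | exists j, B i j x] x].
have dBi i : definable_over setT [set x | exists j, B i j x] by exact: (definable_bigU hU).
have dBB : definable_over setT BB by exact: (definable_bigU hU).
have lamB : lam n BB <= t / 8.
  rewrite -dE.
  apply: le_trans (content_bigU_le hU (keisler_content (lam n)) dBi) _.
  apply: (@le_trans _ _ (\sum_(i < n.+1) n.+1%:R * d)); last first.
    by rewrite sumr_const card_ord -[leLHS]mulr_natl.
  apply: ler_sum => i _.
  apply: le_trans (content_bigU_le hU (keisler_content (lam n)) (dB i)) _.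
  apply: (@le_trans _ _ (\sum_(i < n.+1) d)); last first.
    by rewrite sumr_const card_ord -[leLHS]mulr_natl.
  apply: ler_sum => j _; rewrite /B; case: eqVneq => [_|ij].
    by rewrite (content0 (keisler_content (lam n))) ltW.
  exact: (joined_le cM eM dM lamP fA0 d1 mu_nbr ij).
pose G := theta n `\` BB.
have dG : definable_over setT G by exact: (definableD hU).
have lamG : 1 - 3 / 8 * t <= lam n G.
  have := content_split hU (keisler_content (lam n)) (dth n) dBB.
  have : lam n (theta n `&` BB) <= lam n BB.
    by apply: (content_le hU (keisler_content (lam n))) => //; exact: (definableI hU).
  by rewrite -/G; lra.
(* G misses mass at most 3t/8, so each X_i keeps mass at least 5t/8 inside G; not all points of G
   can then have at most (n + 1)t/2 coordinates off A0. *)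
have [x [Gx cx]] : exists x, G x /\ n.+1%:R * (t / 2) < \sum_i (`[< X i x >])%:R.
  apply: contrapT => nx.
  have dX i : definable_over setT (X i) by exact: definable_out.
  have := count_le (keisler_content (lam n)) dX dG (c := n.+1%:R * (t / 2)).
  have cle x : G x -> \sum_i (`[< X i x >])%:R <= n.+1%:R * (t / 2).
    by move=> Gx; rewrite leNgt; apply/negP => h; apply: nx; exists x.
  move=> /(_ cle); apply/negP; rewrite -ltNge.
  have lamG1 : lam n G <= 1 by exact: (kmeas_le1 hU).
  apply: (@le_lt_trans _ _ (n.+1%:R * (t / 2))).
    by rewrite ler_piMr// mulr_ge0//; lra.
  apply: (@lt_le_trans _ _ (\sum_(i < n.+1) (5 / 8 * t))).
    by rewrite sumr_const card_ord -[ltRHS]mulr_natl ltr_pM2l//; lra.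
  apply: ler_sum => i _.
  have h1 : t <= lam n (X i) by exact: (out_ge cM eM dM lamP fA0 (ltW t0) mu_out).
  have h2 := content_split hU (keisler_content (lam n)) (dX i) dG.
  have h3 : lam n (X i `\` G) <= 1 - lam n G.
    rewrite -(kmeasC hU)//; apply: (content_le hU (keisler_content (lam n))).
    - exact: (definableD hU).
    - exact: definable_overC.
    - by move=> y [].
  lra.
have Gjoin i j : ~ A0 (x i) -> ~ A0 (x j) -> ~ edge (x i) (x j).
  move=> ni nj eij; have [_] := Gx; apply; exists i, j; rewrite /B.
  by case: eqP => [ij|_ //]; move: eij; rewrite ij => /(henson_irr hU).
have fC : finite_set (A0 `|` range x).
  by rewrite finite_setU; split=> //; exact: finite_image.
(* The sample points off A0 are pairwise non-adjacent, hence contain no K_r as r > 1. *)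
have [f Cf h|b Hb] := henson_ext hU (X := [set u | (range x) u /\ ~ A0 u]) fC _.
  pose i0 : 'I_r := Ordinal (ltnW r_gt1); pose i1 : 'I_r := Ordinal r_gt1.
  have [_ [[k0 _ e0] n0']] := h i0; have [_ [[k1 _ e1] n1']] := h i1.
  have := Cf i0 i1 isT; rewrite -e0 -e1; apply: Gjoin; by rewrite ?e0 ?e1.
have mub : mu (nbr b) <= d.
  apply: le_trans (mu_nbr b); rewrite le_eqVlt; apply/orP; left; apply/eqP; congr (mu _).
  apply/seteqP; split=> y; last by case.
  move=> yb; split=> // Ay; have [|_ [+ _]] := Hb (y ord0); first by left.
  by move=> /(_ ((henson_symE hU _ _).1 yb))[].
have Avb : t / 2 < Av R x (nbr b).
  rewrite /Av ltr_pdivlMr// mulrC; apply: lt_le_trans cx _.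
  rewrite -sum1_card natr_sum [leRHS]big_mkcond; apply: ler_sum => i _.
  case: asboolP => [Xi|_]; last by rewrite mulr0n; case: ifP.
  rewrite ifT// inE; apply/asboolP; rewrite /nbr /= /pt.
  apply/asboolP/(henson_symE hU); have [|_ ->] := Hb (x i); first by right; exists i.
  by split=> //; exists i.
(* The measure of N(b) is at most t/8 and its average exceeds t/2, against a tolerance of t/4. *)
have := Hn0 n (leq_maxl _ _) x Gx.1 (pt b); rewrite phiE ltr_norml => /andP[+ _].
lra.
Qed.

Lemma fim_is_trivial (mu : keisler R U 1) : is_fim K mu -> is_trivial mu.
Proof.
move=> fim; have [M [cM eM aM]] := fim_approximated fim.
have [dM fsM] := approximated_dfs hU aM.
have dfs : is_dfs K mu.
  by exists M; split=> //; split=> //; exact: small_countable.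
have [t [nu [t01 nutr muE]]] := dfs_representation hU r_gt1 U_saturated dfs.
have t0 := fim_no_generic_part fim cM eM dM t01 nutr muE.
have tE : t = 0 by apply/eqP; rewrite eq_le t0; have /andP[] := t01.
have [w [a [w0 w1 wnu]]] := nutr.
exists w, a; split=> // D dD.
by rewrite muE// tE mul0r add0r subr0 mul1r; exact: wnu.
Qed.

End fim_trivial.

(** * Trivial measures are fim *)

Section discrete_probability.
Variables (R : realType) (w : nat -> R).
Hypothesis w0 : forall k, 0 <= w k.
Hypothesis w1 : series w @ \oo --> (1 : R).

(** The measure lives on the indices of the atoms: every subset of nat is measurable, whatever
    structure U has. *)
Definition discrete_prob : set nat -> \bar R :=
  mseries (fun k => mscale (NngNum (w0 k)) (\d_k : {measure set nat -> \bar R})) 0.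

HB.instance Definition _ := Measure.on discrete_prob.

Lemma discrete_probE A : discrete_prob A = (limn (series (fun k => w k * \1_A k)))%:E.
Proof.
have wc : cvgn (series w) by apply/cvg_ex; exists 1.
have c : cvgn (series (fun k => w k * \1_A k)).
  apply: (series_le_cvg _ w0 _ wc) => k; first by rewrite mulr_ge0.
  by rewrite ler_piMr// indicE; case: (_ \in _).
rewrite -EFin_lim//; congr (limn _); apply/funext => n.
rewrite /series /= -sumEFin; apply: eq_bigr => k _.
by rewrite /mscale /= diracE EFinM indicE.
Qed.

Lemma discrete_prob_setT : discrete_prob setT = 1%E.
Proof.
rewrite discrete_probE; congr EFin; apply/cvg_lim => //.
by under eq_fun do rewrite indicT mulr1.
Qed.

HB.instance Definition _ := Measure_isProbability.Build _ _ _ discrete_prob discrete_prob_setT.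

Definition discrete_probability : probability nat R := discrete_prob.

End discrete_probability.

Section probability_lemmas.
Variable R : realType.

Lemma pushforward_prob d d' (T : measurableType d) (T' : measurableType d')
    (P : probability T R) (f : T -> T') : measurable_fun setT f ->
  exists P' : probability T' R, P' = pushforward P f :> (set T' -> \bar R).
Proof.
move=> mf; pose X : {mfun T >-> T'} := HB.pack f (isMeasurableFun.Build _ _ _ _ f mf).
by exists (distribution P X).
Qed.

Lemma measurable_nat_fun d (T : measurableType d) (f : nat -> T) : measurable_fun setT f.
Proof. by []. Qed.

Lemma measurable_section_union d (T : measurableType d) (A : set (T * nat)) :
  (forall k, measurable [set q | A (q, k)]) -> measurable A.
Proof.
move=> mA; rewrite (_ : A = \bigcup_k ([set q | A (q, k)] `*` [set k])).
  by apply: bigcup_measurable => k _; apply: measurableX.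
apply/seteqP; split=> [[q k] Aqk|[q k] [l _ [/= Aql ->]]//].
by exists k.
Qed.

(** The witness J n is the largest j <= n with n0 j <= n. It tends to infinity, slowly enough for n
    to stay beyond n0 (J n). *)
Lemma diagonal_index (n0 : nat -> nat) : exists J : nat -> nat,
  forall j, exists m, forall n, (m <= n)%N -> (j <= J n)%N /\ (n0 (J n) <= n)%N.
Proof.
exists (fun n => \max_(j < n.+1 | (n0 j <= n)%N) j) => j; exists (maxn j (n0 j)) => n.
rewrite geq_max => /andP[jn nj]; split.
  exact: (@leq_bigmax_cond _ (fun i : 'I_n.+1 => (n0 i <= n)%N)
    (fun i : 'I_n.+1 => i : nat) (Ordinal (jn : (j < n.+1)%N)) nj).
have [|i ni ->] := @eq_bigmax_cond _ (fun i : 'I_n.+1 => (n0 i <= n)%N) (fun i : 'I_n.+1 => i : nat).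
  by apply/card_gt0P; exists (Ordinal (jn : (j < n.+1)%N)).
exact: ni.
Qed.

End probability_lemmas.

Section trivial_fim.
Variables (R : realType) (r : nat) (U : structure) (K : Type).
Hypothesis hU : henson r U.
Hypothesis r_gt1 : (1 < r)%N.
Hypothesis K_uncountable : ~ countable [set: K].
Hypothesis U_saturated : saturated U K.
Notation def := (definable_over (setT : set U)).

Section keisler_of_probability.
Variables (n : nat) (Q : probability nat R) (t : nat -> 'I_n -> U).

Definition kprob_fun (D : set ('I_n -> U)) : R :=
  if `[< def D >] then fine (Q [set k | D (t k)]) else 0.

Lemma kprob_junk D : ~ def D -> kprob_fun D = 0.
Proof. by rewrite /kprob_fun; case: asboolP. Qed.

Lemma kprob_ge0 D : def D -> 0 <= kprob_fun D.
Proof. by move=> _; rewrite /kprob_fun; case: asboolP => // _; rewrite fine_ge0. Qed.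

Lemma kprobE D : def D -> (kprob_fun D)%:E = Q [set k | D (t k)].
Proof. by move=> dD; rewrite /kprob_fun; case: asboolP => // _; rewrite fineK// fin_num_measure. Qed.

Lemma kprob_setT : kprob_fun setT = 1.
Proof.
apply: EFin_inj; rewrite kprobE; last exact: definableT.
by rewrite -[RHS](probability_setT Q); congr (Q _); apply/seteqP; split.
Qed.

Lemma kprobU D1 D2 : def D1 -> def D2 -> D1 `&` D2 = set0 ->
  kprob_fun (D1 `|` D2) = kprob_fun D1 + kprob_fun D2.
Proof.
move=> d1 d2 d12; apply: EFin_inj; rewrite EFinD !kprobE//; last exact: (definableU hU).
rewrite -measureU//; apply/seteqP; split=> // k [h1 h2].
by have : (D1 `&` D2) (t k) by []; rewrite d12.
Qed.

Definition kprob : keisler R U n := Keisler kprob_junk kprob_ge0 kprob_setT kprobU.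

End keisler_of_probability.

Variables (mu : keisler R U 1) (p : probability nat R) (w : nat -> R) (a : nat -> U).
Hypothesis w0 : forall k, 0 <= w k.
Hypothesis w1 : series w @ \oo --> (1 : R).
Hypothesis mu_disc : forall D, def D -> mu D = disc w a D.
Hypothesis muE : forall D, def D -> (mu D)%:E = p [set k | D (pt (a k))].
Hypothesis a_atom : forall k, 0 < mu [set pt (a k)].

(* Otherwise some point outside the first L atoms would satisfy the same
   formula over M as a_k, and so have almost the same mass. *)
Lemma atom_in_model (M : set U) k : small K M -> definable_measure_over M mu -> M (a k).
Proof.
move=> sM dM; apply: contrapT => nM.
have wc : cvgn (series w) by apply/cvg_ex; exists 1.
have wlim : limn (series w) = 1 by exact/cvg_lim.
pose phi : fmla (1 + 1) := Feq (lshift 1 ord0) (rshift 1 ord0).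
have phiE c : inst phi (pt c) = [set pt c] :> set ('I_1 -> U).
  apply/seteqP; split=> x; rewrite /inst /= catf_lshift catf_rshift; last by move=> ->.
  by move=> xc; rewrite -(pt_ord0 x) xc.
set v := mu [set pt (a k)]; have v0 : 0 < v by exact: a_atom.
have v2 : v / 2 < v by lra.
have [D [dD hD1 hD2]] := sandwich hU U_saturated sM dM phi v2.
have [C [fC CM iD]] := definable_invariant hU dD.
have Da : D (pt (a k)) by apply: hD1; rewrite phiE.
have v20 : 0 < v / 2 by lra.
have [L tailL] := trivial_tail w1 v20.
have fCL : finite_set (C `|` range (fun l : 'I_L => a l)).
  by rewrite finite_setU; split=> //; exact: finite_image.
have [f Cf h|b Hb] := henson_ext hU (X := [set u | C u /\ edge (a k) u]) fCL _.
  by apply: (clique_edges_free hU Cf (a := a k)) => i; case: (h i) => _ [].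
have Db : D (pt b).
  apply: iD Da; apply: sim_pt; [exact: henson_irr hU _|exact: henson_irr hU _|].
  move=> c Cc; have [|bc ->] := Hb c; first by left.
  split; last by split=> [|[]].
  by split=> [ac|/bc//]; case: nM; rewrite ac; exact: CM.
have := hD2 _ Db; rewrite phiE mu_disc; last exact: definable_point.
apply/negP; rewrite -leNgt; apply: le_trans tailL; rewrite -wlim; apply: disc_tail => // l lL.
move=> /= /(@pt_inj U) ab; have [|+ _] := Hb (a l); first by right; exists (Ordinal lL).
by rewrite ab.
Qed.

(** Under Q', t' has the law of an independent new atom put in front of the old tuple. The first
    clause yields the Morley product, the second the recursion for the variance. *)
Definition extends n (Q : probability nat R) (t : nat -> 'I_n -> U)
    (Q' : probability nat R) (t' : nat -> 'I_n.+1 -> U) : Prop :=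
  (forall A : set ('I_n.+1 -> U), Q' [set j | A (t' j)] =
     (\int[Q]_k p [set l | A (catf (pt (a l)) (t k))])%E) /\
  (forall g : ('I_n.+1 -> U) -> \bar R, (forall x, 0 <= g x)%E ->
     (\int[Q']_j g (t' j) = \int[Q]_k \int[p]_l g (catf (pt (a l)) (t k)))%E).

Lemma extends_exists n (Q : probability nat R) (t : nat -> 'I_n -> U) :
  exists Q' t', @extends n Q t Q' t'.
Proof.
have mT (A : set (nat * nat)) : measurable A by exact: measurable_section_union.
have mpk : measurable_fun (setT : set (nat * nat)) (pickle : nat * nat -> nat).
  by move=> _ Y _; exact: mT.
have [Q' Q'E] := pushforward_prob (Q \x p)%E mpk.
pose t2 (z : nat * nat) : 'I_n.+1 -> U := catf (pt (a z.2)) (t z.1).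
(* The default pair at numbers that code nothing is harmless, since the pushforward along [pickle]
   gives them no mass. *)
pose t' j := t2 (odflt (0%N, 0%N) (unpickle j)).
have t'K z : t' (pickle z) = t2 z by rewrite /t' pickleK.
exists Q', t'; split=> [A|g g0].
  rewrite Q'E /pushforward (_ : _ @^-1` _ = [set z | A (t2 z)]); last first.
    by apply/seteqP; split=> z /=; rewrite t'K.
  apply: eq_integral => k _ /=; congr (p _).
  by apply/seteqP; split=> l; rewrite /xsection /= inE.
transitivity (\int[pushforward (Q \x p)%E (pickle : nat * nat -> nat)]_j g (t' j))%E.
  by apply: eq_measure_integral => A _ _; exact: (congr1 (fun f => f A) Q'E).
rewrite ge0_integral_pushforward//= preimage_setT.
rewrite (fubini_tonelli1 (fun z : nat * nat => g (t' (pickle z)))).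
- by apply: eq_integral => k _; rewrite /fubini_F; apply: eq_integral => l _; rewrite t'K.
- by move=> _ Y _; exact: mT.
- by [].
Qed.

(** All atoms lie in N, so E_l, the set of b with (a_l, b) in D, is definable over N. Thus F(q) =
    p{l : E_l in q} makes sense on types, and it is measurable as the measure of the sections of a
    measurable set. *)
Lemma extends_morley n (Q Q' : probability nat R) (t : nat -> 'I_n -> U) (t' : nat -> 'I_n.+1 -> U)
    (nu : keisler R U n) (lam : keisler R U (1 + n)) :
  extends Q t Q' t' ->
  (forall D, def D -> (nu D)%:E = Q [set k | D (t k)]) ->
  (forall D, def D -> (lam D)%:E = Q' [set k | D (t' k)]) ->
  is_morley_product K mu nu lam.
Proof.
move=> [ext _] nuE lamE D M N [sM _] dM [sN _] MN dD.
have aN k : N (a k) by apply: MN; exact: atom_in_model dM.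
have def_fiber (b : 'I_n -> U) : def [set x | D (catf x b)].
  have [C [fC _ iD]] := definable_invariant hU dD.
  apply: (@invariant_definable _ _ (C `|` range b)) => //.
    by rewrite finite_setU; split=> //; exact: finite_image.
  move=> x x' [h1 h2]; apply: iD; split=> [i j|i c Cc].
    case: (split_ordP i) => i' ->; case: (split_ordP j) => j' ->;
      rewrite ?catf_lshift ?catf_rshift //; first by apply: h2; right; exists j'.
    rewrite (henson_symE hU (b _)) (henson_symE hU (b _)).
    have [|e1 e2] := h2 j' (b i'); first by right; exists i'.
    by split=> //; split=> /esym/e1/esym.
  by case: (split_ordP i) => i' ->; rewrite ?catf_lshift ?catf_rshift//; apply: h2; left.
pose E l : set ('I_n -> U) := [set b | D (catf (pt (a l)) b)].
have dE l : definable_over N (E l).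
  have [C [fC CN iD]] := definable_invariant hU dD.
  apply: (@invariant_definable _ _ (C `|` [set a l])) => //.
    by rewrite finite_setU.
    by rewrite subUset; split=> // _ ->.
  move=> b b' [h1 h2]; apply: iD; split=> [i j|i c Cc].
    case: (split_ordP i) => i' ->; case: (split_ordP j) => j' ->;
      rewrite ?catf_lshift ?catf_rshift //.
    - have [|e1 e2] := h2 j' (a l); first by right.
      rewrite !(henson_symE hU (pt (a l) i')).
      by split=> //; split=> /esym/e1/esym.
    - by apply: h2; right.
  by case: (split_ordP i) => i' ->; rewrite ?catf_lshift ?catf_rshift//; apply: h2; left.
pose tq k : stone N n := tp N (t k).
have mtq := measurable_nat_fun tq.
have [P PE] := pushforward_prob Q mtq.
pose B : set (stone N n * nat) := [set z | in_type z.1 (E z.2)].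
have mB : measurable B.
  apply: measurable_section_union => k; apply: sub_sigma_algebra.
  by exists (E k).
pose F (q : stone N n) : R := fine (p [set l | in_type q (E l)]).
have FE q : (F q)%:E = p (xsection B q).
  rewrite /F fineK ?fin_num_measure//; congr (p _).
  by apply/seteqP; split=> l; rewrite /xsection /= inE.
have Ftp b : F (tp N b) = mu [set x | D (catf x b)].
  apply: EFin_inj; rewrite muE// FE; congr (p _); apply/seteqP; split=> l.
    by rewrite /xsection /= inE => -[].
  by rewrite /xsection /= inE; split.
exists P, F; split=> //.
  move=> D' dD'; rewrite PE nuE; last exact: definable_overS dD'.
  rewrite /pushforward; congr (Q _); apply/seteqP; split=> k; first by case.
  by split.
rewrite lamE; last exact: definable_overS dD.
rewrite ext.
transitivity (\int[pushforward Q tq]_q (F q)%:E)%E; last first.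
  by apply: eq_measure_integral => A _ _; exact: (esym (congr1 (fun f => f A) PE)).
rewrite ge0_integral_pushforward//=.
- rewrite preimage_setT; apply: eq_integral => k _ /=.
  by rewrite Ftp muE.
- under eq_fun do rewrite FE.
  exact: measurable_fun_xsection.
- by move=> q _; rewrite lee_fin fine_ge0.
Qed.

Let state n := {Q : probability nat R & nat -> 'I_n.+1 -> U}.

Let next n (s : state n) : state n.+1 :=
  let h := cid (extends_exists (projT1 s) (projT2 s)) in
  existT _ (sval h) (sval (cid (svalP h))).

Fixpoint sample_state n : state n :=
  match n with
  | 0%N => existT _ p (fun k => pt (a k))
  | m.+1 => next (sample_state m)
  end.

Lemma sample_extends n : extends (projT1 (sample_state n)) (projT2 (sample_state n))
  (projT1 (sample_state n.+1)) (projT2 (sample_state n.+1)).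
Proof. exact: (svalP (cid (svalP (cid (extends_exists _ _))))). Qed.

(** The first power is mu itself because [are_morley_powers] asks for an equality there. *)
Definition power n : keisler R U n.+1 :=
  match n with
  | 0%N => mu
  | m.+1 => kprob (projT1 (sample_state m.+1)) (projT2 (sample_state m.+1))
  end.

Lemma powerE n D : def D ->
  (power n D)%:E = projT1 (sample_state n) [set k | D (projT2 (sample_state n) k)].
Proof. by case: n D => [|n] D dD; [exact: muE|exact: kprobE]. Qed.

Lemma power_morley : are_morley_powers K mu power.
Proof.
split=> // n; apply: extends_morley (sample_extends n) _ _; exact: powerE.
Qed.

(** * The weak law of large numbers in the Morley powers *)

Section law_of_large_numbers.
Variable B : set ('I_1 -> U).
Hypothesis dB : def B.
Let beta := mu B.
Let S : set nat := [set l | B (pt (a l))].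

Let pS : p S = beta%:E. Proof. by rewrite -muE. Qed.
Let beta01 : 0 <= beta <= 1.
Proof. by rewrite kmeas_ge0//= (kmeas_le1 hU). Qed.

Let hit (u : U) : R := (`[< B (pt u) >])%:R.

Let hitE l : hit (a l) = \1_S l.
Proof. by rewrite /hit indicE; congr (_%:R); congr nat_of_bool; apply/asboolP/idP; rewrite inE. Qed.

(** The shift c stands for the deviation accumulated by the older coordinates; the vanishing of the
    cross term is what makes variances add. *)
Lemma second_moment (c : R) :
  (\int[p]_l ((hit (a l) - beta + c) ^+ 2)%:E = (beta * (1 - beta) + c ^+ 2)%:E)%E.
Proof.
transitivity (\int[p]_l (((1 - beta + c) ^+ 2)%:E * (\1_S l)%:E + ((c - beta) ^+ 2)%:E * (\1_(~` S) l)%:E))%E.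
  apply: eq_integral => l _; rewrite hitE -!EFinM -EFinD; congr EFin.
  by rewrite !indicE in_setC; case: (_ \in S); rewrite /= ?mulr1n ?mulr0n; ring.
rewrite ge0_integralD//; last 2 first.
- by move=> l _; rewrite mule_ge0// lee_fin// sqr_ge0.
- by move=> l _; rewrite mule_ge0// lee_fin// sqr_ge0.
rewrite !ge0_integralZl_EFin ?sqr_ge0//.
have pC : p (~` S) = (1 - beta)%:E by rewrite probability_setC// pS -EFinB.
rewrite !integral_indic// !setIT.
transitivity (((1 - beta + c) ^+ 2)%:E * p S + ((c - beta) ^+ 2)%:E * p (~` S))%E => //.
by rewrite pC pS -!EFinM -EFinD; congr EFin; ring.
Qed.

Let dev n (x : 'I_n -> U) : R := \sum_i (hit (x i) - beta).

Lemma variance n : (\int[projT1 (sample_state n)]_k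
  ((dev (projT2 (sample_state n) k)) ^+ 2)%:E = (n.+1%:R * (beta * (1 - beta)))%:E)%E.
Proof.
elim: n => [|n IH].
  rewrite mul1r -[RHS]/((beta * (1 - beta))%:E) -[beta * _]addr0.
  rewrite -[X in _ + X](expr0n _ 2) -second_moment; apply: eq_integral => l _.
  by rewrite /dev big_ord_recl big_ord0 /= /pt.
have [_ /(_ (fun x => ((dev x) ^+ 2)%:E)) ->] := sample_extends n; last first.
  by move=> x; rewrite lee_fin sqr_ge0.
transitivity (\int[projT1 (sample_state n)]_k
   ((beta * (1 - beta))%:E + ((dev (projT2 (sample_state n) k)) ^+ 2)%:E))%E.
  apply: eq_integral => k _; rewrite -EFinD -second_moment; apply: eq_integral => l _.
  rewrite /dev big_ord_recl catf_pt0; congr ((_ + _) ^+ 2)%:E.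
  by apply: eq_bigr => i _; rewrite (catf_ptS (a l)).
have b0 : 0 <= beta * (1 - beta) by have /andP[? ?] := beta01; rewrite mulr_ge0// subr_ge0.
rewrite ge0_integralD//; last by move=> k _; rewrite lee_fin sqr_ge0.
rewrite IH integral_cst//.
transitivity ((beta * (1 - beta))%:E * projT1 (sample_state n) setT +
  (n.+1%:R * (beta * (1 - beta)))%:E)%E => //.
rewrite probability_setT mule1 -EFinD; congr EFin.
by rewrite -[n.+2%:R]natr1; ring.
Qed.

Lemma AvE n (x : 'I_n -> U) D : Av R x D = (\sum_i (`[< D (pt (x i)) >])%:R) / n%:R.
Proof.
rewrite /Av -sum1_card natr_sum big_mkcond; congr (_ / _); apply: eq_bigr => i _.
by rewrite inE; case: asboolP.
Qed.

Lemma dev_Av n (x : 'I_n.+1 -> U) : dev x = n.+1%:R * (Av R x B - beta).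
Proof.
rewrite AvE /dev sumrB sumr_const card_ord -[beta *+ _]mulr_natl mulrBr; congr (_ - _).
by rewrite mulrCA divff ?mulr1// pnatr_eq0.
Qed.

Definition deviates n (eta : R) : set ('I_n.+1 -> U) := [set x | eta <= `|Av R x B - beta|].

(** Bounding beta (1 - beta) by 1 makes the estimate the same for every B, as suits the union bound
    over sets of atoms. *)
Lemma chebyshev n (eta : R) : 0 < eta -> def (deviates (n := n) eta) ->
  power n (deviates eta) <= (eta ^+ 2 * n.+1%:R)^-1.
Proof.
move=> eta0 dd.
have n0 : 0 < n.+1%:R :> R by rewrite ltr0n.
set Q := projT1 (sample_state n); set t := projT2 (sample_state n).
pose c := (n.+1%:R * eta) ^+ 2.
pose W : set nat := [set k | deviates eta (t k)].
have h : (c%:E * Q W <= (n.+1%:R * (beta * (1 - beta)))%:E)%E.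
  rewrite -variance -/Q -/t -[W]setIT -(integral_indic Q measurableT)//.
  rewrite -ge0_integralZl_EFin ?sqr_ge0//.
  apply: ge0_le_integralT => k; first by rewrite -EFinM lee_fin mulr_ge0// sqr_ge0.
  rewrite -EFinM lee_fin indicE; case: (boolP (_ \in W)) => [|_]; last by rewrite mulr0 sqr_ge0.
  move=> /set_mem; rewrite /W /deviates /= mulr1 => hk.
  have {}hk : n.+1%:R * eta <= `|dev (t k)|.
    by rewrite dev_Av normrM (gtr0_norm n0) ler_pM2l.
  have ne0 : 0 <= n.+1%:R * eta by rewrite mulr_ge0// ltW.
  rewrite -[leRHS]real_normK ?num_real// /c.
  by apply: lerXn2r; rewrite ?nnegrE.
move: h; rewrite /W -powerE// -EFinM lee_fin.
have b1 : beta * (1 - beta) <= 1 by have /andP[? ?] := beta01; nra.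
have e2 : 0 < eta ^+ 2 by rewrite exprn_gt0.
move=> h; rewrite -[leRHS]mul1r ler_pdivlMr ?mulr_gt0// -(ler_pM2l n0) mulr1.
apply: (@le_trans _ _ (n.+1%:R * (beta * (1 - beta)))); last first.
  by rewrite -[leRHS]mulr1 ler_pM2l.
by apply: le_trans h; rewrite /c le_eqVlt; apply/orP; left; apply/eqP; ring.
Qed.

End law_of_large_numbers.

(** * Frequency formulas for a trivial measure *)

Section frequency_formula.
Variables (L : nat) (eta : R).
Hypothesis eta0 : 0 < eta.
Hypothesis tailL : 1 - \sum_(l < L) w l <= eta.

Definition atoms_in (S : {set 'I_L}) : set ('I_1 -> U) :=
  [set x | exists2 l : 'I_L, l \in S & x = pt (a l)].

Lemma definable_atoms_in S : def (atoms_in S).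
Proof.
apply: definable_finite => //; apply: (@sub_finite_set _ _ (range (fun l : 'I_L => pt (a l)))).
  by move=> x [l _ ->]; exists l.
exact: finite_image.
Qed.

(** Only the subsets of the first L atoms are tested, so this single formula serves every definable
    set at once. *)
Definition frequent n : set ('I_n.+1 -> U) :=
  [set x | forall S, ~ deviates (atoms_in S) eta x].

Lemma sim_atoms_in n (x x' : 'I_n -> U) S : sim (range (fun l : 'I_L => a l)) x x' ->
  Av R x (atoms_in S) = Av R x' (atoms_in S).
Proof.
move=> [_ h]; rewrite !AvE; congr (_ / _); apply: eq_bigr => i _; congr (_%:R).
congr nat_of_bool; apply: asbool_equiv_eq.
split=> -[l lS /(@pt_inj U) xl]; exists l => //; congr pt.
  by have [[-> //] _] := h i (a l) (ex_intro2 _ _ l I erefl).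
by have [[_ -> //] _] := h i (a l) (ex_intro2 _ _ l I erefl).
Qed.

Lemma definable_deviates n S : def (deviates (n := n) (atoms_in S) eta).
Proof.
apply: (@invariant_definable _ _ (range (fun l : 'I_L => a l))) => //; first exact: finite_image.
by move=> x x' xx'; rewrite /deviates /= (sim_atoms_in S xx').
Qed.

Lemma definable_frequent n : def (frequent (n := n)).
Proof.
apply: (@invariant_definable _ _ (range (fun l : 'I_L => a l))) => //; first exact: finite_image.
by move=> x x' xx' h S; rewrite /deviates /= -(sim_atoms_in S xx'); exact: h.
Qed.

Lemma frequent_ge n : 1 - (#|{set 'I_L}|%:R / (eta ^+ 2 * n.+1%:R)) <= power n (frequent (n := n)).
Proof.
have : power n (~` frequent (n := n)) <= #|{set 'I_L}|%:R / (eta ^+ 2 * n.+1%:R).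
  apply: (@le_trans _ _ (power n [set x | exists i : 'I_#|{set 'I_L}|,
      deviates (atoms_in (enum_val i)) eta x])).
    have dev_def := definable_deviates.
    apply: (content_le hU (keisler_content (power n))).
    - exact/definable_overC/definable_frequent.
    - exact: (definable_bigU hU).
    - move=> x nx; apply: contrapT => ne; apply: nx => S dS; apply: ne.
      by exists (enum_rank S); rewrite enum_rankK.
  apply: le_trans (content_bigU_le hU (keisler_content (power n)) _) _.
    by move=> i; exact: definable_deviates.
  apply: (@le_trans _ _ (\sum_(i < #|{set 'I_L}|) (eta ^+ 2 * n.+1%:R)^-1)); last first.
    by rewrite sumr_const card_ord -[leLHS]mulr_natl.
  apply: ler_sum => i _; apply: chebyshev => //.
    exact: definable_atoms_in.
  exact: definable_deviates.
rewrite (kmeasC hU); last exact: definable_frequent.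
by rewrite lerBlDr addrC -lerBlDr.
Qed.

(** D is compared with the set of its first L atoms: the measure loses at most eta, the tail, and
    the average loses at most the share of sample points outside the first L atoms, which is at most
    2 eta. *)
Lemma frequent_approx n (x : 'I_n.+1 -> U) D : frequent x -> def D ->
  `|mu D - Av R x D| <= 3 * eta.
Proof.
move=> fx dD.
have wc : cvgn (series w) by apply/cvg_ex; exists 1.
have wlim : limn (series w) = 1 by exact/cvg_lim.
pose S := finset (fun l : 'I_L => `[< D (pt (a l)) >]).
have dS := definable_atoms_in S.
have near S' : `|Av R x (atoms_in S') - mu (atoms_in S')| < eta.
  by rewrite ltNge; apply/negP; exact: fx.
have SD : atoms_in S `<=` D by move=> y [l]; rewrite inE => /asboolP ? ->.
have tail0 E : def E -> (forall l : 'I_L, ~ E (pt (a l))) -> mu E <= eta.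
  move=> dE nE; rewrite mu_disc//; apply: le_trans tailL; rewrite -wlim.
  by apply: disc_tail => // k kL; exact: (nE (Ordinal kL)).
have h1 : mu (atoms_in S) <= mu D by exact: (content_le hU (keisler_content mu)).
have h2 : mu D <= mu (atoms_in S) + eta.
  rewrite (content_split hU (keisler_content mu) dD dS); apply: lerD.
    apply: (content_le hU (keisler_content mu)) => //; exact: (definableI hU).
  apply: tail0; first exact: (definableD hU).
  by move=> l [Dl]; apply; exists l => //; rewrite inE; apply/asboolP.
have h3 : 1 - eta <= mu (atoms_in [set: 'I_L]%SET).
  have := tail0 (~` atoms_in [set: 'I_L]%SET) (definable_overC (definable_atoms_in _)) _.
  rewrite (kmeasC hU); last exact: definable_atoms_in.
  by move=> h; have {}h := h (fun l nl => nl (ex_intro2 _ _ l (finset.in_setT l) erefl)); lra.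
have n0 : 0 < n.+1%:R^-1 :> R by rewrite invr_gt0.
have h4 : Av R x (atoms_in S) <= Av R x D.
  rewrite !AvE ler_pM2r//; apply: ler_sum => i _.
  by case: asboolP => [/SD Di|_]; [rewrite asboolT|].
have h5 : Av R x D <= Av R x (atoms_in S) + (1 - Av R x (atoms_in [set: 'I_L]%SET)).
  have one : 1 = (\sum_(i < n.+1) 1) / n.+1%:R :> R.
    by rewrite sumr_const card_ord divff// pnatr_eq0.
  rewrite !AvE [X in _ + (X - _)]one -mulrBl -mulrDl ler_pM2r// -sumrB -big_split /=.
  apply: ler_sum => i _.
  case: (asboolP (atoms_in [set: 'I_L]%SET _)) => [[l _ xl]|_]; last first.
    by rewrite subr0; case: (`[< _ >]); case: (`[< _ >]); rewrite /= ?mulr1n ?mulr0n; lra.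
  rewrite subrr addr0; case: (asboolP (D _)) => [Di|_].
    rewrite asboolT//; exists l => //; rewrite inE; apply/asboolP.
    by rewrite -xl.
  by rewrite mulr0n ler0n.
have := near S; have := near [set: 'I_L]%SET; rewrite !ltr_norml => /andP[h6 h7] /andP[h8 h9].
by rewrite ler_norml; apply/andP; split; lra.
Qed.

End frequency_formula.

Lemma power_fim m (phi : fmla (1 + m)) :
  exists theta : forall n, set ('I_n.+1 -> U),
      [/\ forall n, definable_over setT (theta n),
          forall eps : R, 0 < eps -> exists n0, forall n, (n0 <= n)%N ->
            forall x, theta n x -> forall b : 'I_m -> U,
              `|mu (inst phi b) - Av R x (inst phi b)| < eps &
          (fun n => power n (theta n)) @ \oo --> (1 : R)].
Proof.
pose eta (j : nat) : R := j.+1%:R^-1.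
have eta0 j : 0 < eta j by rewrite invr_gt0.
have small (e : R) : 0 < e -> exists j0 : nat, forall j, (j0 <= j)%N -> eta j < e.
  move=> e0; exists (Num.truncn e^-1) => j j0.
  rewrite /eta invf_plt ?posrE//; apply: lt_le_trans (truncnS_gt _) _.
  by rewrite ler_nat ltnS.
have /choice[L HL] := fun j => trivial_tail w1 (eta0 j).
(* The numerator of the failure bound at precision [eta j]; beyond [n0 j] the failure probability is
   at most [eta j]. *)
pose c j : R := #|{set 'I_(L j)}|%:R / eta j ^+ 2.
have c0 j : 0 <= c j by rewrite divr_ge0// sqr_ge0.
have /choice[n0 Hn0] : forall j, exists n0 : nat, forall n, (n0 <= n)%N -> c j / n.+1%:R <= eta j.
  move=> j; exists (Num.truncn (c j / eta j)) => n jn.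
  rewrite ler_pdivrMr// mulrC -ler_pdivrMr//.
  by apply/ltW/(lt_le_trans (truncnS_gt _)); rewrite ler_nat ltnS.
(* A single sequence theta_n must serve all eps, so the precision [eta (J n)] improves slowly with
   n. *)
have [J HJ] := diagonal_index n0.
exists (fun n => frequent (L (J n)) (eta (J n)) (n := n)); split.
- by move=> n; exact: definable_frequent.
- move=> e e0; have e3 : 0 < e / 3 by lra.
  have [j0 Hj0] := small _ e3; have [k Hk] := HJ j0; exists k => n kn x fx b.
  have [/Hj0 h _] := Hk n kn.
  have db : def (inst phi b) by exists m, phi, b.
  by apply: le_lt_trans (frequent_approx (HL _) fx db) _; lra.
- apply/cvgrPdist_le => e e0.
  have [j0 Hj0] := small _ e0; have [k Hk] := HJ j0; exists k => // n kn.
  have [/Hj0 h hn] := Hk n kn.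
  have dF := definable_frequent (L (J n)) (eta (J n)) n.
  rewrite ger0_norm; last by rewrite subr_ge0 (kmeas_le1 hU).
  have := frequent_ge (L (J n)) (eta0 (J n)) n.
  rewrite invfM mulrA -/(c (J n)) lerBlDr -lerBlDl => hf.
  exact: le_trans hf (le_trans (Hn0 (J n) n hn) (ltW h)).
Qed.

End trivial_fim.

Section trivial_is_fim.
Variables (R : realType) (r : nat) (U : structure) (K : Type).
Hypothesis hU : henson r U.
Hypothesis r_gt1 : (1 < r)%N.
Hypothesis K_uncountable : ~ countable [set: K].
Hypothesis U_saturated : saturated U K.

Lemma trivial_dfs (mu : keisler R U 1) : is_trivial mu -> is_dfs K mu.
Proof.
move=> tr; apply: (fam_dfs hU).
apply: (representation_fam hU r_gt1 K_uncountable (t := 0) _ tr); first by rewrite lexx ler01.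
by move=> D _; rewrite mul0r add0r subr0 mul1r.
Qed.

(** Points of weight 0 are arbitrary and might lie outside a model over which mu is definable;
    replacing them by one genuine atom makes [atom_in_model] apply to every index. *)
Lemma trivial_normal (mu : keisler R U 1) : is_trivial mu ->
  exists (w : nat -> R) (a : nat -> U), [/\ forall k, 0 <= w k, series w @ \oo --> (1 : R),
    forall D, definable_over setT D -> mu D = disc w a D & forall k, 0 < mu [set pt (a k)]].
Proof.
move=> [w [a [w0 w1 wmu]]]; have muE := trivial_disc wmu.
have wc : cvgn (series w) by apply/cvg_ex; exists 1.
have atom k : 0 < w k -> 0 < mu [set pt (a k)].
  by move=> wk; rewrite muE; [apply: lt_le_trans wk _; exact: disc_ge|exact: definable_point].
have [k0 wk0] : exists k0, 0 < w k0.
  apply: contrapT => ne; have wE k : w k = 0.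
    apply/eqP; rewrite eq_le w0 andbT leNgt; apply/negP => wk; apply: ne.
    by exists k.
  have : limn (series w) = 1 by exact/cvg_lim.
  rewrite (_ : series w = cst 0) ?lim_cst//; first by move/eqP; rewrite eq_sym oner_eq0.
  by apply/funext => n; rewrite /series /= big1.
exists w, (fun k => if 0 < w k then a k else a k0); split=> //.
  move=> D dD; rewrite muE// /disc; congr (limn (series _)); apply/funext => k.
  case: ifP => // /negbT; rewrite -leNgt => wk.
  by rewrite (_ : w k = 0) ?mul0r//; apply/eqP; rewrite eq_le wk w0.
by move=> k; case: ifP => [/atom//|_]; exact: atom.
Qed.

Lemma trivial_is_fim (mu : keisler R U 1) : is_trivial mu -> is_fim K mu.
Proof.
move=> tr; split; first by have [M [sM dM _]] := trivial_dfs tr; exists M.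
have [w [a [w0 w1 muE aat]]] := trivial_normal tr.
pose p := discrete_probability w0 w1.
have mup D : definable_over setT D -> (mu D)%:E = p [set k | D (pt (a k))].
  move=> dD; rewrite muE// -[RHS]/(discrete_prob w0 [set k | D (pt (a k))]).
  rewrite (discrete_probE w0 w1) /disc.
  suff -> : (fun k => w k * \1_D (pt (a k))) = (fun k => w k * \1_[set k | D (pt (a k))] k) by [].
  apply/funext => k; rewrite !indicE.
  have -> // : (pt (a k) \in D) = (k \in [set k | D (pt (a k))]).
  by apply/idP/idP; rewrite !inE.
exists (power hU mu p a); first exact: power_morley mup aat.
by move=> m phi; exact: power_fim mup m phi.
Qed.

End trivial_is_fim.

Theorem theorem5p10 (R : realType) (s : nat) (K : Type) (U : structure) :
  (3 <= s)%N -> monster U K (T2 s) ->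
  let avoids_all (p : ctype (U := U) setT 1) : Prop :=
    forall b : U, in_type p [set x | ~ edge (x ord0) b] in
  (exists! pE, avoids_all pE) /\
  forall pE, avoids_all pE ->
    ([set mu : keisler R U 1 | is_fam K mu] = [set mu : keisler R U 1 | is_dfs K mu] /\
     [set mu : keisler R U 1 | is_dfs K mu] =
     [set nu : keisler R U 1 | exists (r : R) (mu : keisler R U 1),
        [/\ 0 <= r <= 1, is_trivial mu &
            forall D, definable_over setT D ->
              nu D = r * \1_(in_type pE) D + (1 - r) * mu D]]) /\
    [set mu : keisler R U 1 | is_fim K mu] = [set mu : keisler R U 1 | is_trivial mu].
Proof.
case: s => // r r_gt1 [UT K_unc U_sat _] avoids_all.
have hU := henson_of_T2 UT.
split.
  exists (pE hU r_gt1); split; first by move=> b; exact: pE_avoids.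
  by move=> p; exact: pE_unique.
move=> pE0 /(avoids_pE hU r_gt1) pE0P.
have -> : in_type pE0 = @pE_set U by apply/seteqP; split=> D /pE0P.
have dfs_rep mu : is_dfs K mu -> exists (t : R) (nu : keisler R U 1),
    [/\ 0 <= t <= 1, is_trivial nu &
    forall D, definable_over setT D -> mu D = t * \1_(@pE_set U) D + (1 - t) * nu D].
  exact: (dfs_representation hU r_gt1 U_sat).
have rep_fam (mu : keisler R U 1) : (exists (t : R) (nu : keisler R U 1),
    [/\ 0 <= t <= 1, is_trivial nu &
    forall D, definable_over setT D -> mu D = t * \1_(@pE_set U) D + (1 - t) * nu D]) ->
    is_fam K mu.
  by move=> [t [nu [t01 nutr muE]]]; exact: (representation_fam hU r_gt1 K_unc t01 nutr muE).
split; [split|]; apply/seteqP; split=> mu /=.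
- exact: (fam_dfs hU).
- by move=> /dfs_rep/rep_fam.
- exact: dfs_rep.
- by move=> /rep_fam; exact: (fam_dfs hU).
- exact: (fim_is_trivial hU r_gt1 K_unc U_sat).
- exact: (trivial_is_fim hU r_gt1 K_unc U_sat).
Qed.
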